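(* Let $p\in(1,\infty)$, $\alpha\ge0$, fix either choice of sign $\pm$, and consider on the necklace graph $\Gamma$ the equation $$\partial_t^2u(x,t)-\partial_x^2u(x,t)+\alpha u(x,t)=\pm|u(x,t)|^{p-1}u(x,t).\qquad(\ast)$$ Let $u$ be a real-valued weak solution of $(\ast)$ that is $2\pi$-antiperiodic in time, belongs to $H^1_c(\Gamma\times\mathbb{T})\cap H^2(\Gamma\times\mathbb{T})$ with $\mathbb{T}=\mathbb{R}/4\pi\mathbb{Z}$, is symmetric with respect to the upper/lower semicircles ($u_+=u_-$), satisfies $(\ast)$ pointwise a.e. on $\Gamma\times\mathbb{T}$, and satisfies the continuity conditions (C) and the Kirchhoff conditions (K) for almost all $t\in\mathbb{T}$. Then $u\in L^2(\mathbb{T};H^1_c(\Gamma))\cap H^2(\mathbb{T};L^2(\Gamma))$, and $u$ solves $(\ast)$ in the sense that for almost all $t\in(0,\infty)$ $$\int_\Gamma\left(\partial_t^2u\,\varphi+\partial_xu\,\partial_x\varphi+\alpha u\varphi\mp|u|^{p-1}u\varphi\right)dx=0\qquad\text{for all }\varphi\in H^1_c(\Gamma),$$ with its own initial values $u(\cdot,0)\in L^2(\Gamma)$ and $\partial_tu(\cdot,0)\in L^2(\Gamma)$ in the sense of traces. As a consequence of this identity, the continuity conditions (C) and the Kirchhoff conditions (K) hold for almost all $t\in\mathbb{T}$. Here, for all $n\in\mathbb{Z}$, (C) is $$u_0(2\pi n+\pi,t)=u_+(2\pi n+\pi,t)=u_-(2\pi n+\pi,t),\quad u_0(2\pi(n+1),t)=u_+(2\pi(n+1),t)=u_-(2\pi(n+1),t),$$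 and (K) is $$\partial_xu_0(2\pi n+\pi,t)=\partial_xu_+(2\pi n+\pi,t)+\partial_xu_-(2\pi n+\pi,t),$$ $$\partial_xu_0(2\pi(n+1),t)=\partial_xu_+(2\pi(n+1),t)+\partial_xu_-(2\pi(n+1),t).$$
   Context: Necklace graph: $\Gamma=\oplus_{n\in\mathbb{Z}}\Gamma_n$, $\Gamma_n=\Gamma_{n,0}\oplus\Gamma_{n,+}\oplus\Gamma_{n,-}$, where the edge $\Gamma_{n,0}$ is identified isometrically with $I_{n,0}=[2\pi n,2\pi n+\pi]$ and each of the two parallel edges $\Gamma_{n,\pm}$ (upper and lower semicircle) with $I_{n,\pm}=[2\pi n+\pi,2\pi(n+1)]$. At the vertex $2\pi n+\pi$ the right end of $\Gamma_{n,0}$ is joined to the left ends of $\Gamma_{n,\pm}$; at the vertex $2\pi(n+1)$ the right ends of $\Gamma_{n,\pm}$ are joined to the left end of $\Gamma_{n+1,0}$. A function $u$ on $\Gamma$ is represented by a triple $(u_0,u_+,u_-)$ with $u|_{\Gamma_{n,j}}=u_j|_{I_{n,j}}$ and $\operatorname{supp}u_j\subseteq\bigcup_nI_{n,j}$; values (and derivatives) of $u_j$ at a vertex are one-sided limits/traces from the adjoining edge of type $j$. Derivatives in $x$ are taken edge-wise, and $\int_\Gamma$ is the sum of the integrals over all edges. Function spaces: $H^k(\Gamma\times\mathbb{T})$ consists of functions whose restriction to every $I_{n,j}\times\mathbb{T}$ lies in $H^k(I_{n,j}\times\mathbb{T})$ with $\sum_{n,j}\|u_j|_{I_{n,j}\times\mathbb{T}}\|_{H^k}^2<\infty$.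 $H^1_c(\Gamma\times\mathbb{T})$ is the space of $u\in H^1(\Gamma\times\mathbb{T})$ whose traces on (vertices)$\times\mathbb{T}$ from all adjoining edges coincide. $L^2(\Gamma)$ and $H^1(\Gamma)$ are defined edge-wise in the same way without $t$, and $H^1_c(\Gamma)=H^1(\Gamma)\cap C(\Gamma)$, i.e. $H^1(\Gamma)$-functions that are continuous at all vertices. Weak solution: a time-periodic $u\in H^1_c(\Gamma\times\mathbb{T})$ is a weak solution of $(\ast)$ if $$\int_{\Gamma\times\mathbb{T}}\left(\partial_xu\,\partial_x\phi-\partial_tu\,\partial_t\phi+\alpha u\phi\mp|u|^{p-1}u\phi\right)d(x,t)=0$$ for every time-periodic $\phi\in H^1_c(\Gamma\times\mathbb{T})$. *)

(* Defs.v *)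
From HB Require Import structures.
From mathcomp Require Import all_boot all_order all_algebra.
From mathcomp Require Import all_classical all_reals all_analysis.
From mathcomp Require Import measurable_realfun.

Set Implicit Arguments.
Unset Strict Implicit.
Unset Printing Implicit Defensive.

Import Order.TTheory GRing.Theory Num.Theory.
Import numFieldNormedType.Exports.

Local Open Scope classical_set_scope.
Local Open Scope ring_scope.

(** * The necklace graph *)

Inductive branch := mid | up | low.

(* Functions on the graph, and functions of (x, t), as triples (u_0, u_+, u_-).
   Every notion below looks at the component j only over the union [gdom j] of
   the intervals I_{n,j}: the values elsewhere are irrelevant, so no support
   condition is imposed. *)
Definition gfun (R : realType) := branch -> R -> R.
Definition gfun2 (R : realType) := branch -> R * R -> R.

Section Graph.
Variable R : realType.
Implicit Types (n : int) (j : branch).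

(* the two families of vertices 2 pi n + pi and 2 pi (n + 1) *)
Definition va n : R := 2 * pi * n%:~R + pi.
Definition vb n : R := 2 * pi * (n + 1)%:~R.

Definition lend n j : R := if j is mid then 2 * pi * n%:~R else va n.
Definition rend n j : R := if j is mid then va n else vb n.

Definition edge n j : set R := `[lend n j, rend n j]%classic.
Definition gdom j : set R := \bigcup_n edge n j.

(* One period of the circle R / 4 pi Z.  Functions on the circle are functions
   on R with period 4 pi. *)
Definition torus : set R := `[0, 4 * pi]%classic.

Local Notation mu := (@lebesgue_measure R).
Local Notation mu2 := (mu \x mu)%E.

(* Integral over the graph.  The edges of one type only overlap in null sets,
   so that the integral over [gdom j] is the sum of those over the edges. *)
Definition gint (f : gfun R) : \bar R :=
  (\int[mu]_(x in gdom mid) (f mid x)%:E + \int[mu]_(x in gdom up) (f up x)%:E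
   + \int[mu]_(x in gdom low) (f low x)%:E)%E.

Definition gint2 (f : gfun2 R) : \bar R :=
  (\int[mu2]_(z in gdom mid `*` torus) (f mid z)%:E
   + \int[mu2]_(z in gdom up `*` torus) (f up z)%:E
   + \int[mu2]_(z in gdom low `*` torus) (f low z)%:E)%E.

Definition gae2 (P : branch -> R * R -> Prop) :=
  forall j, \forall z \ae mu2, (gdom j `*` torus) z -> P j z.

Definition slice (u : gfun2 R) (t : R) : gfun R := fun j x => u j (x, t).

(** * One-sided limits and traces *)

(* [f @ ess_within A c --> l] is the limit of f at c along A, up to null sets:
   for c an end point of the interval A it is the one-sided limit, from A, of
   the continuous representative of f (if there is one). *)
Definition ess_within (A : set R) (c : R) : set_system R :=
  [set P | exists2 d : R, 0 < d &
     \forall x \ae mu, A x -> `|x - c| < d -> P x].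

(* value at the end point c of the edge (n, j), taken from that edge *)
Definition vertex_value (f : gfun R) n j (c l : R) :=
  f j @ ess_within (edge n j) c --> l.

(* V n j c a : "a is the value at c taken from the edge (n, j)"; the three
   values at each vertex coincide. *)
Definition glued (A : Type) (V : int -> branch -> R -> A -> Prop) :=
  forall n,
    (exists a, [/\ V n mid (va n) a, V n up (va n) a & V n low (va n) a]) /\
    (exists a, [/\ V (n + 1) mid (vb n) a, V n up (vb n) a & V n low (vb n) a]).

Definition continuous_at_vertices (f : gfun R) := glued (vertex_value f).

Definition kirchhoff (g : gfun R) := forall n,
  (exists a b c : R,
    [/\ vertex_value g n mid (va n) a, vertex_value g n up (va n) b,
        vertex_value g n low (va n) c & a = b + c]) /\
  (exists a b c : R,
    [/\ vertex_value g (n + 1) mid (vb n) a, vertex_value g n up (vb n) b,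
        vertex_value g n low (vb n) c & a = b + c]).

(* g in L^2(T) is the trace on {c} x T of u, from the edge (n, j) *)
Definition xtrace (u : gfun2 R) n j (c : R) (g : R -> R) :=
  [/\ measurable_fun setT g, (forall t, g (t + 4 * pi) = g t),
      (\int[mu]_(t in torus) (g t ^+ 2)%:E < +oo)%E &
      (fun x => \int[mu]_(t in torus) ((u j (x, t) - g t) ^+ 2)%:E)%E
        @ ess_within (edge n j) c --> 0%E].

(** * Function spaces on the graph *)

Definition L2G (f : gfun R) :=
  (forall j, measurable_fun (gdom j) (f j)) /\
  (gint (fun j x => (f j x ^+ 2)%R) < +oo)%E.

Definition ipL2 (f g : gfun R) : \bar R := gint (fun j x => f j x * g j x).

Definition C1c (a b : R) (phi : R -> R) :=
  [/\ forall x, derivable phi x 1, continuous (derive1 phi) &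
      exists a' b', [/\ a < a', b' < b &
        forall x, ~ (a' <= x <= b') -> phi x = 0]].

(* g is the edge-wise weak derivative of f *)
Definition weak_deriv (f g : gfun R) := forall n j phi,
  C1c (lend n j) (rend n j) phi ->
  (\int[mu]_(x in edge n j) (f j x * derive1 phi x)%:E
   = - \int[mu]_(x in edge n j) (g j x * phi x)%:E)%E.

(* the weak derivative, if there is one in L^2 *)
Definition dw (f : gfun R) : gfun R :=
  xget (fun _ _ => 0) [set g | L2G g /\ weak_deriv f g].

Definition H1G (f : gfun R) :=
  L2G f /\ exists g, L2G g /\ weak_deriv f g.

Definition H1cG (f : gfun R) := H1G f /\ continuous_at_vertices f.

Definition ipH1 (f g : gfun R) : \bar R := (ipL2 f g + ipL2 (dw f) (dw g))%E.

(** * Function spaces on the product of the graph and the circle *)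

Definition L2GT (u : gfun2 R) :=
  [/\ forall j, measurable_fun (gdom j `*` setT) (u j),
      forall j x t, u j (x, t + 4 * pi) = u j (x, t) &
      (gint2 (fun j z => (u j z ^+ 2)%R) < +oo)%E].

(* partial derivatives: in x for b = false, in t for b = true *)
Definition pder (b : bool) (phi : R * R -> R) (z : R * R) : R :=
  if b then derive1 (fun t => phi (z.1, t)) z.2
  else derive1 (fun x => phi (x, z.2)) z.1.
Definition pderivable (b : bool) (phi : R * R -> R) (z : R * R) : Prop :=
  if b then derivable (fun t => phi (z.1, t)) z.2 1
  else derivable (fun x => phi (x, z.2)) z.1 1.
Definition pders (s : seq bool) (phi : R * R -> R) := foldr pder phi s.
Definition pderij (i k : nat) := pders (nseq i false ++ nseq k true).

Definition Cm2 (m : nat) (phi : R * R -> R) := forall s : seq bool,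
  ((size s <= m)%N -> continuous (pders s phi)) /\
  ((size s < m)%N -> forall b z, pderivable b (pders s phi) z).

(* C^m functions with compact support in (a, b) x T *)
Definition Cm2c (m : nat) (a b : R) (phi : R * R -> R) :=
  [/\ Cm2 m phi, (forall x t, phi (x, t + 4 * pi) = phi (x, t)) &
      exists a' b', [/\ a < a', b' < b &
        forall x t, ~ (a' <= x <= b') -> phi (x, t) = 0]].

(* g is the weak derivative of u of order i in x and k in t on every I_{n,j} x T;
   as usual the test functions are of class C^{i + k}. *)
Definition weak_pderiv (i k : nat) (u g : gfun2 R) := forall n j phi,
  Cm2c (i + k) (lend n j) (rend n j) phi ->
  (\int[mu2]_(z in edge n j `*` torus) (u j z * pderij i k phi z)%:E
   = ((-1) ^+ (i + k))%:E
     * \int[mu2]_(z in edge n j `*` torus) (g j z * phi z)%:E)%E.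

(* the weak derivative of order i in x and k in t, if there is one in L^2 *)
Definition Dw (i k : nat) (u : gfun2 R) : gfun2 R :=
  xget (fun _ _ => 0) [set g | L2GT g /\ weak_pderiv i k u g].

Definition HGT (m : nat) (u : gfun2 R) :=
  L2GT u /\ forall i k, (i + k <= m)%N ->
    exists g, L2GT g /\ weak_pderiv i k u g.

Definition H1cGT (u : gfun2 R) := HGT 1 u /\ glued (xtrace u).

(** * Spaces of functions of time with values in a function space *)

Definition ae_measurable (f : R -> \bar R) :=
  exists2 g : R -> \bar R, measurable_fun setT g &
    \forall t \ae mu, torus t -> f t = g t.

(* L^2(T; X) for a separable Hilbert space X with inner product ip.  By Pettis'
   theorem strong measurability is measurability of all t |-> (w(t), phi)_X. *)
Definition bochner_L2 (X : set (gfun R)) (ip : gfun R -> gfun R -> \bar R)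
    (w : R -> gfun R) :=
  [/\ \forall t \ae mu, torus t -> X (w t),
      forall phi, X phi -> ae_measurable (fun t => ip (w t) phi) &
      (\int[mu]_(t in torus) ip (w t) (w t) < +oo)%E].

(* C^m functions on the circle *)
Definition CmT (m : nat) (psi : R -> R) :=
  [/\ forall i, (i <= m)%N -> continuous (derive1n i psi),
      forall i, (i < m)%N -> forall t, derivable (derive1n i psi) t 1 &
      forall t, psi (t + 4 * pi) = psi t].

(* H^m(T; L^2(G)); the identity \int w psi^(i) dt = (-1)^i \int v psi dt of
   elements of L^2(G) is tested with the elements of L^2(G). *)
Definition bochner_Hm (m : nat) (w : R -> gfun R) :=
  bochner_L2 L2G ipL2 w /\
  forall i, (i <= m)%N -> exists2 v, bochner_L2 L2G ipL2 v &
    forall psi phi, CmT i psi -> L2G phi ->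
      (\int[mu]_(t in torus) (ipL2 (w t) phi * (derive1n i psi t)%:E)
       = ((-1) ^+ i)%:E
         * \int[mu]_(t in torus) (ipL2 (v t) phi * (psi t)%:E))%E.

(* f in L^2(G) is the trace of w at the time t0 *)
Definition time_trace (w : R -> gfun R) (t0 : R) (f : gfun R) :=
  L2G f /\
  (fun t => gint (fun j x => (w t j x - f j x) ^+ 2))
    @ ess_within setT t0 --> 0%E.

(** * The equation *)

(* the right-hand side, with the sign + for s = false and - for s = true *)
Definition nonlin (s : bool) (p v : R) : R :=
  (-1) ^+ s * (`|v| `^ (p - 1) * v).

Definition antiperiodic_2pi (u : gfun2 R) :=
  gae2 (fun j z => u j (z.1, z.2 + 2 * pi) = - u j z).

Definition up_low_symmetric (u : gfun2 R) := gae2 (fun _ z => u up z = u low z).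

Definition weak_solution (s : bool) (p alpha : R) (u : gfun2 R) :=
  H1cGT u /\ forall phi, H1cGT phi ->
    gint2 (fun j z =>
      Dw 1 0 u j z * Dw 1 0 phi j z - Dw 0 1 u j z * Dw 0 1 phi j z
      + alpha * u j z * phi j z - nonlin s p (u j z) * phi j z) = 0%E.

Definition pointwise_solution (s : bool) (p alpha : R) (u : gfun2 R) :=
  gae2 (fun j z =>
    Dw 0 2 u j z - Dw 2 0 u j z + alpha * u j z = nonlin s p (u j z)).

(* the identity, for almost all t > 0, of an evolutionary solution *)
Definition evolution_identity (s : bool) (p alpha : R) (u : gfun2 R) :=
  \forall t \ae mu, 0 < t -> forall phi, H1cG phi ->
    gint (fun j x =>
      Dw 0 2 u j (x, t) * phi j x + Dw 1 0 u j (x, t) * dw phi j x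
      + alpha * u j (x, t) * phi j x - nonlin s p (u j (x, t)) * phi j x) = 0%E.

(* L^2(T; H^1_c(G)) /\ H^2(T; L^2(G)) *)
Definition evolution_space (u : gfun2 R) :=
  bochner_L2 H1cG ipH1 (slice u) /\ bochner_Hm 2 (slice u).

Definition condC (u : gfun2 R) :=
  \forall t \ae mu, torus t -> continuous_at_vertices (slice u t).

Definition condK (u : gfun2 R) :=
  \forall t \ae mu, torus t -> kirchhoff (slice (Dw 1 0 u) t).

End Graph.

(* Main.v *)
Require Import Defs.
From mathcomp Require Import all_boot all_order all_algebra.
From mathcomp Require Import all_classical all_reals all_analysis.
From mathcomp Require Import measurable_realfun ring lra zify.

(** The proof works with absolutely continuous representatives.  A weak derivative
is tested with products of two plateaus, one in x and one in t, with rational end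
points.  Fubini and the lemma of du Bois-Reymond, applied to each of these
countably many test functions, turn a weak x-derivative g of w on an edge times
the circle into the statement that for almost every t the section of w is a
constant plus a primitive of the section of g ([weak_tensor_AC_x]), and likewise
for t ([weak_tensor_AC_t]).  Hence for almost every t the sections of u and of
its first and second x-derivatives form an H^2 function on every edge.

If u solves the equation pointwise, then for almost every t and every phi in
H^1_c the integrand of the evolution identity is almost everywhere
(u_xx phi + u_x phi'), the derivative of u_x phi.  Its integral over the graph is
0 ([graph_green]): on the 2 N edges of each type next to the origin it telescopes,
by the Kirchhoff conditions for u_x and the continuity of phi, to the difference
of two values of u_x phi, which tends to 0 since u_x phi and its derivative are
integrable.  Periodicity extends this to almost every t > 0.

The membership in L^2(T; H^1_c) and H^2(T; L^2) is Fubini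
([bochner_L2_H1c], [bochner_Hm_slice]).  For the traces at t = 0, let w be u or u_t,
with time derivative g.  A section w(x, .) is C plus the primitive of g(x, .), so
the value at 0 is the mean of w - (4 pi - t) g over a period, and by the
Cauchy-Schwarz inequality |w(x, t) - C|^2 <= |t| \int g(x, .)^2
([mean_zero_bound], [trace0_trace]).

Conversely, in the evolution identity let phi be, on all edges, a bump of height
1 at a vertex c whose width tends to 0.  Integrating by parts on the three edges
at c leaves the signed sum of the three values of u_x at c, plus the
integrals of an integrable function against the bumps, which tend to 0
([vertex_balance]).  So the signed sum is 0, which is the Kirchhoff
condition; the continuity conditions are part of u(t) being in H^1_c. *)

Set Implicit Arguments.
Unset Strict Implicit.
Unset Printing Implicit Defensive.

Import Order.TTheory GRing.Theory Num.Theory.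
Import numFieldNormedType.Exports.

Local Open Scope classical_set_scope.
Local Open Scope ring_scope.

(** * Spline plateaus as test functions *)

Section Spline.
Variable R : realType.
Implicit Types (x y c d k : R) (i n : nat).

(** The truncated power max(x, 0)^n. *)
Definition ppow n x : R := Num.max x 0 ^+ n.

Lemma ppow_ge0 n x : 0 <= x -> ppow n x = x ^+ n.
Proof. by move=> x0; rewrite /ppow max_l. Qed.

Lemma ppow_le0 n x : x <= 0 -> ppow n.+1 x = 0.
Proof. by move=> x0; rewrite /ppow max_r// expr0n. Qed.

Lemma continuous_ppow n : continuous (ppow n).
Proof.
move=> x; rewrite /ppow; apply: (@continuous_comp _ _ _ (fun x => Num.max x 0) (fun x => x ^+ n)); last exact: exprn_continuous.
apply: continuous_max; [exact: cvg_id|exact: cvg_cst].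
Qed.

Lemma is_derive_ppow n x : is_derive x 1 (ppow n.+2) (n.+2%:R * ppow n.+1 x).
Proof.
have [x0|x0|->] := ltrgtP x 0.
- rewrite ppow_le0 ?ltW// mulr0.
  have H : \near x, cst 0 x = ppow n.+2 x.
    near=> y; rewrite ppow_le0//; apply/ltW; near: y; exact: lt_nbhsl.
  apply: (near_eq_is_derive H); exact: is_derive_cst.
- rewrite ppow_ge0 ?ltW//.
  have H : \near x, x ^+ n.+2 = ppow n.+2 x.
    near=> y; rewrite ppow_ge0//; apply/ltW; near: y; exact: lt_nbhsr.
  apply: (near_eq_is_derive H).
  have := @is_deriveX R _ id n.+2 x 1 1 (is_derive_id _ _).
  have -> : (id : R -> R) ^+ n.+2 = (fun y => y ^+ n.+2) by apply/funext => y; rewrite exprfctE.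
  by move=> /is_derive_eq; apply; rewrite /GRing.scale/= mulr1.
- rewrite {2}/ppow maxxx expr0n/= mulr0.
  have H : h^-1 *: ((ppow n.+2 \o shift 0) (h *: 1%R) - ppow n.+2 0) @[h --> 0^'] --> (0:R).
    apply/cvgr0Pnorm_le => e e0.
    near=> h.
    rewrite /= [ppow _ 0]ppow_le0// subr0 addr0 normrM.
    apply: (@le_trans _ _ (`|h|^-1 * `|h| ^+ n.+2)).
      rewrite normfV ler_wpM2l ?invr_ge0//.
      rewrite /ppow [_%:A]mulr1 [X in X <= _]ger0_norm ?exprn_ge0 ?le_max ?lexx ?orbT// lerXn2r ?nnegrE ?le_max ?lexx ?orbT//.
      by rewrite ge_max ler_norm normr_ge0.
    have h0 : `|h| != 0 by rewrite normr_eq0; near: h; exact: nbhs_dnbhs_neq.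
    rewrite exprS mulrA mulVf// mul1r.
    have h1 : `|h| <= 1 by near: h; apply: dnbhs0_le.
    apply: (@le_trans _ _ `|h|).
      by rewrite exprS ler_piMr// exprn_ile1.
    by near: h; apply: dnbhs0_le.
  split; [by apply/cvg_ex; exists 0| exact/cvg_lim].
Unshelve. all: by end_near.
Qed.

(** The factor that makes [spl 0] equal to 1 on the right of 3. *)
Definition spl_coef i : R := match i with 0 => 6^-1 | 1 => 2^-1 | _ => 1 end.
(** The i-th derivative (i <= 2) of a C^2 step, which is 0 on the left of 0 and
    1 on the right of 3: a third difference of truncated powers. *)
Definition spl i x : R :=
  spl_coef i * (ppow (3 - i) x - 3 * ppow (3 - i) (x - 1)
                + 3 * ppow (3 - i) (x - 2) - ppow (3 - i) (x - 3)).

Lemma is_derive_spl i x : (i < 2)%N -> is_derive x 1 (spl i) (spl i.+1 x).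
Proof.
have dsh n (c : R) : is_derive x 1 (fun y => ppow n.+2 (y - c)) (n.+2%:R * ppow n.+1 (x - c)).
  have := @is_derive1_comp R (ppow n.+2) (fun y => y - c) x _ 1 (is_derive_ppow n (x - c)).
  rewrite mulr1; apply.
  have := @is_deriveB R R R id (cst c) x 1 1 0 (is_derive_id _ _) (is_derive_cst _ _ _).
  by rewrite subr0.
have key n (e : R) : is_derive x 1 (fun y => e * (ppow n.+2 y - 3 * ppow n.+2 (y - 1) + 3 * ppow n.+2 (y - 2) - ppow n.+2 (y - 3)))
   (e * n.+2%:R * (ppow n.+1 x - 3 * ppow n.+1 (x - 1) + 3 * ppow n.+1 (x - 2) - ppow n.+1 (x - 3))).
  have d1 := @is_deriveZ R _ _ (fun y => ppow n.+2 (y - 1)) 3 x 1 _ (dsh n 1).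
  have d2 := @is_deriveZ R _ _ (fun y => ppow n.+2 (y - 2)) 3 x 1 _ (dsh n 2).
  have d3 := dsh n 3.
  have d0 := is_derive_ppow n x.
  have := is_deriveZ e (is_deriveB (is_deriveD (is_deriveB d0 d1) d2) d3).
  move=> /(@is_derive_eq _ _ _ _ _ _ _ _); apply.
  rewrite /GRing.scale/=; ring.
case: i => [|[|//]] _.
- apply: (is_derive_eq (key 1%N _)).
  by rewrite /spl /spl_coef/= ; congr (_ * _); lra.
- apply: (is_derive_eq (key 0%N _)).
  by rewrite /spl /spl_coef/= ; congr (_ * _); lra.
Qed.

Lemma continuous_spl i : continuous (spl i).
Proof.
have csh n (c : R) : continuous (fun y => ppow n (y - c)).
  move=> x; apply: (@continuous_comp _ _ _ (fun y => y - c) (ppow n)); last exact: continuous_ppow.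
  by apply: cvgB; [exact: cvg_id|exact: cvg_cst].
move=> x; rewrite /spl; apply: cvgM; first exact: cvg_cst.
apply: cvgB; last exact: csh.
apply: cvgD; last by apply: cvgM; [exact: cvg_cst|exact: csh].
apply: cvgB; last by apply: cvgM; [exact: cvg_cst|exact: csh].
exact: continuous_ppow.
Qed.

Lemma spl_le0 i x : (i <= 2)%N -> x <= 0 -> spl i x = 0.
Proof.
move=> i2 x0; rewrite /spl; have -> : (3 - i = (2 - i).+1)%N by rewrite subSn.
rewrite !ppow_le0; lra.
Qed.

Lemma spl_ge3 i x : (i <= 2)%N -> 3 <= x -> spl i x = (i == 0%N)%:R.
Proof.
move=> i2 x0; rewrite /spl !ppow_ge0; [|lra..].
by case: i i2 => [|[|[|//]]] _ /=; rewrite ?subn0 ?subSS ?subn0/= ?expr1; field.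
Qed.

Lemma bounded_spl i : (i <= 2)%N -> exists2 M, 0 < M & forall x, `|spl i x| <= M.
Proof.
move=> i2.
have [M [_ HM]] : bounded_set (spl i @` `[0, 3]).
  apply: compact_bounded; apply: continuous_compact; last exact: segment_compact.
  by apply: continuous_subspaceT; exact: continuous_spl.
pose K := Num.max 1 (M + 1).
have K1 : 1 <= K by rewrite le_max lexx.
have MK : M < K by rewrite lt_max; apply/orP; right; lra.
exists K; first lra.
move=> x; have [x0|x0] := leP x 0; first by rewrite spl_le0// normr0; lra.
have [x3|x3] := leP 3 x.
  by rewrite spl_ge3//; case: eqP => _; rewrite ?normr1 ?normr0; lra.
apply: (HM K MK); exists x => //=; rewrite in_itv/=; apply/andP; split; exact: ltW.
Qed.

(** The i-th derivative (i <= 2) of a C^2 plateau supported in [c, d + 3 / k], for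
    c <= d: the difference of a step on [c, c + 3 / k] and one on [d, d + 3 / k]. *)
Definition plat k c d i x : R := k ^+ i * (spl i (k * (x - c)) - spl i (k * (x - d))).

Lemma is_derive_plat k c d i x : (i < 2)%N -> is_derive x 1 (plat k c d i) (plat k c d i.+1 x).
Proof.
move=> i2.
have key e : is_derive x 1 (fun y => spl i (k * (y - e))) (spl i.+1 (k * (x - e)) * k).
  apply: (@is_derive1_comp R (spl i) (fun y => k * (y - e)) x _ k); first exact: is_derive_spl.
  have := is_deriveZ k (is_deriveB (is_derive_id x 1) (is_derive_cst e x 1)).
  by move=> /is_derive_eq; apply; rewrite /GRing.scale/=; ring.
apply: (is_derive_eq (is_deriveZ (k ^+ i) (is_deriveB (key c) (key d)))).
rewrite /plat exprS /GRing.scale/=; ring.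
Qed.

Lemma continuous_plat k c d i : continuous (plat k c d i).
Proof.
have csh (e : R) : continuous (fun y => spl i (k * (y - e))).
  move=> x; apply: (@continuous_comp _ _ _ (fun y => k * (y - e)) (spl i)); last exact: continuous_spl.
  apply: cvgM; first exact: cvg_cst.
  by apply: cvgB; [exact: cvg_id|exact: cvg_cst].
by move=> x; apply: cvgM; [exact: cvg_cst|apply: cvgB; exact: csh].
Qed.

Lemma plat_out k c d i x : 0 < k -> c <= d -> (i <= 2)%N ->
  ~ (c <= x <= d + 3 / k) -> plat k c d i x = 0.
Proof.
move=> k0 cd i2 /negP; rewrite negb_and -!ltNge => /orP[xc|dx].
  rewrite /plat !spl_le0 ?subrr ?mulr0//; rewrite pmulr_rle0//; lra.
rewrite /plat !spl_ge3 ?subrr ?mulr0// mulrC -ler_pdivrMr//; lra.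
Qed.

End Spline.

(** * Almost everywhere statements and the theorem of Fubini *)

Section MeasTools.
Variable R : realType.
Local Notation mu := (@lebesgue_measure R).
Local Notation mu2 := (mu \x mu)%E.
Implicit Types (A B : set R) (F : R * R -> R).

Lemma ae_imp (P Q : R -> Prop) : (forall x, P x -> Q x) ->
  (\forall x \ae mu, P x) -> \forall x \ae mu, Q x.
Proof.
move=> PQ [N [mN N0 HN]]; exists N; split => // x /= nQ.
by apply: HN => /= /PQ.
Qed.

Lemma ae_imp2 (P Q S : R -> Prop) : (forall x, P x -> Q x -> S x) ->
  (\forall x \ae mu, P x) -> (\forall x \ae mu, Q x) -> \forall x \ae mu, S x.
Proof.
move=> PQ [N [mN N0 HN]] [M [mM M0 HM]].
exists (N `|` M); split => //; first exact: measurableU.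
  have /negligibleP : mu.-negligible (N `|` M); last by apply; exact: measurableU.
  by apply: negligibleU; apply/negligibleP.
move=> x /= nS; have [Px|nP] := pselect (P x); last by left; exact: HN.
by right; apply: HM => /= Qx; exact/nS/PQ.
Qed.

Lemma ae_and (P Q : R -> Prop) :
  (\forall x \ae mu, P x) -> (\forall x \ae mu, Q x) -> \forall x \ae mu, P x /\ Q x.
Proof. exact: ae_imp2. Qed.

Lemma ae_count d (T : measurableType d) (m : {measure set T -> \bar R}) (C : countType) (P : C -> T -> Prop) :
  (forall c, \forall x \ae m, P c x) -> \forall x \ae m, forall c, P c x.
Proof.
move=> H.
have : \forall x \ae m, forall n, (fun n x => forall c, unpickle n = Some c -> P c x) n x.
  apply: ae_foralln => n /=; case: (unpickle n) => [c|].
    apply: filterS (H c) => x Px c' [<-] //.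
  by apply: aeW.
by apply: filterS => x + c => /(_ (pickle c)); apply; rewrite pickleK.
Qed.

Lemma restrict_prodE A B F x y : (F \_ (A `*` B)) (x, y) = ((fun x => ((fun y => F (x, y)) \_ B) y) \_ A) x.
Proof.
rewrite !patchE in_setX/=.
by case: (x \in A) => //=; rewrite !patchE.
Qed.

Section Fubini.
Variables (A B : set R) (F : R * R -> R).
Hypotheses (mA : measurable A) (mB : measurable B).
Hypothesis iF : mu2.-integrable (A `*` B) (EFin \o F).

Let G := F \_ (A `*` B).
Let iG : mu2.-integrable setT (EFin \o G).
Proof.
by move/integrable_mkcond : iF => /(_ (measurableX mA mB)); rewrite restrict_EFin.
Qed.

Let sec1 x : A x -> (fun y => G (x, y)) = (fun y => F (x, y)) \_ B.
Proof. by move=> Ax; apply/funext => y; rewrite /G restrict_prodE patchE mem_set. Qed.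
Let sec1N x : ~ A x -> (fun y => G (x, y)) = cst 0.
Proof. by move=> Ax; apply/funext => y; rewrite /G restrict_prodE patchE memNset. Qed.
Let sec2 y : B y -> (fun x => G (x, y)) = (fun x => F (x, y)) \_ A.
Proof. by move=> By; apply/funext => x; rewrite /G restrict_prodE !patchE; case: ifP => // _; rewrite ?patchE mem_set. Qed.
Let sec2N y : ~ B y -> (fun x => G (x, y)) = cst 0.
Proof. by move=> By; apply/funext => x; rewrite /G restrict_prodE !patchE; case: ifP => // _; rewrite ?patchE memNset. Qed.

Lemma ae_integrable_sec1 : \forall x \ae mu, A x -> mu.-integrable B (EFin \o (fun y => F (x, y))).
Proof.
apply: filterS (ae_integrable1 iG) => x + Ax.
by move=> H; rewrite integrable_mkcond// restrict_EFin -sec1.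
Qed.

Lemma ae_integrable_sec2 : \forall y \ae mu, B y -> mu.-integrable A (EFin \o (fun x => F (x, y))).
Proof.
apply: filterS (ae_integrable2 iG) => y + By.
by move=> H; rewrite integrable_mkcond// restrict_EFin -sec2.
Qed.

Let integrable_fubini_G : mu.-integrable setT (fubini_G mu (EFin \o G)).
Proof.
have mG := measurable_int _ iG.
apply/integrableP; split; first exact: measurable_fubini_G iG.
have mG2 := measurable_fun_fubini_tonelli_G (m1 := mu) (abse \o (EFin \o G)).
apply: le_lt_trans ((integrable21ltyP mu mu mG).1 iG).
have m1 : measurable_fun setT (fun y => `|fubini_G mu (EFin \o G) y|)%E.
  by apply: measurableT_comp => //; exact: measurable_fubini_G iG.
apply: ge0_le_integral; [exact: measurableT|by []|exact: m1| |].
- exact: (mG2 (measurableT_comp (@abse_measurable _ _) mG) (fun x => abse_ge0 _)).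
- move=> y _; apply: le_abse_integral => //; exact: measurableT_comp.
Qed.

Let aefin (h : R -> \bar R) : mu.-integrable setT h -> 
  mu.-integrable setT (EFin \o (fine \o h)) /\ (\int[mu]_x h x = (\int[mu]_x (fine (h x)))%:E)%E.
Proof.
move=> ih; have mh := measurable_int _ ih.
have mfh : measurable_fun setT (EFin \o (fine \o h)).
  by apply/measurable_EFinP; apply: measurableT_comp.
have E : ae_eq mu setT h (EFin \o (fine \o h)).
  by apply: filterS (integrable_ae measurableT ih) => x /(_ I) hx _ /=; rewrite fineK.
have ifh : mu.-integrable setT (EFin \o (fine \o h)).
  apply/integrableP; split => //.
  case/integrableP : ih => _ ; apply: le_lt_trans.
  have m1 : measurable_fun setT (fun x => `|(EFin \o (fine \o h)) x|)%E by apply: measurableT_comp.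
  have m2 : measurable_fun setT (fun x => `|h x|)%E by apply: measurableT_comp.
  apply: ge0_le_integral; [exact: measurableT|by []|exact: m1|exact: m2|].
  by move=> x _ /=; case: (h x) => [r| |] //=; rewrite ?normr0 ?leey.
split => //.
by rewrite /Rintegral fineK ?integrable_fin_num//; exact: ae_eq_integral.
Qed.

(** Fubini on A x B for real-valued integrals. *)
Lemma Rintegral_fubini1 : mu.-integrable A (EFin \o (fun x => \int[mu]_(y in B) F (x, y))) /\
  \int[mu]_(x in A) (\int[mu]_(y in B) F (x, y)) = \int[mu2]_(z in A `*` B) F z.
Proof.
have [] := aefin (integrable_fubini_F iG); rewrite integral12_prod_meas1//.
have E : (fine \o fubini_F mu (EFin \o G)) = (fun x => \int[mu]_(y in B) F (x, y)) \_ A.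
  apply/funext => x; rewrite /fubini_F/=.
  have [Ax|Ax] := pselect (A x).
    rewrite patchE mem_set// [RHS]Rintegral_mkcond.
    by rewrite -sec1.
  by rewrite patchE memNset//= /G; under eq_integral do rewrite [F \_ _ _](congr1 (fun f => f _) (sec1N Ax)); rewrite integral0.
rewrite {1}E => H1 H2; split.
  by rewrite integrable_mkcond// restrict_EFin.
rewrite [RHS]Rintegral_mkcond [LHS]Rintegral_mkcond /Rintegral.
rewrite -/G [in RHS]H2/=; rewrite -/(Rintegral _ _ _).
exact: (esym (congr1 (fun f => \int[mu]_x f x) E)).
Qed.

Lemma Rintegral_fubini2 : mu.-integrable B (EFin \o (fun y => \int[mu]_(x in A) F (x, y))) /\
  \int[mu]_(y in B) (\int[mu]_(x in A) F (x, y)) = \int[mu2]_(z in A `*` B) F z.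
Proof.
have [] := aefin (integrable_fubini_G); rewrite integral21_prod_meas1//.
have E : (fine \o fubini_G mu (EFin \o G)) = (fun y => \int[mu]_(x in A) F (x, y)) \_ B.
  apply/funext => y; rewrite /fubini_G/=.
  have [By|By] := pselect (B y).
    rewrite patchE mem_set// [RHS]Rintegral_mkcond.
    by rewrite -sec2.
  by rewrite patchE memNset//= /G; under eq_integral do rewrite [F \_ _ _](congr1 (fun f => f _) (sec2N By)); rewrite integral0.
rewrite {1}E => H1 H2; split.
  by rewrite integrable_mkcond// restrict_EFin.
rewrite [RHS]Rintegral_mkcond [LHS]Rintegral_mkcond /Rintegral.
rewrite -/G [in RHS]H2/=; rewrite -/(Rintegral _ _ _).
exact: (esym (congr1 (fun f => \int[mu]_x f x) E)).
Qed.

End Fubini.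

Lemma product_measure_ysection N : measurable N -> mu2 N = (\int[mu]_y (mu \o ysection N) y)%E.
Proof.
move=> mN.
have mi : measurable_fun setT (EFin \o (\1_N : R * R -> R)) by exact/measurable_EFinP.
have := @fubini_tonelli2 _ _ _ _ R mu mu (EFin \o \1_N) mi.
rewrite integral_indic// setIT => -> //; last by move=> x; rewrite lee_fin.
apply: eq_integral => y _; rewrite /fubini_G/=.
rewrite -[in RHS](setIT (ysection _ _)) -integral_indic//; last exact: measurable_ysection.
by apply: eq_integral => x _; rewrite !indicE mem_ysection.
Qed.

Lemma ae_sec2 A B (P : R * R -> Prop) :
  (\forall z \ae mu2, (A `*` B) z -> P z) ->
  \forall y \ae mu, B y -> \forall x \ae mu, A x -> P (x, y).
Proof.
move=> [N [mN N0 HN]].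
have : (\int[mu]_x (mu \o ysection N) x = 0)%E by rewrite -N0 product_measure_ysection.
have mx := @measurable_fun_ysection _ _ _ _ _ mu N mN.
rewrite (_ : (\int[mu]_x _)%E = \int[mu]_x `| (mu \o ysection N) x|)%E; last first.
  by apply: eq_integral => x _; rewrite gee0_abs.
move/(ae_eq_integral_abs _ measurableT mx).
apply: filterS => y /(_ I) /= H By; exists (ysection N y); split => //.
- exact: measurable_ysection.
- move=> x /= /not_implyP[Ax nP]; rewrite /ysection/= inE; apply: HN => /= /(_ (conj Ax By)); exact: nP.
Qed.

(** For a measurable P, almost everywhere in y for almost every x can be
    exchanged with almost everywhere in x for almost every y. *)
Lemma ae_swap A B (P : set (R * R)) : measurable A -> measurable B -> measurable P ->
  (\forall x \ae mu, A x -> \forall y \ae mu, B y -> P (x, y)) ->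
  \forall y \ae mu, B y -> \forall x \ae mu, A x -> P (x, y).
Proof.
move=> mA mB mP H; apply: ae_sec2.
pose N := (A `*` B) `\` P.
have mN : measurable N by apply: measurableD => //; exact: measurableX.
exists N; split => //; last by move=> z /= /not_implyP.
have mx := @measurable_fun_xsection _ _ _ _ _ mu N mN.
rewrite [LHS](_ : _ = \int[mu]_x `| (mu \o xsection N) x|)%E; last first.
  by apply: eq_integral => x _; rewrite gee0_abs.
apply: (ae_eq_integral_abs mu measurableT mx).2.
move: H; rewrite /ae_eq; apply: ae_imp => x Hx _ /=; apply/negligibleP; first exact: measurable_xsection.
have [Ax|Ax] := pselect (A x); last first.
  rewrite (_ : xsection _ _ = set0); first exact: negligible_set0.
  by apply/seteqP; split => // y; rewrite /xsection/= inE => -[[]].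
apply: negligibleS (Hx Ax) => y; rewrite /xsection/= inE /N => -[[/= _ By] nP].
by move=> /(_ By).
Qed.

(** Translation invariance, by uniqueness of the Lebesgue measure. *)
Lemma lebesgue_shift (c : R) A : measurable A -> mu [set x | A (x + c)] = mu A.
Proof.
move=> mA.
have mf : measurable_fun setT (fun x : measurableTypeR R => x + c : measurableTypeR R).
  by apply: measurable_funD => //.
have H := @lebesgue_measure_unique R (pushforward mu (fun x : measurableTypeR R => x + c : measurableTypeR R)).
apply/esym; apply: (H mf) => // _ [[a b]] _ <-.
have E : (+%R^~ c @^-1` `]a, b]%classic) = `]a - c, b - c]%classic.
  by apply/seteqP; split => x /=; rewrite !in_itv/= ltrBlDr lerBrDr.
transitivity (mu `]a - c, b - c]%classic); last by rewrite -E.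
rewrite !lebesgue_measure_itv/= !lte_fin ltrD2r; case: ifP => // _.
by rewrite -!EFinD; congr EFin; ring.
Qed.

Lemma ae_shift (c : R) (P : R -> Prop) :
  (\forall x \ae mu, P x) -> \forall x \ae mu, P (x + c).
Proof.
move=> [N [mN N0 HN]].
have mf : measurable_fun setT (fun x : R => x + c) by apply: measurable_funD.
exists [set x | N (x + c)]; split.
- by rewrite -[X in measurable X]setTI; exact: mf.
- by rewrite lebesgue_shift.
- by move=> x /= nP; exact: HN.
Qed.

(** A periodic property that holds almost everywhere on one period holds almost
    everywhere. *)
Lemma ae_periodic (T : R) (P : R -> Prop) : 0 < T ->
  (forall t, P t <-> P (t + T)) ->
  (\forall t \ae mu, `[0, T]%classic t -> P t) -> \forall t \ae mu, P t.
Proof.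
move=> T0 per H.
have perz (n : int) t : P t <-> P (t + T * n%:~R).
  have pern (m : nat) s : P s <-> P (s + T * m%:R).
    elim: m s => [|m IH] s; first by rewrite mulr0 addr0.
    by rewrite -natr1 mulrDr mulr1 addrA -per.
  case: n => n; first exact: pern.
  rewrite NegzE mulrNz; split => [Pt|].
    by apply/(pern n.+1); rewrite mulrN subrK.
  by move/(pern n.+1); rewrite mulrN subrK.
have : \forall t \ae mu, forall n : int, `[0, T]%classic (t + T * n%:~R) -> P (t + T * n%:~R).
  by apply: ae_count => n; exact: ae_shift H.
apply: ae_imp => t /(_ (- Num.floor (t / T))) H1; apply/(perz (- Num.floor (t / T)))/H1.
rewrite /= in_itv/= mulrNz mulrN subr_ge0 lerBlDr.
rewrite [T * _]mulrC -ler_pdivlMr// floor_le//=.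
rewrite -{1}(mul1r T) -mulrDl -ler_pdivrMr// addrC ltW//.
have := floorD1_gt (t / T); by rewrite intrD addrC.
Qed.

End MeasTools.

(** * Integrable functions and their primitives *)

(** [f] is a real-valued function integrable on [D]. *)
Notation intg mu D f := (mu.-integrable D (EFin \o f)).

Section IntgTools.
Context d (T : measurableType d) (R : realType) (mu : {measure set T -> \bar R}).
Implicit Types (D : set T) (f g : T -> R).

Lemma intg_meas D f : intg mu D f -> measurable_fun D f.
Proof. by move=> /measurable_int/measurable_EFinP. Qed.

Lemma intg_le D f g : measurable D -> measurable_fun D f ->
  (forall x, D x -> `|f x| <= g x) -> intg mu D g -> intg mu D f.
Proof.
move=> mD mf fg ig; apply: (le_integrable mD _ _ ig); first exact/measurable_EFinP.
by move=> x Dx /=; rewrite lee_fin; apply: (le_trans (fg x Dx)); exact: ler_norm.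
Qed.

Lemma intgM D f g M : measurable D -> intg mu D f -> measurable_fun D g ->
  (forall x, D x -> `|g x| <= M) -> intg mu D (fun x => f x * g x).
Proof.
move=> mD fi mg gM; have mf := intg_meas fi.
apply: (@intg_le _ _ (fun x => M * `|f x|)) => //.
- exact: measurable_funM.
- by move=> x Dx; rewrite normrM mulrC ler_wpM2r// gM.
- have := @integrableZl _ _ _ mu D mD M _ (integrable_norm fi).
  by apply: eq_integrable => // x _.
Qed.

Lemma intgZ D k f : measurable D -> intg mu D f -> intg mu D (fun x => k * f x).
Proof. by move=> mD fi; have := integrableZl mD k fi; apply: eq_integrable. Qed.

Lemma intgD D f g : measurable D -> intg mu D f -> intg mu D g -> intg mu D (fun x => f x + g x).
Proof. by move=> mD fi gi; have := integrableD mD fi gi; apply: eq_integrable. Qed.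

Lemma intgB D f g : measurable D -> intg mu D f -> intg mu D g -> intg mu D (fun x => f x - g x).
Proof. by move=> mD fi gi; have := integrableB mD fi gi; apply: eq_integrable. Qed.

Lemma ae_eq_intg D f g : measurable D -> measurable_fun D g ->
  (\forall x \ae mu, D x -> f x = g x) -> intg mu D f -> intg mu D g.
Proof.
move=> mD mg fg fi; apply/integrableP; split; first exact/measurable_EFinP.
case/integrableP : (fi) => _; rewrite (ae_eq_integral (fun x => `|(g x)%:E|)%E)//.
- by apply: measurableT_comp => //; exact: measurable_int fi.
- by do 2 apply: measurableT_comp => //.
- by apply: filterS fg => x + Dx => /(_ Dx) /= ->.
Qed.

Lemma ae_eq_Rintegral D f g : measurable D -> measurable_fun D f -> measurable_fun D g ->
  (\forall x \ae mu, D x -> f x = g x) ->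
  \int[mu]_(x in D) f x = \int[mu]_(x in D) g x.
Proof.
move=> mD mf mg fg; congr fine; apply: ae_eq_integral => //; [exact/measurable_EFinP|exact/measurable_EFinP|].
by apply: filterS fg => x + Dx => /(_ Dx) /= ->.
Qed.

Lemma integral_EFin D f : measurable D -> intg mu D f ->
  (\int[mu]_(x in D) (f x)%:E = (\int[mu]_(x in D) f x)%:E)%E.
Proof. by move=> mD fi; rewrite /Rintegral fineK// integrable_fin_num. Qed.

Lemma intgS D E f : measurable D -> measurable E -> D `<=` E -> intg mu E f -> intg mu D f.
Proof. by move=> mD mE DE; apply: integrableS. Qed.

End IntgTools.

Section AC.
Variable R : realType.
Local Notation mu := (@lebesgue_measure R).
Local Notation mu2 := (mu \x mu)%E.
Implicit Types (a b x y : R) (f g : R -> R).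

(** The primitive of g that vanishes at a. *)
Definition prim a g x := \int[mu]_(t in `[a, x]) g t.

Lemma prim_aa a g : prim a g a = 0.
Proof. by rewrite /prim set_itv1 Rintegral_set1. Qed.

Lemma intg_sub a b c d f : a <= c -> d <= b -> intg mu `[a, b] f -> intg mu `[c, d] f.
Proof.
move=> ac db; apply: intgS => // x /=; rewrite !in_itv/= => /andP[cx xd].
by rewrite (le_trans ac)//= (le_trans xd).
Qed.

Lemma prim_meas a b f : a <= b -> intg mu `[a, b] f -> measurable_fun `[a, b] (prim a f).
Proof.
move=> ab fi; apply: subspace_continuous_measurable_fun => //.
exact: parameterized_integral_continuous.
Qed.

Lemma prim_bound a b f x : x <= b -> intg mu `[a, b] f ->
  `|prim a f x| <= \int[mu]_(t in `[a, b]) `|f t|.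
Proof.
move=> xb fi; apply: (le_trans (le_normr_Rintegral _ _)) => //.
  exact: intg_sub fi.
rewrite -lee_fin -!integral_EFin//; last 2 first.
  exact: integrable_norm.
  by apply: integrable_norm; exact: intg_sub fi.
apply: ge0_subset_integral => //.
  by apply/measurable_EFinP/measurableT_comp => //; exact: intg_meas fi.
by move=> y /=; rewrite !in_itv/= => /andP[->/=] /le_trans; apply.
Qed.

Lemma intg_prim a b f g : a <= b -> intg mu `[a, b] f -> intg mu `[a, b] g ->
  intg mu `[a, b] (fun x => g x * prim a f x).
Proof.
move=> ab fi gi; apply: (intgM (M := \int[mu]_(t in `[a, b]) `|f t|)) => //; first exact: prim_meas.
by move=> x /=; rewrite in_itv/= => /andP[_ xb]; exact: prim_bound.
Qed.

Lemma intg_tensor (A B : set R) f g : measurable A -> measurable B -> intg mu A f -> intg mu B g ->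
  intg mu2 (A `*` B) (fun z => f z.1 * g z.2).
Proof.
move=> mA mB fi gi.
rewrite integrable_mkcond; last exact: measurableX.
have -> : ((EFin \o (fun z => f z.1 * g z.2)) \_ (A `*` B)) =
          (fun z : R * R => ((f \_ A) z.1 * (g \_ B) z.2)%:E).
  apply/funext => -[x y]; rewrite !patchE in_setX/=.
  by case: (x \in A) => /=; case: (y \in B) => //=; rewrite ?mul0r ?mulr0.
have ifA : mu.-integrable setT (EFin \o (f \_ A)) by rewrite -restrict_EFin -integrable_mkcond.
have igB : mu.-integrable setT (EFin \o (g \_ B)) by rewrite -restrict_EFin -integrable_mkcond.
apply/integrable12ltyP.
  apply/measurable_EFinP; apply: measurable_funM.
    exact: measurableT_comp (intg_meas ifA) measurable_fst.
  exact: measurableT_comp (intg_meas igB) measurable_snd.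
have -> : (\int[mu]_x \int[mu]_y `|((f \_ A) (x, y).1 * (g \_ B) (x, y).2)%:E| =
  \int[mu]_x (`|((f \_ A) x)%:E| * \int[mu]_y `|((g \_ B) y)%:E|))%E.
  apply: eq_integral => x _.
  rewrite -ge0_integralZl//=; last by do 2 apply: measurableT_comp => //; exact: intg_meas igB.
  by apply: eq_integral => y _; rewrite -EFinM normrM.
case/integrableP : igB => _ /= Bfin; case/integrableP : (ifA) => _ /= Afin.
rewrite ge0_integralZr//; last 2 first.
  by apply/measurable_EFinP/measurableT_comp => //; exact: (intg_meas ifA).
  exact: integral_ge0.
by rewrite lte_mul_pinfty// ?integral_ge0// ge0_fin_numE// integral_ge0.
Qed.

(** Both sides are the integral of g(x) f(y) over the triangle y <= x. *)
Lemma prim_ibp a b f g : a <= b -> intg mu `[a, b] f -> intg mu `[a, b] g ->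
  \int[mu]_(x in `[a, b]) (g x * prim a f x) =
  \int[mu]_(y in `[a, b]) (f y * (prim a g b - prim a g y)).
Proof.
move=> ab fi gi.
(* g(x) f(y) times the indicator of the triangle y <= x *)
pose F (z : R * R) : R := if z.2 <= z.1 then g z.1 * f z.2 else 0.
have iF : intg mu2 (`[a, b] `*` `[a, b]) F.
  have mP := intg_tensor (measurable_itv `[a, b]) (measurable_itv `[a, b]) gi fi.
  apply: (intg_le _ _ _ (integrable_norm mP)).
  - exact: measurableX.
  - apply: measurable_fun_if => //.
    + exact: measurableX.
    + by apply: measurable_fun_ler; apply: measurable_funTS; [exact: measurable_snd|exact: measurable_fst].
    + apply: measurable_funS (intg_meas mP); first exact: measurableX.
      by apply: subIsetl.
  - by move=> z _; rewrite /F/=; case: ifP => // _; rewrite normr0.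
have [_ E1] := Rintegral_fubini1 (measurable_itv _) (measurable_itv _) iF.
have [_ E2] := Rintegral_fubini2 (measurable_itv _) (measurable_itv _) iF.
transitivity (\int[mu]_(x in `[a, b]) \int[mu]_(y in `[a, b]) F (x, y)).
  apply: eq_Rintegral => x; rewrite inE/= in_itv/= => /andP[ax xb].
  transitivity (\int[mu]_(y in `[a, b]) (g x * (f \_ `[a, x]) y)); last first.
    apply: eq_Rintegral => y; rewrite inE/= in_itv/= => /andP[ay yb].
    rewrite /F/= patchE; case: ifPn.
      by rewrite inE/= in_itv/= => /andP[_ ->].
    by rewrite notin_setE/= in_itv/= ay/= => /negP/negbTE ->; rewrite mulr0.
  have E : `[a, b] `&` `[a, x] = `[a, x]%classic.
    by apply/setIidPr => y /=; rewrite !in_itv/= => /andP[->/=] /le_trans; apply.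
  rewrite RintegralZl//; first by rewrite -Rintegral_mkcondr E.
  rewrite -restrict_EFin; apply/integrable_restrict => //; rewrite E.
  exact: intg_sub fi.
rewrite E1 -E2.
apply: eq_Rintegral => y; rewrite inE/= in_itv/= => /andP[ay yb].
transitivity (\int[mu]_(x in `[a, b]) (f y * (g \_ `[y, b]) x)).
  apply: eq_Rintegral => x; rewrite inE/= in_itv/= => /andP[ax xb].
  rewrite /F/= patchE; case: ifPn => xy.
    have -> : x \in `[y, b]%classic by rewrite inE/= in_itv/= xy.
    by rewrite mulrC.
  have /negbTE -> : x \notin `[y, b]%classic.
    by rewrite notin_setE/= in_itv/= (negbTE xy).
  by rewrite mulr0.
have E : `[a, b] `&` `[y, b] = `[y, b]%classic.
  by apply/setIidPr => x /=; rewrite !in_itv/= => /andP[+ ->]; rewrite andbT => /(le_trans _); apply.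
rewrite RintegralZl//; last first.
  rewrite -restrict_EFin; apply/integrable_restrict => //; rewrite E.
  exact: intg_sub gi.
rewrite -Rintegral_mkcondr E /prim; congr (_ * _).
rewrite Rintegral_itvB//= Rintegral_itv_obnd_cbnd//.
apply: intgS gi => // x /=; rewrite !in_itv/= => /andP[yx ->]; rewrite andbT.
exact: (le_trans ay (ltW yx)).
Qed.

(** Integration by parts for two absolutely continuous functions. *)
Lemma AC_ibp a b f g A B : a <= b -> intg mu `[a, b] f -> intg mu `[a, b] g ->
  \int[mu]_(x in `[a, b]) ((A + prim a f x) * g x + f x * (B + prim a g x)) =
  (A + prim a f b) * (B + prim a g b) - A * B.
Proof.
move=> ab fi gi.
have i1 := intg_prim ab fi gi; have i2 := intg_prim ab gi fi.
transitivity (\int[mu]_(x in `[a, b]) ((A * g x + B * f x) + (g x * prim a f x + f x * prim a g x))).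
  by apply: eq_Rintegral => x _; ring.
have mI : measurable `[a, b] by exact: measurable_itv.
rewrite RintegralD//; [|by apply: intgD => //; apply: intgZ|exact: intgD].
rewrite RintegralD ?RintegralZl//; [|exact: intgZ|exact: intgZ].
rewrite RintegralD// prim_ibp//.
have -> : \int[mu]_(y in `[a, b]) (f y * (prim a g b - prim a g y)) =
   \int[mu]_(y in `[a, b]) (prim a g b * f y) - \int[mu]_(y in `[a, b]) (f y * prim a g y).
  rewrite -RintegralB//; last exact: intgZ.
  by apply: eq_Rintegral => x _; ring.
by rewrite RintegralZl// -!/(prim _ _ _); ring.
Qed.

(** A function of class C^1 is the primitive of its derivative. *)
Lemma C1_prim a b (f f' : R -> R) : (forall x, is_derive x 1 f (f' x)) -> continuous f' ->
  a <= b -> f b = f a + prim a f' b.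
Proof.
move=> df cf'; rewrite le_eqVlt => /predU1P[<-|ab]; first by rewrite prim_aa addr0.
have H : (\int[mu]_(x in `[a, b]) (f' x)%:E = (f b)%:E - (f a)%:E)%E.
  apply: continuous_FTC2 => //.
  - exact: continuous_subspaceT.
  - have cf x : {for x, continuous f}.
      by apply: differentiable_continuous; apply/derivable1_diffP; exact: ex_derive.
    split.
    + by move=> x _; exact: ex_derive.
    + by apply: cvg_at_right_filter; exact: cf.
    + by apply: cvg_at_left_filter; exact: cf.
  - by move=> x _; rewrite derive1E; exact: derive_val.
by have := congr1 fine H; rewrite /= -/(Rintegral _ _ _) -/(prim _ _ _) => ->; ring.
Qed.

Lemma intg_cont a b f : continuous f -> intg mu `[a, b] f.
Proof.
move=> cf; apply: continuous_compact_integrable; first exact: segment_compact.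
exact: continuous_subspaceT.
Qed.

(** Integration by parts for f, almost everywhere equal to the absolutely
    continuous function C + prim a g, and a function h of class C^1. *)
Lemma ibp_C1 a b f g C (h h' : R -> R) : a <= b -> intg mu `[a, b] f -> intg mu `[a, b] g ->
  (\forall x \ae mu, `[a, b]%classic x -> f x = C + prim a g x) ->
  (forall x, is_derive x 1 h (h' x)) -> continuous h' ->
  \int[mu]_(x in `[a, b]) (f x * h' x + g x * h x) = (C + prim a g b) * h b - C * h a.
Proof.
move=> ab fi gi fE dh ch'.
have ih' := intg_cont a b ch'.
have hE x : a <= x -> h x = h a + prim a h' x by apply: C1_prim.
have ch : continuous h.
  by move=> x; apply: differentiable_continuous; apply/derivable1_diffP; exact: ex_derive.
have mI : measurable `[a, b] by exact: measurable_itv.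
rewrite (hE b ab) -AC_ibp//.
have mh : measurable_fun `[a, b] h by exact: measurable_funS (continuous_measurable_fun ch).
have mh' : measurable_fun `[a, b] h' by exact: measurable_funS (continuous_measurable_fun ch').
apply: ae_eq_Rintegral => //.
- by apply: measurable_funD; apply: measurable_funM => //; [exact: intg_meas fi|exact: intg_meas gi].
- apply: measurable_funD; apply: measurable_funM => //; last 2 first.
  + exact: intg_meas gi.
  + by apply: measurable_funD => //; exact: prim_meas.
  by apply: measurable_funD => //; exact: prim_meas.
- move: fE; apply: ae_imp => x + Ix; move=> /(_ Ix) ->.
  by rewrite {1}(hE x)//; move: Ix; rewrite /= in_itv/= => /andP[].
Qed.

End AC.

(** * The lemma of du Bois-Reymond on an interval *)

Section DuBoisReymond.
Variable R : realType.
Local Notation mu := (@lebesgue_measure R).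
Implicit Types (a b x y c d : R) (f g h : R -> R).

Lemma ae_neq c : \forall x \ae mu, x <> c.
Proof.
exists [set c]; split => //; first exact: lebesgue_measure_set1.
by move=> x /= /contrapT.
Qed.

(** At a Lebesgue point the mean oscillation over small balls is small. *)
Lemma lebesgue_ptP h x : lebesgue_pt h x -> forall e : R, 0 < e ->
  exists2 r0 : R, 0 < r0 & forall r : R, 0 < r < r0 ->
   (\int[mu]_(y in ball x r) `|(h y - h x)%:E| <= (e * r)%:E)%E.
Proof.
move=> hx e e0.
have e2 : 0 < e / 2 by rewrite divr_gt0.
move/fine_cvgP : hx => [fin cv].
move/cvgr0Pnorm_lt : cv => /(_ _ e2) cv.
have [r0 /= r00 H] := (@filterI _ _ _ _ _ fin cv).
exists r0 => // r /andP[rp rr0].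
have [] := H r; [by rewrite /ball/= sub0r normrN gtr0_norm|by []|].
move=> fin1 lt1.
have : (davg h x r <= (e / 2)%:E)%E.
  rewrite -(fineK fin1) lee_fin; apply: (le_trans (ler_norm _)); exact: ltW.
rewrite /davg /iavg lebesgue_measure_ball; last exact: ltW.
rewrite inver.
have rn : r *+ 2 != 0 by rewrite mulrn_eq0 /= gt_eqF.
rewrite (negbTE rn).
rewrite lee_pdivrMl ?mulrn_wgt0//.
move=> /le_trans; apply; rewrite -EFinM lee_fin mulr2n; lra.
Qed.

Lemma spl_mass a b c K : 0 < K -> a <= c -> c + 3 / K <= b ->
  \int[mu]_(y in `[a, b]) (K * spl 1 (K * (y - c))) = 1.
Proof.
move=> K0 ac cb.
have ab : a <= b.
  by apply: (le_trans ac); apply: le_trans cb; rewrite lerDl divr_ge0// ltW.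
have D x : is_derive x 1 (fun y => spl 0 (K * (y - c))) (K * spl 1 (K * (x - c))).
  rewrite mulrC; apply: (@is_derive1_comp R (spl 0) (fun y => K * (y - c)) x _ K); first exact: is_derive_spl.
  have := is_deriveZ K (is_deriveB (is_derive_id x 1) (is_derive_cst c x 1)).
  by move=> /is_derive_eq; apply; rewrite /GRing.scale/=; ring.
have := C1_prim D _ ab; rewrite /prim.
have -> : spl 0 (K * (a - c)) = 0 by rewrite spl_le0// pmulr_rle0// subr_le0.
have -> : spl 0 (K * (b - c)) = 1.
  by rewrite spl_ge3// mulrC -ler_pdivrMr//; lra.
rewrite add0r => <-// x.
apply: (@continuous_comp _ _ _ (fun y => K * (y - c)) (fun z => K * spl 1 z)).
  apply: cvgM; first exact: cvg_cst.
  by apply: cvgB; [exact: cvg_id|exact: cvg_cst].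
by apply: cvgM; [exact: cvg_cst|exact: continuous_spl].
Qed.

Lemma continuous_spl1 c K : continuous (fun y => K * spl 1 (K * (y - c))).
Proof.
move=> x; apply: (@continuous_comp _ _ _ (fun y => K * (y - c)) (fun z => K * spl 1 z)).
  apply: cvgM; first exact: cvg_cst.
  by apply: cvgB; [exact: cvg_id|exact: cvg_cst].
by apply: cvgM; [exact: cvg_cst|exact: continuous_spl].
Qed.

Lemma intg_mul_cont a b f g : intg mu `[a, b] f -> continuous g ->
  intg mu `[a, b] (fun x => f x * g x).
Proof.
move=> fi cg.
have [M [_ HM]] : bounded_set (g @` `[a, b]).
  apply: compact_bounded; apply: continuous_compact; last exact: segment_compact.
  exact: continuous_subspaceT.
apply: (intgM (M := M + 1)) => //.
  exact: measurable_funTS (continuous_measurable_fun cg).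
by move=> x abx; apply: (HM (M + 1)); [lra|exists x].
Qed.

(** The bumps K * spl 1 (K * (y - c)) have mass 1 and support [c, c + 3 / K],
    so they approximate the Dirac mass at any Lebesgue point x near c. *)
Lemma spl_concentrate a b h x : intg mu `[a, b] h -> a < x < b ->
  lebesgue_pt (h \_ `[a, b]) x -> forall e : R, 0 < e ->
  exists K0 : R, forall K c : R, K0 <= K -> 0 < K -> x < c < x + K^-1 ->
  `|\int[mu]_(y in `[a, b]) (h y * (K * spl 1 (K * (y - c)))) - h x| <= e.
Proof.
move=> hi /andP[ax xb] hx e e0.
have [M M0 HM] : exists2 M : R, 0 < M & forall x, `|spl 1 x| <= M := @bounded_spl R 1 isT.
have M4 : 0 < e / (M * 4) by rewrite divr_gt0// mulr_gt0.
have [r0 r00 Hr] := lebesgue_ptP hx M4.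
pose r1 := Num.min r0 (Num.min (x - a) (b - x)).
have r10 : 0 < r1 by rewrite !lt_min r00 !subr_gt0 ax.
have [r1r0 r1a r1b] : [/\ r1 <= r0, r1 <= x - a & r1 <= b - x].
  by split; rewrite /r1 !ge_min lexx ?orbT.
(* the support [c, c + 3 / K] lies in the ball of radius 4 / K around x, and
5 / r1 <= K makes this ball smaller than r1 *)
exists (5 / r1) => K c K0 Kp /andP[xc cx].
have Kr : 4 / K < r1.
  rewrite ltr_pdivrMr// mulrC -ltr_pdivrMr//; apply: lt_le_trans K0.
  by rewrite ltr_pM2r ?invr_gt0// ltr_nat.
have Ki : 0 < K^-1 by rewrite invr_gt0.
have ac : a <= c by lra.
have cb : c + 3 / K <= b by lra.
have mI : measurable `[a, b] by exact: measurable_itv.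
have ci := @continuous_spl1 c K.
rewrite -[X in _ - X]mulr1 -(spl_mass Kp ac cb) -RintegralZl//; last exact: intg_cont.
have i1 := intg_mul_cont hi ci.
have i2 : intg mu `[a, b] (fun y => h x * (K * spl 1 (K * (y - c)))).
  by apply: intgZ => //; exact: intg_cont.
rewrite -RintegralB//.
have i3 : intg mu `[a, b] (fun y => h y * (K * spl 1 (K * (y - c))) - h x * (K * spl 1 (K * (y - c)))) by exact: intgB.
apply: (le_trans (le_normr_Rintegral _ i3)); first exact: measurable_itv.
rewrite -lee_fin -integral_EFin//; last exact: integrable_norm.
have bI : ball x (4 / K) `<=` `[a, b].
  move=> y; rewrite /ball/= in_itv/= ltr_norml => /andP[]; lra.
have hh y : `[a, b]%classic y -> (h \_ `[a, b]) y = h y by move=> Iy; rewrite patchE mem_set.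
have xI : `[a, b]%classic x by rewrite /= in_itv/= !ltW.
have mh := intg_meas hi.
have HB := Hr (4 / K); rewrite (lt_le_trans Kr)// divr_gt0// in HB.
have {}HB := HB isT.
apply: (@le_trans _ _ ((K * M)%:E * \int[mu]_(y in ball x (4 / K)) `|((h \_ `[a, b]) y - (h \_ `[a, b]) x)%:E|)%E); last first.
  have KM : 0 < K * M by rewrite mulr_gt0.
  have -> : (e%:E = (K * M)%:E * (e / (M * 4) * (4 / K))%:E)%E.
    rewrite -EFinM; congr EFin; field; rewrite !gt_eqF//.
  by rewrite lee_pmul2l// lte_fin.
have mB : measurable (ball x (4 / K)) by exact: measurable_ball.
have mF : measurable_fun `[a, b] (fun y => h y * (K * spl 1 (K * (y - c))) - h x * (K * spl 1 (K * (y - c)))).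
  exact: intg_meas i3.
have mhB : measurable_fun (ball x (4 / K)) (fun y => `|((h \_ `[a, b]) y - (h \_ `[a, b]) x)%:E|%E).
  apply: measurableT_comp => //; apply/measurable_EFinP; apply: measurable_funB => //.
  apply: (measurable_funS mI bI); apply/measurable_restrict => //; exact: measurable_funS mh.
rewrite -ge0_integralZl//; last by rewrite lee_fin mulr_ge0// ltW.
rewrite [X in (X <= _)%E]integral_mkcond [X in (_ <= X)%E]integral_mkcond.
apply: ge0_le_integral => //.
- by move=> y _; apply: erestrict_ge0 => z _; rewrite lee_fin.
- apply: (measurable_restrictT _ _).1 => //.
  by apply/measurable_EFinP; apply: measurableT_comp.
- apply: (measurable_restrictT _ _).1 => //.
  by apply: measurable_funeM.
move=> y _; rewrite !patchE.
case: ifPn => [|_]; last by case: ifP => // _; rewrite mule_ge0// lee_fin mulr_ge0// ltW.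
rewrite inE => Iy; case: ifPn.
  rewrite inE => By; rewrite /= !ifT ?inE// lee_fin -mulrBl normrM normrM (gtr0_norm Kp).
  by rewrite mulrC ler_wpM2r// ler_wpM2l// ltW.
rewrite notin_setE /ball/= => nB.
have -> : spl 1 (K * (y - c)) = 0; last by rewrite mulr0 !mulr0 subrr normr0.
have [yc|cy] := leP y c; first by rewrite spl_le0// pmulr_rle0// subr_le0.
rewrite spl_ge3// mulrC -ler_pdivrMr//.
move: nB => /negP; rewrite -leNgt distrC ger0_norm; lra.
Qed.

(** If g is the weak derivative of f, tested with rational plateaus only, then f
    is almost everywhere a constant plus a primitive of g.  The restriction to
    countably many test functions is what allows f and g to depend on a
    parameter below. *)
Lemma du_Bois_Reymond a b f g : a < b -> intg mu `[a, b] f -> intg mu `[a, b] g ->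
  (forall (k : nat) (c d : rat), let K := k.+1%:R in
     a < ratr c -> ratr c <= ratr d :> R -> ratr d + 3 / K < b ->
     \int[mu]_(x in `[a, b]) (f x * plat K (ratr c) (ratr d) 1 x + g x * plat K (ratr c) (ratr d) 0 x) = 0) ->
  exists C, \forall x \ae mu, `[a, b]%classic x -> f x = C + prim a g x.
Proof.
move=> ab fi gi H.
have mI : measurable `[a, b] by exact: measurable_itv.
pose h x := f x - prim a g x.
have ip : intg mu `[a, b] (prim a g).
  apply: (@eq_integrable _ _ _ mu _ mI (EFin \o (fun x => cst 1 x * prim a g x))).
    by move=> x _ /=; rewrite mul1r.
  apply: intg_prim => //; first exact: ltW.
  by apply: intg_cont => z; exact: cvg_cst.
have hi : intg mu `[a, b] h by exact: intgB.
have lp : \forall x \ae mu, lebesgue_pt (h \_ `[a, b]) x.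
  apply: lebesgue_differentiation; exact: integrable_locally.
(* The derivative of the plateau from c to d is a bump at c minus a bump at d; with
c, d close to x, y the hypothesis says that h = f - prim a g satisfies h x = h y. *)
have main x y : a < x -> x < y -> y < b -> lebesgue_pt (h \_ `[a, b]) x -> lebesgue_pt (h \_ `[a, b]) y -> h x = h y.
  move=> ax xy yb lx ly.
  apply/eqP; rewrite -subr_eq0 -normr_le0; apply/ler_addgt0Pr => e e0; rewrite add0r.
  have e2 : 0 < e / 2 by rewrite divr_gt0.
  have xab : a < x < b by rewrite ax (lt_trans xy).
  have yab : a < y < b by rewrite yb (lt_trans ax).
  have [Kx HKx] := spl_concentrate hi xab lx e2.
  have [Ky HKy] := spl_concentrate hi yab ly e2.
  pose K0 := Num.max (Num.max Kx Ky) (Num.max (2 / (y - x)) (5 / (b - y))).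
  have [k [K EK Hk]] : exists k : nat, exists2 K : R, K = k.+1%:R & K0 <= K.
    by exists (Num.truncn K0), (Num.truncn K0).+1%:R => //; exact/ltW/truncnS_gt.
  have Kp : 0 < K by rewrite EK ltr0n.
  have Ki : 0 < K^-1 by rewrite invr_gt0.
  move: Hk; rewrite !ge_max => /andP[/andP[Kx1 Ky1] /andP[K2 K5]].
  have K2' : 2 * K^-1 <= y - x.
    by rewrite ler_pdivrMr// mulrC -ler_pdivrMr// subr_gt0.
  have K5' : 5 * K^-1 <= b - y.
    by rewrite ler_pdivrMr// mulrC -ler_pdivrMr// subr_gt0.
  have [c /andP[xc cx]] : exists c : rat, x < ratr c < x + K^-1.
    by have [|c] := @rat_in_itvoo R x (x + K^-1); [rewrite ltrDl|rewrite in_itv/=; exists c].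
  have [d /andP[yd dy]] : exists c : rat, y < ratr c < y + K^-1.
    by have [|d] := @rat_in_itvoo R y (y + K^-1); [rewrite ltrDl|rewrite in_itv/=; exists d].
  have acc : a < ratr c by rewrite (lt_trans ax).
  have cdd : ratr c <= ratr d :> R by apply: (le_trans (ltW cx)); apply: le_trans (ltW yd); lra.
  have dbb : ratr d + 3 / K < b.
    by apply: (@lt_trans _ _ (y + K^-1 + 3 / K)); [rewrite ltrD2r|lra].
  have := H k c d; rewrite /= -EK => /(_ acc cdd dbb).
  have Hx := HKx K (ratr c) Kx1 Kp; rewrite xc cx in Hx; move/(_ isT) : Hx.
  have Hy := HKy K (ratr d) Ky1 Kp; rewrite yd dy in Hy; move/(_ isT) : Hy.
  have dp (z : R) : is_derive z 1 (plat K (ratr c) (ratr d) 0) (plat K (ratr c) (ratr d) 1 z).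
    exact: is_derive_plat.
  have cp := @continuous_plat R K (ratr c) (ratr d) 1.
  have cp0 := @continuous_plat R K (ratr c) (ratr d) 0.
  have E : \forall x \ae mu, `[a, b]%classic x -> prim a g x = 0 + prim a g x.
    by apply: aeW => z _; rewrite add0r.
  have := ibp_C1 (ltW ab) ip gi E dp cp.
  rewrite (@plat_out _ K _ _ 0 b)//; last by lra.
  rewrite mulr0 mul0r subr0 => EP Hd Hc EF.
  have i1 := intg_mul_cont fi cp; have i2 := intg_mul_cont gi cp0.
  have i3 := intg_mul_cont ip cp; have i4 := intg_mul_cont hi (@continuous_spl1 (ratr c) K).
  have i5 := intg_mul_cont hi (@continuous_spl1 (ratr d) K).
  have : \int[mu]_(y in `[a, b]) (h y * (K * spl 1 (K * (y - ratr c)))) - \int[mu]_(y in `[a, b]) (h y * (K * spl 1 (K * (y - ratr d)))) = 0.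
    rewrite -RintegralB// -[RHS](subrr 0) -{1}EF -EP -RintegralB//; [|exact: intgD|exact: intgD].
    by apply: eq_Rintegral => z _; rewrite /h /plat; ring.
  move=> /eqP; rewrite subr_eq0 => /eqP Ecd; rewrite Ecd in Hc.
  set J := \int[mu]_(y in _) _ in Hd Hc.
  have -> : h x - h y = (J - h y) - (J - h x) by ring.
  by apply: (le_trans (ler_normB _ _)); rewrite [e]splitr lerD.
(* The constant is the value of h at any Lebesgue point. *)
have [[x0 [ax0 x0b lx0]]|nex] := pselect (exists x0, [/\ a < x0, x0 < b & lebesgue_pt (h \_ `[a, b]) x0]).
  exists (h x0); apply: ae_imp2 (ae_neq a) (ae_and (ae_neq b) lp).
  move=> x xa [xb lx] /=; rewrite in_itv/= !le_eqVlt => /andP[/predU1P[/esym//|ax] /predU1P[//|xb']].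
  have -> : h x0 = h x; last by rewrite /h subrK.
  by have [xx0|x0x|->//] := ltgtP x x0; [rewrite (main x x0)|rewrite (main x0 x)].
exists 0; apply: ae_imp2 (ae_neq a) (ae_and (ae_neq b) lp).
move=> x xa [xb lx] /=; rewrite in_itv/= !le_eqVlt => /andP[/predU1P[/esym//|ax] /predU1P[//|xb']].
by exfalso; apply: nex; exists x.
Qed.

(** A function whose primitive vanishes is 0 almost everywhere. *)
Lemma ae_eq0_prim a b g : a < b -> intg mu `[a, b] g ->
  (forall x, a <= x <= b -> prim a g x = 0) ->
  \forall x \ae mu, `[a, b]%classic x -> g x = 0.
Proof.
move=> ab gi H.
have lp : \forall x \ae mu, lebesgue_pt (g \_ `[a, b]) x.
  apply: lebesgue_differentiation; exact: integrable_locally.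
have gi' : intg mu setT (g \_ `[a, b]) by rewrite -restrict_EFin -integrable_mkcond.
apply: ae_imp2 (ae_neq a) (ae_and (ae_neq b) lp).
move=> x xa [xb lx] /=; rewrite in_itv/= !le_eqVlt => /andP[/predU1P[/esym//|ax] /predU1P[//|xb']].
have [] := @FTC1_lebesgue_pt R (g \_ `[a, b]) (BLeft a) x b xb' _ _ lx.
- exact: intgS gi'.
- by rewrite lte_fin.
move=> _; rewrite patchE mem_set/=; last by rewrite in_itv/= !ltW.
move=> <-; rewrite derive1E; apply: (@derive_val _ _ _ _ _ _ 0).
have N : \near x, cst 0 x = \int[mu]_(t in [set` Interval (BLeft a) (BRight x)]) (g \_ `[a, b]) t.
  near=> y.
  have ay : a < y by near: y; exact: lt_nbhsr.
  have yb : y < b by near: y; exact: lt_nbhsl.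
  rewrite -(H y); last by rewrite !ltW.
  apply: eq_Rintegral => t; rewrite inE/= in_itv/= => /andP[at_ ty].
  by rewrite patchE mem_set//= in_itv/= at_ (le_trans ty)// ltW.
by apply: (near_eq_is_derive N); exact: is_derive_cst.
Unshelve. all: by end_near.
Qed.

End DuBoisReymond.

(** * The lemma of du Bois-Reymond on a rectangle *)

Section FundamentalLemma.
Variable R : realType.
Local Notation mu := (@lebesgue_measure R).
Local Notation mu2 := (mu \x mu)%E.
Implicit Types (a b x y c d : R) (f g h : R -> R).

(** A property that holds almost everywhere on [a, b] holds at points of [a, b]
    arbitrarily close to any c in [a, b]. *)
Lemma ae_witness a b c d (P : R -> Prop) : a < b -> a <= c <= b -> 0 < d ->
  (\forall x \ae mu, `[a, b]%classic x -> P x) ->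
  exists x, [/\ a <= x <= b, `|x - c| < d & P x].
Proof.
move=> ab /andP[ac cb] d0 [N [mN N0 HN]]; apply: contrapT => nex.
pose l := Num.max a (c - d); pose r := Num.min b (c + d).
have lr : l < r by rewrite /l /r gt_max !lt_min; apply/andP; split; apply/andP; split => //; lra.
have : (mu `]l, r[ <= mu N)%E.
  apply: le_measure; rewrite ?inE//.
  move=> x; rewrite /= in_itv/= /l /r gt_max lt_min => /andP[/andP[ax cx] /andP[xb xc]].
  apply: HN => /= H; apply: nex; exists x; split.
  - by rewrite !ltW.
  - by rewrite ltr_norml; apply/andP; split; lra.
  - by apply: H; rewrite in_itv/= !ltW.
rewrite N0 lebesgue_measure_itv/= lte_fin lr -EFinB lee_fin; lra.
Qed.

Lemma prim_cvg a b f c : a <= b -> intg mu `[a, b] f -> a <= c <= b ->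
  forall e : R, 0 < e -> exists2 d : R, 0 < d & forall x, a <= x <= b -> `|x - c| < d -> `|prim a f x - prim a f c| < e.
Proof.
move=> ab fi cab e e0.
have Ic : `[a, b]%classic c by rewrite /= in_itv.
have /subspace_continuousP := parameterized_integral_continuous ab fi.
move=> /(_ c Ic) /cvgrPdist_lt /(_ e e0) [d /= d0 H]; exists d => // x xab xd.
rewrite distrC; apply: (H x); last by rewrite /= in_itv.
by rewrite /ball/= distrC.
Qed.

(** A primitive is continuous, so it is constant if it is so almost everywhere. *)
Lemma prim_ae_const a b f C : a < b -> intg mu `[a, b] f ->
  (\forall x \ae mu, `[a, b]%classic x -> prim a f x = C) ->
  forall x, a <= x <= b -> prim a f x = C.
Proof.
move=> ab fi H c cab; apply/eqP; rewrite -subr_eq0 -normr_le0; apply/ler_addgt0Pr => e e0; rewrite add0r.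
have [d d0 Hd] := prim_cvg (ltW ab) fi cab e0.
have [x [xab xd <-]] := ae_witness ab cab d0 H.
by rewrite distrC ltW// Hd.
Qed.

Lemma fundamental_lemma a b h : a < b -> intg mu `[a, b] h ->
  (forall (k : nat) (c d : rat), let K := k.+1%:R in
     a < ratr c -> ratr c <= ratr d :> R -> ratr d + 3 / K < b ->
     \int[mu]_(x in `[a, b]) (h x * plat K (ratr c) (ratr d) 0 x) = 0) ->
  \forall x \ae mu, `[a, b]%classic x -> h x = 0.
Proof.
move=> ab hi H.
have i0 : intg mu `[a, b] (cst 0 : R -> R) by apply: intg_cont => z; exact: cvg_cst.
have [|C HC] := du_Bois_Reymond ab i0 hi.
  move=> k c d K ac cd db; rewrite -[RHS](H k c d ac cd db).
  by apply: eq_Rintegral => x _; rewrite mul0r add0r.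
have HC' : \forall x \ae mu, `[a, b]%classic x -> prim a h x = - C.
  by move: HC; apply: ae_imp => x + Ix => /(_ Ix) E; apply/eqP; rewrite -addr_eq0 addrC -E.
have HP := prim_ae_const ab hi HC'.
have C0 : - C = 0 by rewrite -(HP a) ?prim_aa// lexx ltW.
by apply: ae_eq0_prim => // x /HP ->.
Qed.

(** The lemma of du Bois-Reymond for families w t, g t on [a, b]: the defect h t of
    each plateau in x vanishes for almost every t, by the fundamental lemma in t. *)
Lemma du_Bois_Reymond_family a b a' b' (w g : R -> R -> R) : a < b -> a' < b' ->
  (\forall t \ae mu, `[a', b']%classic t -> intg mu `[a, b] (w t)) ->
  (\forall t \ae mu, `[a', b']%classic t -> intg mu `[a, b] (g t)) ->
  (forall (k : nat) (c d : rat), let K := k.+1%:R in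
     a < ratr c -> ratr c <= ratr d :> R -> ratr d + 3 / K < b ->
     let h t := \int[mu]_(x in `[a, b]) (w t x * plat K (ratr c) (ratr d) 1 x + g t x * plat K (ratr c) (ratr d) 0 x) in
     intg mu `[a', b'] h /\
     forall (k' : nat) (c' d' : rat), let K' := k'.+1%:R in
     a' < ratr c' -> ratr c' <= ratr d' :> R -> ratr d' + 3 / K' < b' ->
     \int[mu]_(t in `[a', b']) (h t * plat K' (ratr c') (ratr d') 0 t) = 0) ->
  \forall t \ae mu, `[a', b']%classic t -> exists C, \forall x \ae mu, `[a, b]%classic x -> w t x = C + prim a (g t) x.
Proof.
move=> ab ab' wi gi H.
have : \forall t \ae mu, forall q : nat * rat * rat, `[a', b']%classic t ->
   a < ratr q.1.2 -> ratr q.1.2 <= ratr q.2 :> R -> ratr q.2 + 3 / q.1.1.+1%:R < b ->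
   \int[mu]_(x in `[a, b]) (w t x * plat q.1.1.+1%:R (ratr q.1.2) (ratr q.2) 1 x + g t x * plat q.1.1.+1%:R (ratr q.1.2) (ratr q.2) 0 x) = 0.
  apply: ae_count => -[[k c] d] /=.
  have [[ac [cd db]]|nH] := pselect (a < ratr c /\ ratr c <= ratr d :> R /\ ratr d + 3 / k.+1%:R < b); last first.
    by apply: aeW => t _ ac cd db; exfalso; apply: nH.
  have [hi Hh] := H k c d ac cd db.
  by move: (fundamental_lemma ab' hi Hh); apply: ae_imp => t Ht /Ht ->.
apply: ae_imp2 (ae_and wi gi) => t [wt gt] Ht Jt.
apply: du_Bois_Reymond => //; [exact: wt|exact: gt|].
by move=> k c d K ac cd db; apply: (Ht (k, c, d)).
Qed.

Section Rectangle.
Variables (a b a' b' : R) (w g : R * R -> R).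
Hypotheses (ab : a < b) (ab' : a' < b').
Local Notation I := (`[a, b]%classic : set R).
Local Notation J := (`[a', b']%classic : set R).
Hypotheses (wi : intg mu2 (I `*` J) w) (gi : intg mu2 (I `*` J) g).

Lemma intg_mul_cont1 (f : R * R -> R) h : intg mu2 (I `*` J) f -> continuous h ->
  intg mu2 (I `*` J) (fun z => f z * h z.1).
Proof.
move=> fi cg.
have [M [_ HM]] : bounded_set (h @` `[a, b]).
  apply: compact_bounded; apply: continuous_compact; last exact: segment_compact.
  exact: continuous_subspaceT.
apply: (intgM (M := M + 1)) => //; first exact: measurableX.
  apply: measurable_funTS; apply: measurableT_comp => //; exact: continuous_measurable_fun.
by move=> [x y] [/= Ix Jy]; apply: (HM (M + 1)); [lra|exists x].
Qed.

Lemma intg_mul_cont2 (f : R * R -> R) h : intg mu2 (I `*` J) f -> continuous h ->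
  intg mu2 (I `*` J) (fun z => f z * h z.2).
Proof.
move=> fi cg.
have [M [_ HM]] : bounded_set (h @` `[a', b']).
  apply: compact_bounded; apply: continuous_compact; last exact: segment_compact.
  exact: continuous_subspaceT.
apply: (intgM (M := M + 1)) => //; first exact: measurableX.
  apply: measurable_funTS; apply: measurableT_comp => //; exact: continuous_measurable_fun.
by move=> [x y] [/= Ix Jy]; apply: (HM (M + 1)); [lra|exists y].
Qed.

Let valid k (c d : rat) (a b : R) := [/\ a < ratr c, ratr c <= ratr d :> R & ratr d + 3 / k.+1%:R < b].

(** If g is the weak x-derivative of w, tested with products of plateaus, then
    almost every section w (., t) is a constant plus a primitive of g (., t). *)
Lemma du_Bois_Reymond_x :
  (forall (k : nat) (c d : rat), valid k c d a b -> forall (k' : nat) (c' d' : rat), valid k' c' d' a' b' ->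
     \int[mu2]_(z in I `*` J) ((w z * plat k.+1%:R (ratr c) (ratr d) 1 z.1 + g z * plat k.+1%:R (ratr c) (ratr d) 0 z.1)
        * plat k'.+1%:R (ratr c') (ratr d') 0 z.2) = 0) ->
  \forall t \ae mu, J t -> exists C, \forall x \ae mu, I x -> w (x, t) = C + prim a (fun x => g (x, t)) x.
Proof.
move=> H.
have mI : measurable I by exact: measurable_itv.
have mJ : measurable J by exact: measurable_itv.
apply: (@du_Bois_Reymond_family a b a' b' (fun t x => w (x, t)) (fun t x => g (x, t))) => //.
- exact: (ae_integrable_sec2 mI mJ wi).
- exact: (ae_integrable_sec2 mI mJ gi).
move=> k c d K ac cd db h.
pose F z := w z * plat K (ratr c) (ratr d) 1 z.1 + g z * plat K (ratr c) (ratr d) 0 z.1.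
have Fi : intg mu2 (I `*` J) F.
  by apply: intgD; [exact: measurableX|apply: intg_mul_cont1|apply: intg_mul_cont1] => //; exact: continuous_plat.
have [hi _] := Rintegral_fubini2 mI mJ Fi; split; first exact: hi.
move=> k' c' d' K' ac' cd' db'.
rewrite -(H k c d _ k' c' d' _)//.
have Gi : intg mu2 (I `*` J) (fun z => F z * plat K' (ratr c') (ratr d') 0 z.2).
  by apply: intg_mul_cont2 => //; exact: continuous_plat.
have [Gi' <-] := Rintegral_fubini2 mI mJ Gi.
apply: ae_eq_Rintegral => //.
- apply: measurable_funM; first exact: intg_meas hi.
  by apply: measurable_funTS; apply: continuous_measurable_fun; exact: continuous_plat.
- exact: intg_meas Gi'.
- move: (ae_integrable_sec2 mI mJ Fi); apply: ae_imp => t + Jt => /(_ Jt) Fit.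
  by rewrite /= RintegralZr.
Qed.

Lemma du_Bois_Reymond_t :
  (forall (k : nat) (c d : rat), valid k c d a' b' -> forall (k' : nat) (c' d' : rat), valid k' c' d' a b ->
     \int[mu2]_(z in I `*` J) ((w z * plat k.+1%:R (ratr c) (ratr d) 1 z.2 + g z * plat k.+1%:R (ratr c) (ratr d) 0 z.2)
        * plat k'.+1%:R (ratr c') (ratr d') 0 z.1) = 0) ->
  \forall x \ae mu, I x -> exists C, \forall t \ae mu, J t -> w (x, t) = C + prim a' (fun t => g (x, t)) t.
Proof.
move=> H.
have mI : measurable I by exact: measurable_itv.
have mJ : measurable J by exact: measurable_itv.
apply: (@du_Bois_Reymond_family a' b' a b (fun x t => w (x, t)) (fun x t => g (x, t))) => //.
- exact: (ae_integrable_sec1 mI mJ wi).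
- exact: (ae_integrable_sec1 mI mJ gi).
move=> k c d K ac cd db h.
pose F z := w z * plat K (ratr c) (ratr d) 1 z.2 + g z * plat K (ratr c) (ratr d) 0 z.2.
have Fi : intg mu2 (I `*` J) F.
  by apply: intgD; [exact: measurableX|apply: intg_mul_cont2|apply: intg_mul_cont2] => //; exact: continuous_plat.
have [hi _] := Rintegral_fubini1 mI mJ Fi; split; first exact: hi.
move=> k' c' d' K' ac' cd' db'.
rewrite -(H k c d _ k' c' d' _)//.
have Gi : intg mu2 (I `*` J) (fun z => F z * plat K' (ratr c') (ratr d') 0 z.1).
  by apply: intg_mul_cont1 => //; exact: continuous_plat.
have [Gi' <-] := Rintegral_fubini1 mI mJ Gi.
apply: ae_eq_Rintegral => //.
- apply: measurable_funM; first exact: intg_meas hi.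
  by apply: measurable_funTS; apply: continuous_measurable_fun; exact: continuous_plat.
- exact: intg_meas Gi'.
- move: (ae_integrable_sec1 mI mJ Fi); apply: ae_imp => t + Jt => /(_ Jt) Fit.
  by rewrite /= RintegralZr.
Qed.

(** If g h, with h a function of t, integrates to 0 against the plateaus in x, then
    the integrals of g h over J vanish for almost every x. *)
Lemma fundamental_lemma_x h : continuous h ->
  (forall (k : nat) (c d : rat), valid k c d a b ->
     \int[mu2]_(z in I `*` J) ((g z * h z.2) * plat k.+1%:R (ratr c) (ratr d) 0 z.1) = 0) ->
  \forall x \ae mu, I x -> \int[mu]_(t in J) (g (x, t) * h t) = 0.
Proof.
move=> ch H.
have mI : measurable I by exact: measurable_itv.
have mJ : measurable J by exact: measurable_itv.
have Fi := intg_mul_cont2 gi ch.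
have [hi _] := Rintegral_fubini1 mI mJ Fi.
apply: fundamental_lemma => // k c d K ac cd db.
rewrite -(H k c d)//.
have Gi : intg mu2 (I `*` J) (fun z => g z * h z.2 * plat K (ratr c) (ratr d) 0 z.1).
  by apply: intg_mul_cont1 => //; exact: continuous_plat.
have [Gi' <-] := Rintegral_fubini1 mI mJ Gi.
apply: ae_eq_Rintegral => //.
- apply: measurable_funM; first exact: intg_meas hi.
  by apply: measurable_funTS; apply: continuous_measurable_fun; exact: continuous_plat.
- exact: intg_meas Gi'.
- move: (ae_integrable_sec1 mI mJ Fi); apply: ae_imp => t + Jt => /(_ Jt) Fit.
  by rewrite /= RintegralZr.
Qed.

End Rectangle.
End FundamentalLemma.

(** * Products of test functions and periodic extensions *)

Section Chains.
Variable R : realType.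
Implicit Types (fs gs : nat -> R -> R) (m i : nat).

(** fs 0, ..., fs m are continuous, and each is the derivative of the one before. *)
Definition chain m fs := (forall i, (i < m)%N -> forall x : R, is_derive x 1 (fs i) (fs i.+1 x)) /\
  (forall i, (i <= m)%N -> continuous (fs i)).

(** The function f(x) g(t). *)
Definition tens (f g : R -> R) (z : R * R) := f z.1 * g z.2.

Lemma chain_le m n fs : (n <= m)%N -> chain m fs -> chain n fs.
Proof. by move=> nm [H1 H2]; split=> i im; [apply: H1; exact: leq_trans nm|apply: H2; exact: leq_trans nm]. Qed.

Lemma chain_shift m n fs : chain (m + n) fs -> chain m (fun i => fs (n + i)%N).
Proof.
by move=> [H1 H2]; split=> i im x; [rewrite addnS; apply: H1|apply: H2]; rewrite addnC ?ltn_add2r ?leq_add2r.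
Qed.

Lemma chain_plat K c d : chain 2 (plat K c d : nat -> R -> R).
Proof. by split=> i im; [move=> x; exact: is_derive_plat|exact: continuous_plat]. Qed.

Lemma pders_tens m fs gs s : chain m fs -> chain m gs -> (size s <= m)%N ->
  pders s (tens (fs 0%N) (gs 0%N)) = tens (fs (count negb s)) (gs (count id s)).
Proof.
move=> [f1 _] [g1 _]; elim: s => //= b s IH sm.
have sm' : (size s < m)%N by [].
rewrite (IH (ltnW sm)); apply/funext => -[x t]; rewrite /pder /tens/=.
have cf : (count negb s < m)%N by exact: leq_ltn_trans (count_size _ _) sm'.
have cg : (count id s < m)%N by exact: leq_ltn_trans (count_size _ _) sm'.
case: b => /=; rewrite ?add0n ?add1n derive1E.
  have D := is_deriveZ (fs (count negb s) x) (g1 _ cg t).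
  by rewrite (@derive_val _ _ _ _ _ _ _ D).
have D := is_deriveZ (gs (count id s) t) (f1 _ cf x).
have -> : (fun y => fs (count negb s) y * gs (count id s) t) = (gs (count id s) t \*: fs (count negb s)).
  by apply/funext => y; exact: mulrC.
by rewrite (@derive_val _ _ _ _ _ _ _ D) /GRing.scale/= mulrC.
Qed.

Lemma Cm2_tens m fs gs : chain m fs -> chain m gs -> Cm2 m (tens (fs 0%N) (gs 0%N)).
Proof.
move=> Cf Cg s; split => [sm|sm].
  rewrite (pders_tens Cf Cg sm).
  have cf : continuous (fs (count negb s)) by apply: Cf.2; exact: leq_trans (count_size _ _) sm.
  have cg : continuous (gs (count id s)) by apply: Cg.2; exact: leq_trans (count_size _ _) sm.
  move=> z; apply: cvgM.
    by apply: (@continuous_comp _ _ _ fst (fs (count negb s))); [exact: cvg_fst|exact: cf].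
  by apply: (@continuous_comp _ _ _ snd (gs (count id s))); [exact: cvg_snd|exact: cg].
move=> b [x t]; rewrite (pders_tens Cf Cg (ltnW sm)) /pderivable /tens/=.
have cf : (count negb s < m)%N by exact: leq_ltn_trans (count_size _ _) sm.
have cg : (count id s < m)%N by exact: leq_ltn_trans (count_size _ _) sm.
case: b => /=.
  have D := is_deriveZ (fs (count negb s) x) (Cg.1 _ cg t); exact: ex_derive.
have D := is_deriveZ (gs (count id s) t) (Cf.1 _ cf x).
rewrite [X in derivable X](_ : _ = (gs (count id s) t) \*: fs (count negb s)); first exact: ex_derive.
by apply/funext => y; rewrite /GRing.scale/= mulrC.
Qed.

Lemma pderij_tens m i k fs gs : chain m fs -> chain m gs -> (i + k <= m)%N ->
  pderij i k (tens (fs 0%N) (gs 0%N)) = tens (fs i) (gs k).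
Proof.
move=> Cf Cg ikm; rewrite /pderij (pders_tens Cf Cg) ?size_cat ?size_nseq//.
by rewrite !count_cat !count_nseq/= mul1n mul0n addn0 mul1n mul0n add0n.
Qed.

(** The T-periodic function that agrees with f on [0, T). *)
Definition per (T : R) (f : R -> R) t := f (t - T * (Num.floor (t / T))%:~R).

Lemma per_periodic T f t : 0 < T -> per T f (t + T) = per T f t.
Proof.
move=> T0; rewrite /per mulrDl divff ?gt_eqF//.
have -> : Num.floor (t / T + 1) = Num.floor (t / T) + 1.
  apply: floor_def; have := floor_le (t / T); have := floorD1_gt (t / T).
  by rewrite !intrD => H1 H2; apply/andP; split; lra.
by rewrite intrD; congr f; ring.
Qed.

(** If f vanishes outside (0, T), then around any point the periodic extension is
    the sum of two translates of f. *)
Lemma per_loc T f (n : int) t : 0 < T -> (forall x, ~ (0 < x < T) -> f x = 0) ->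
  (T * n%:~R - T < t < T * n%:~R + T) ->
  per T f t = f (t - T * n%:~R) + f (t - T * n%:~R + T).
Proof.
move=> T0 f0 /andP[lt ut]; rewrite /per.
have [tn|nt] := leP (T * n%:~R) t.
  have -> : Num.floor (t / T) = n.
    apply: floor_def; rewrite intrD ler_pdivlMr// ltr_pdivrMr//; apply/andP; split; first by rewrite mulrC.
    by rewrite mulrDl mul1r mulrC.
  rewrite (f0 (t - T * n%:~R + T)) ?addr0//; lra.
have -> : Num.floor (t / T) = n - 1.
  apply: floor_def; rewrite subrK intrB ler_pdivlMr// ltr_pdivrMr//; apply/andP; split; last by rewrite mulrC.
  by rewrite mulrBl mul1r mulrC ltW.
rewrite (f0 (t - T * n%:~R)) ?add0r; last by lra.
by rewrite intrB; congr f; ring.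
Qed.

Lemma chain_per m T fs : 0 < T -> (forall i, (i <= m)%N -> forall x, ~ (0 < x < T) -> fs i x = 0) ->
  chain m fs -> chain m (fun i => per T (fs i)).
Proof.
move=> T0 f0 [C1 C2].
have itv t : exists n : int, T * n%:~R - T < t < T * n%:~R + T.
  exists (Num.floor (t / T)); apply/andP; split.
    have : (Num.floor (t / T))%:~R <= t / T by exact: floor_le.
    by rewrite ler_pdivlMr// => H; lra.
  have : t / T < (Num.floor (t / T) + 1)%:~R by exact: floorD1_gt.
  by rewrite intrD ltr_pdivrMr// => H; lra.
have nr t (n : int) f : T * n%:~R - T < t < T * n%:~R + T -> (forall x, ~ (0 < x < T) -> f x = 0) ->
  \near t, f (t - T * n%:~R) + f (t - T * n%:~R + T) = per T f t.
  move=> /andP[lt ut] f00; near=> s; rewrite -per_loc//; apply/andP; split; near: s.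
    exact: lt_nbhsr.
  exact: lt_nbhsl.
split=> i im t; have [n tn] := itv t.
- have fi0 := f0 i (ltnW im).
  apply: (near_eq_is_derive (nr t n _ tn fi0)).
  rewrite (per_loc T0 (f0 i.+1 im) tn).
  have D e : is_derive t 1 (fun s => fs i (s + e)) (fs i.+1 (t + e)).
    have := @is_derive1_comp R (fs i) (fun y => y + e) t _ 1 (C1 i im (t + e)).
    rewrite mulr1; apply.
    have := @is_deriveD R R R id (cst e) t 1 1 0 (is_derive_id _ _) (is_derive_cst _ _ _).
    by rewrite addr0.
  have -> : (fun s => fs i (s - T * n%:~R) + fs i (s - T * n%:~R + T)) =
    (fun s => fs i (s - T * n%:~R)) + (fun s => fs i (s + (- (T * n%:~R) + T))).
    by apply/funext => s; rewrite addrfctE/= addrA.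
  apply: (is_derive_eq (is_deriveD (D (- (T * n%:~R))) (D (- (T * n%:~R) + T)))).
  by rewrite addrA.
- have fi0 := f0 i im.
  have cs (e : R) : {for t, continuous (fun s => fs i (s + e))}.
    apply: (@continuous_comp _ _ _ (fun s => s + e) (fs i)); last exact: C2.
    by apply: cvgD; [exact: cvg_id|exact: cvg_cst].
  have H := nr t n _ tn fi0.
  rewrite /continuous_at -(nbhs_singleton H).
  apply: cvg_trans (near_eq_cvg H) _.
  apply: cvgD; first exact: cs.
  under eq_cvg do rewrite -addrA.
  rewrite -addrA; exact: cs.
Unshelve. all: by end_near.
Qed.

End Chains.

(** * Functions on the graph *)

Section GraphBasics.
Variable R : realType.
Local Notation mu := (@lebesgue_measure R).
Local Notation mu2 := (mu \x mu)%E.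
Implicit Types (n : int) (j : branch) (f g : gfun R).

Lemma lend_lt_rend n j : lend R n j < rend R n j.
Proof.
by have := pi_gt0 R; case: j; rewrite /lend /rend /va /vb ?intrD => p0; lra.
Qed.

Lemma measurable_edge n j : measurable (@edge R n j).
Proof. exact: measurable_itv. Qed.

(** An enumeration of the integers, so that countable unions over them are unions
    over nat. *)
Definition int_of_code (k : nat) : int := odflt 0 (unpickle k).

Lemma gdomE j : @gdom R j = \bigcup_k @edge R (int_of_code k) j.
Proof.
apply/seteqP; split => [x [n _ nx]|x [k _ kx]]; last by exists (int_of_code k).
by exists (pickle n) => //; rewrite /int_of_code pickleK.
Qed.

Lemma measurable_gdom j : measurable (@gdom R j).
Proof. by rewrite gdomE; apply: bigcup_measurable => k _; exact: measurable_edge. Qed.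

Lemma measurable_torus : measurable (@torus R).
Proof. exact: measurable_itv. Qed.

Hint Extern 0 (_.-measurable (@edge _ _ _)) => solve [exact: measurable_edge] : core.
Hint Extern 0 (_.-measurable (@gdom _ _)) => solve [exact: measurable_gdom] : core.
Hint Extern 0 (_.-measurable (@torus _)) => solve [exact: measurable_torus] : core.

Lemma edge_sub n j : @edge R n j `<=` @gdom R j.
Proof. by move=> x nx; exists n. Qed.

Lemma gdom_meas_fun j (h : R -> R) : (forall n, measurable_fun (@edge R n j) h) -> measurable_fun (@gdom R j) h.
Proof.
move=> H; by rewrite gdomE; apply/measurable_fun_bigcup => // k; exact: H.
Qed.

Lemma ae_gdom j (P : R -> Prop) : (forall n, \forall x \ae mu, @edge R n j x -> P x) ->
  \forall x \ae mu, @gdom R j x -> P x.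
Proof.
move=> H; have := ae_count H; apply: ae_imp => x Hx [n _ nx]; exact: (Hx n).
Qed.

Lemma ge0_adde3_lty (a b c : \bar R) : (0 <= a)%E -> (0 <= b)%E -> (0 <= c)%E -> (a + b + c < +oo)%E ->
  [/\ (a < +oo)%E, (b < +oo)%E & (c < +oo)%E].
Proof.
move=> a0 b0 c0 H; split; apply: le_lt_trans H.
- by rewrite -addeA leeDl// adde_ge0.
- by rewrite -addeA addeCA leeDl// adde_ge0.
- by rewrite leeDr// adde_ge0.
Qed.

Lemma gint_intg (F : gfun R) : (forall j, intg mu (@gdom R j) (F j)) ->
  gint F = (\int[mu]_(x in @gdom R mid) F mid x + \int[mu]_(x in @gdom R up) F up x + \int[mu]_(x in @gdom R low) F low x)%:E.
Proof. by move=> H; rewrite /gint !integral_EFin. Qed.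

Lemma gint_ae_eq (F G : gfun R) : (forall j, measurable_fun (@gdom R j) (F j)) ->
  (forall j, measurable_fun (@gdom R j) (G j)) ->
  (forall j, \forall x \ae mu, @gdom R j x -> F j x = G j x) -> gint F = gint G.
Proof.
move=> mF mG FG.
have K j : (\int[mu]_(x in gdom j) (F j x)%:E = \int[mu]_(x in gdom j) (G j x)%:E)%E.
  apply: ae_eq_integral; [by []|apply/measurable_EFinP; exact: mF|apply/measurable_EFinP; exact: mG|].
  by move: (FG j); apply: ae_imp => x + gx => /(_ gx) /= ->.
by rewrite /gint !K.
Qed.

Lemma L2G_intg f : L2G f -> forall j, intg mu (@gdom R j) (fun x => f j x ^+ 2).
Proof.
move=> [mf fi] j.
have ge (i : branch) : (0 <= \int[mu]_(x in @gdom R i) (f i x ^+ 2)%:E)%E.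
  by apply: integral_ge0 => x _; rewrite lee_fin sqr_ge0.
have [i1 i2 i3] := ge0_adde3_lty (ge _) (ge _) (ge _) fi.
apply/integrableP; split; first by apply/measurable_EFinP; apply: measurable_funX; exact: mf.
under eq_integral do rewrite /= ger0_norm ?sqr_ge0//.
by case: j.
Qed.

Lemma intg_L2G f : (forall j, measurable_fun (@gdom R j) (f j)) ->
  (forall j, intg mu (@gdom R j) (fun x => f j x ^+ 2)) -> L2G f.
Proof. by move=> mf fi; split => //; rewrite gint_intg// ltry. Qed.

Lemma L2G_mul f g : L2G f -> L2G g -> forall j, intg mu (@gdom R j) (fun x => f j x * g j x).
Proof.
move=> Lf Lg j; have [[mf _] [mg _]] := (Lf, Lg).
apply: (@intg_le _ _ _ mu _ _ (fun x => f j x ^+ 2 + g j x ^+ 2)) => //.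
- exact: measurable_funM (mf j) (mg j).
- move=> x _; rewrite normrM -(real_normK (num_real (f j x))) -(real_normK (num_real (g j x))).
  by have := sqr_ge0 (`|f j x| - `|g j x|); have := normr_ge0 (f j x); have := normr_ge0 (g j x); nra.
- by apply: intgD => //; exact: L2G_intg.
Qed.

Lemma intg_sq_itv (a b : R) (h : R -> R) : measurable_fun `[a, b] h -> intg mu `[a, b] (fun x => h x ^+ 2) -> intg mu `[a, b] h.
Proof.
move=> mh hi.
apply: (@intg_le _ _ _ mu _ _ (fun x => 1 + h x ^+ 2)) => //.
- by move=> x _; rewrite -(real_normK (num_real (h x))); have := normr_ge0 (h x); nra.
- apply: intgD => //; apply: intg_cont => z; exact: cvg_cst.
Qed.

Lemma L2G_edge f n j : L2G f -> intg mu (@edge R n j) (f j).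
Proof.
move=> Lf; apply: intg_sq_itv.
  by apply: measurable_funS (Lf.1 j) => //; exact: edge_sub.
by apply: intgS (L2G_intg Lf j) => //; exact: edge_sub.
Qed.

(** On the edge, f is almost everywhere an absolutely continuous function with
    derivative g. *)
Definition AC_edge n j (f g : R -> R) := exists C,
  \forall x \ae mu, @edge R n j x -> f x = C + prim (lend R n j) g x.

Lemma C1cP (a b : R) (phi : R -> R) : C1c a b phi ->
  (forall x : R, is_derive x 1 phi (derive1 phi x)) /\ (phi a = 0 /\ phi b = 0).
Proof.
move=> [d c [a' [b' [aa' bb' H]]]]; split; first by move=> x; rewrite derive1E; exact: DeriveDef.
by split; apply: H; lra.
Qed.

Lemma C1c_cont (a b : R) (phi : R -> R) : C1c a b phi -> continuous phi.
Proof.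
move=> [d c _] x; apply: differentiable_continuous; apply/derivable1_diffP; exact: d.
Qed.

Lemma derive1_plat (K c d : R) i : (i < 2)%N -> derive1 (plat K c d i) = plat K c d i.+1.
Proof.
move=> i2; apply/funext => x; rewrite derive1E.
by have D := is_derive_plat K c d x i2; rewrite (@derive_val _ _ _ _ _ _ _ D).
Qed.

Lemma C1c_plat (a b K c d : R) : 0 < K -> c <= d -> a < c -> d + 3 / K < b -> C1c a b (plat K c d 0).
Proof.
move=> K0 cd ac db; split.
- by move=> x; have D := is_derive_plat K c d x (isT : (0 < 2)%N); exact: ex_derive.
- by rewrite derive1_plat//; exact: continuous_plat.
- by exists c, (d + 3 / K); split => // x; exact: plat_out.
Qed.

Lemma weak_deriv_AC f g n j : L2G f -> L2G g -> weak_deriv f g -> AC_edge n j (f j) (g j).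
Proof.
move=> Lf Lg W; have fi := L2G_edge n j Lf; have gi := L2G_edge n j Lg.
apply: (du_Bois_Reymond (lend_lt_rend n j) fi gi) => k c d K ac cd db.
have K0 : 0 < K by rewrite ltr0n.
have := W n j _ (C1c_plat K0 cd ac db); rewrite derive1_plat//.
have i1 := intg_mul_cont fi (@continuous_plat R K (ratr c) (ratr d) 1).
have i2 := intg_mul_cont gi (@continuous_plat R K (ratr c) (ratr d) 0).
rewrite integral_EFin// integral_EFin// -EFinN => -[E].
by rewrite RintegralD// E addNr.
Qed.

Lemma AC_weak_deriv f g : L2G f -> L2G g -> (forall n j, AC_edge n j (f j) (g j)) -> weak_deriv f g.
Proof.
move=> Lf Lg H n j phi phiC; have [C HC] := H n j.
have fi := L2G_edge n j Lf; have gi := L2G_edge n j Lg.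
have [dphi [pa pb]] := C1cP phiC; have cphi := C1c_cont phiC; have [_ cphi' _] := phiC.
have := ibp_C1 (ltW (lend_lt_rend n j)) fi gi HC dphi cphi'.
have i1 := intg_mul_cont fi cphi'.
have i2 := intg_mul_cont gi cphi.
rewrite pa pb !mulr0 subrr RintegralD// => /eqP; rewrite addr_eq0 => /eqP E.
by rewrite integral_EFin// integral_EFin// -EFinN E.
Qed.

Lemma prim_ae (a b : R) (g h : R -> R) x : x <= b -> intg mu `[a, b] g -> measurable_fun `[a, b] h ->
  (\forall x \ae mu, `[a, b]%classic x -> g x = h x) -> prim a g x = prim a h x.
Proof.
move=> xb gi mh gh.
have sub : `[a, x] `<=` `[a, b].
  by move=> y /=; rewrite !in_itv/= => /andP[->/=] /le_trans; apply.
apply: ae_eq_Rintegral => //.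
- by apply: intg_meas; apply: intgS gi.
- by apply: measurable_funS mh.
- by move: gh; apply: ae_imp => y gh /sub; exact: gh.
Qed.

Lemma prim_sub (a b : R) (g h : R -> R) x : x <= b -> intg mu `[a, b] g -> intg mu `[a, b] h ->
  prim a (fun y => g y - h y) x = prim a g x - prim a h x.
Proof.
by move=> xb gi hi; rewrite /prim RintegralB//; apply: intg_sub; [exact: lexx|exact: xb|exact: gi|exact: lexx|exact: xb|exact: hi].
Qed.

(** The derivative of an absolutely continuous function is unique. *)
Lemma AC_unique (a b : R) (f g h : R -> R) C C' : a < b -> intg mu `[a, b] g -> intg mu `[a, b] h ->
  (\forall x \ae mu, `[a, b]%classic x -> f x = C + prim a g x) ->
  (\forall x \ae mu, `[a, b]%classic x -> f x = C' + prim a h x) ->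
  \forall x \ae mu, `[a, b]%classic x -> g x = h x.
Proof.
move=> ab gi hi H1 H2.
have di : intg mu `[a, b] (fun y => g y - h y) by exact: intgB.
have P : \forall x \ae mu, `[a, b]%classic x -> prim a (fun y => g y - h y) x = C' - C.
  move: H2 H1; apply: ae_imp2 => x + + Ix => /(_ Ix) E1 /(_ Ix) E2.
  rewrite (prim_sub (b := b))//; last by move: Ix; rewrite /= in_itv/= => /andP[].
  rewrite E1 in E2; lra.
have HP := prim_ae_const ab di P.
have C0 : C' - C = 0 by rewrite -(HP a) ?prim_aa// lexx ltW.
have := ae_eq0_prim ab di; rewrite -C0 => /(_ HP).
by rewrite C0; apply: ae_imp => x + Ix => /(_ Ix) /eqP; rewrite subr_eq0 => /eqP.
Qed.

Lemma dwP f : H1G f -> L2G (dw f) /\ weak_deriv f (dw f).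
Proof.
move=> [Lf [g gP]].
have := @xgetPex (gfun R) (fun _ _ => 0) [set g | L2G g /\ weak_deriv f g].
by apply; exists g.
Qed.

(** The chosen weak derivative of f is the derivative of the absolutely continuous
    representative of f. *)
Lemma dw_AC f g : L2G f -> L2G g -> (forall n j, AC_edge n j (f j) (g j)) ->
  forall j, \forall x \ae mu, @gdom R j x -> dw f j x = g j x.
Proof.
move=> Lf Lg H j.
have Hf : H1G f by split => //; exists g; split => //; exact: AC_weak_deriv.
have [Ld Wd] := dwP Hf.
apply: ae_gdom => n; have [C HC] := H n j; have [C' HC'] := weak_deriv_AC n j Lf Ld Wd.
by apply: AC_unique (lend_lt_rend n j) _ _ HC' HC; exact: L2G_edge.
Qed.

(** The value of f at an end point c of an edge is that of its continuous
    representative. *)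
Lemma AC_vertex (a b : R) (f g : R -> R) C c : a < b -> a <= c <= b -> intg mu `[a, b] g ->
  (\forall x \ae mu, `[a, b]%classic x -> f x = C + prim a g x) ->
  f @ ess_within `[a, b] c --> C + prim a g c.
Proof.
move=> ab cab gi fE U [e /= e0 eU].
have [d d0 Hd] := prim_cvg (ltW ab) gi cab e0.
exists d => //; move: fE; apply: ae_imp => x fE Ix xd.
apply: eU; rewrite /ball/= (fE Ix) opprD addrACA subrr add0r distrC; exact: Hd.
Qed.

Lemma vertex_unique (a b : R) (f : R -> R) (c l l' : R) : a < b -> a <= c <= b ->
  f @ ess_within `[a, b] c --> l -> f @ ess_within `[a, b] c --> l' -> l = l'.
Proof.
move=> ab cab H1 H2; apply/eqP; rewrite -subr_eq0 -normr_le0; apply/ler_addgt0Pr => e e0; rewrite add0r.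
have e2 : 0 < e / 2 by rewrite divr_gt0.
have [d1 d10 A1] := H1 _ (nbhsx_ballx l _ e2).
have [d2 d20 A2] := H2 _ (nbhsx_ballx l' _ e2).
have d0 : 0 < Num.min d1 d2 by rewrite lt_min d10.
have A : \forall x \ae mu, `[a, b]%classic x -> `|x - c| < Num.min d1 d2 -> ball l (e / 2) (f x) /\ ball l' (e / 2) (f x).
  move: A1 A2; apply: ae_imp2 => x B1 B2 Ix; rewrite lt_min => /andP[x1 x2].
  by split; [exact: B1|exact: B2].
have [x [_ xd /(_ xd)[]]] := ae_witness ab cab d0 A.
rewrite /ball/= => b1 b2; have -> : l - l' = (l - f x) - (l' - f x) by ring.
by apply: (le_trans (ler_normB _ _)); rewrite [e]splitr lerD// ltW.
Qed.

End GraphBasics.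
#[global] Hint Extern 0 (_.-measurable (@edge _ _ _)) => solve [exact: measurable_edge] : core.
#[global] Hint Extern 0 (_.-measurable (@gdom _ _)) => solve [exact: measurable_gdom] : core.
#[global] Hint Extern 0 (_.-measurable (@torus _)) => solve [exact: measurable_torus] : core.

(** * Weak derivatives on the product of an edge and the circle *)

Section SpaceTime.
Variable R : realType.
Local Notation mu := (@lebesgue_measure R).
Local Notation mu2 := (mu \x mu)%E.
Local Notation P4 := (4 * pi : R).
Implicit Types (n : int) (j : branch) (u w g : gfun2 R).

Lemma P4_gt0 : 0 < P4.
Proof. by rewrite mulr_gt0// pi_gt0. Qed.

Lemma measurable_gT j : measurable (@gdom R j `*` @torus R).
Proof. exact: measurableX. Qed.

Lemma measurable_eT n j : measurable (@edge R n j `*` @torus R).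
Proof. exact: measurableX. Qed.

Hint Extern 0 (_.-measurable (_ `*` _)) => solve [exact: measurable_gT|exact: measurable_eT] : core.

Lemma L2GT_meas u j : L2GT u -> measurable_fun (@gdom R j `*` @torus R) (u j).
Proof.
move=> [mu_ _ _]; apply: measurable_funS (mu_ j); first exact: measurableX.
by move=> [x t] [].
Qed.

Lemma L2GT_sec u t : L2GT u -> forall j, measurable_fun (@gdom R j) (fun x => u j (x, t)).
Proof.
move=> [mu_ _ _] j.
have mr : measurable_fun setT (u j \_ (@gdom R j `*` setT)).
  by apply: (measurable_restrictT _ _).1; [exact: measurableX|exact: mu_].
have : measurable_fun setT (fun x => (u j \_ (@gdom R j `*` setT)) (x, t)).
  apply: measurableT_comp mr _; exact: pair2_measurable.
move=> /(@measurable_funTS _ _ _ _ (@gdom R j)); apply: eq_measurable_fun.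
by move=> x; rewrite inE => gx; rewrite patchE mem_set.
Qed.

Lemma L2GT_sq u j : L2GT u -> intg mu2 (@gdom R j `*` @torus R) (fun z => u j z ^+ 2).
Proof.
move=> Lu; have [_ _ ui] := Lu.
have ge (i : branch) : (0 <= \int[mu2]_(z in @gdom R i `*` @torus R) (u i z ^+ 2)%:E)%E.
  by apply: integral_ge0 => x _; rewrite lee_fin sqr_ge0.
have [i1 i2 i3] := ge0_adde3_lty (ge _) (ge _) (ge _) ui.
apply/integrableP; split.
  by apply/measurable_EFinP; apply: measurable_funX; exact: L2GT_meas.
under eq_integral do rewrite /= ger0_norm ?sqr_ge0//.
by case: j.
Qed.

Lemma mu2_fin n j : (mu2 (@edge R n j `*` @torus R) < +oo)%E.
Proof.
have E1 : mu (@edge R n j) = _ := lebesgue_measure_itv _.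
have E2 : mu (@torus R) = _ := lebesgue_measure_itv _.
rewrite product_measure1E// [X in (X * _)%E]E1 [X in (_ * X)%E]E2/=.
by case: ifP => _; case: ifP => _; rewrite ?mul0e ?mule0 ?ltry.
Qed.

Lemma edgeT_sub n j : @edge R n j `*` @torus R `<=` @gdom R j `*` @torus R.
Proof. by move=> [x t] [/= Ix Tt]; split => //=; exact: (edge_sub Ix). Qed.

Lemma L2GT_edge u n j : L2GT u -> intg mu2 (@edge R n j `*` @torus R) (u j).
Proof.
move=> Lu.
have mE : measurable_fun (@edge R n j `*` @torus R) (u j).
  exact: (measurable_funS (measurable_gT j) (@edgeT_sub n j) (L2GT_meas Lu)).
apply: (@intg_le _ _ _ mu2 _ _ (fun z => 1 + u j z ^+ 2)) => //.
- by move=> z _; rewrite -(real_normK (num_real (u j z))); have := normr_ge0 (u j z); nra.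
- apply: intgD => //; last by apply: intgS (L2GT_sq j Lu) => //; exact: edgeT_sub.
  apply: measurable_bounded_integrable => //; first exact: mu2_fin.
  by exists 1; split; rewrite ?num_real// => x x1 z _ /=; rewrite normr1 ltW.
Qed.

(** Almost every section of an element of L^2(G x T) is in L^2(G). *)
Lemma L2GT_ae_L2G u : L2GT u -> \forall t \ae mu, @torus R t -> L2G (slice u t).
Proof.
move=> Lu.
have H j : \forall t \ae mu, @torus R t -> intg mu (@gdom R j) (fun x => u j (x, t) ^+ 2).
  by have := ae_integrable_sec2 _ _ (L2GT_sq j Lu); apply.
apply: ae_imp2 (H mid) (ae_and (H up) (H low)) => t H1 [H2 H3] Tt.
apply: intg_L2G; first exact: L2GT_sec.
by case; [exact: H1|exact: H2|exact: H3].
Qed.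

(** f has compact support in (a, b). *)
Definition csupp (a b : R) (f : R -> R) := exists a' b', [/\ a < a', b' < b &
   forall x, ~ (a' <= x <= b') -> f x = 0].

(** The definition of the weak derivative, for the test function
    fs 0 (x) gs 0 (t). *)
Lemma weak_test i k u g n j fs gs : L2GT u -> L2GT g -> weak_pderiv i k u g ->
  chain (i + k) fs -> chain (i + k) gs -> csupp (lend R n j) (rend R n j) (fs 0%N) ->
  (forall t, gs 0%N (t + P4) = gs 0%N t) ->
  \int[mu2]_(z in @edge R n j `*` @torus R) (u j z * fs i z.1 * gs k z.2) =
  (-1) ^+ (i + k) * \int[mu2]_(z in @edge R n j `*` @torus R) (g j z * fs 0%N z.1 * gs 0%N z.2).
Proof.
move=> Lu Lg W Cf Cg [a' [b' [aa' bb' f0]]] pg.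
have /W : Cm2c (i + k) (lend R n j) (rend R n j) (tens (fs 0%N) (gs 0%N)).
  split; first exact: Cm2_tens.
  - by move=> x t; rewrite /tens/= pg.
  - exists a', b'; split => // x t xab; by rewrite /tens/= f0// mul0r.
rewrite (pderij_tens Cf Cg)// /tens.
have ci : continuous (fs i) by apply: Cf.2; exact: leq_addr.
have ck : continuous (gs k) by apply: Cg.2; exact: leq_addl.
have c0 : continuous (fs 0%N) by apply: Cf.2.
have d0 : continuous (gs 0%N) by apply: Cg.2.
have i1 := intg_mul_cont2 (intg_mul_cont1 (L2GT_edge n j Lu) ci) ck.
have i2 := intg_mul_cont2 (intg_mul_cont1 (L2GT_edge n j Lg) c0) d0.
under eq_integral do rewrite mulrA.
under [X in _ = (_ * X)%E -> _]eq_integral do rewrite mulrA.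
by rewrite integral_EFin// integral_EFin// -EFinM => -[].
Qed.

Lemma csupp_plat (a b K c d : R) i : 0 < K -> c <= d -> a < c -> d + 3 / K < b -> (i <= 2)%N ->
  csupp a b (plat K c d i).
Proof. by move=> K0 cd ac db i2; exists c, (d + 3 / K); split => // x; exact: plat_out. Qed.

(** On the closed period [0, 4 pi] too, the periodic extension is f itself. *)
Lemma per_torus (f : R -> R) t : f 0 = 0 -> f P4 = 0 -> @torus R t -> per P4 f t = f t.
Proof.
have p0 := P4_gt0.
rewrite /torus/= in_itv/= => f0 f4 /andP[t0]; rewrite le_eqVlt => /predU1P[->|t4].
  rewrite /per divff ?gt_eqF//; have -> : Num.floor (1 : R) = 1 by apply: floor_def; rewrite lexx/= -[X in X < _]/(1%:~R) ltr_int.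
  by rewrite mulr1 subrr f0 f4.
rewrite /per; have -> : Num.floor (t / P4) = 0.
  by apply: floor_def; rewrite divr_ge0 ?(ltW p0)// ltr_pdivrMr// mul1r.
by rewrite mulr0 subr0.
Qed.

Section PeriodicPlateau.
Variables (k : nat) (c d : rat).
Let K : R := k.+1%:R.
Hypotheses (c0 : 0 < ratr c :> R) (cd : ratr c <= ratr d :> R) (d4 : ratr d + 3 / K < P4).
Let K0 : 0 < K. Proof. by rewrite ltr0n. Qed.

Lemma plat_out_P4 i : (i <= 2)%N -> forall x : R, ~ (0 < x < P4) -> plat K (ratr c) (ratr d) i x = 0.
Proof.
move=> i2 x nx; apply: plat_out => // /andP[cx xd]; apply: nx.
by rewrite (lt_le_trans c0)//= (le_lt_trans xd).
Qed.

Lemma chain_pplat : chain 2 (fun i => per P4 (plat K (ratr c) (ratr d) i)).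
Proof.
apply: chain_per; [exact: P4_gt0|move=> i i2; exact: plat_out_P4|exact: chain_plat].
Qed.

Lemma pplat_torus i t : (i <= 2)%N -> @torus R t -> per P4 (plat K (ratr c) (ratr d) i) t = plat K (ratr c) (ratr d) i t.
Proof.
by move=> i2; apply: per_torus; apply: plat_out_P4 => //; rewrite ltxx ?andbF.
Qed.
End PeriodicPlateau.

(** The weak derivative of w, in x for b = false and in t for b = true, is g, when
    tested with products of functions of class C^2.  Asking that fs 1 also has
    compact support costs nothing and lets second derivatives be treated
    as first derivatives of first derivatives. *)
Definition weak_tensor (b : bool) (w g : gfun2 R) := forall n j fs gs, chain 2 fs -> chain 2 gs ->
  csupp (lend R n j) (rend R n j) (fs 0%N) -> csupp (lend R n j) (rend R n j) (fs 1%N) ->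
  (forall i t, gs i (t + P4) = gs i t) ->
  \int[mu2]_(z in @edge R n j `*` @torus R) (w j z * fs (~~ b : nat) z.1 * gs (b : nat) z.2) =
  - \int[mu2]_(z in @edge R n j `*` @torus R) (g j z * fs 0%N z.1 * gs 0%N z.2).

Lemma weak_tensor_x u g : L2GT u -> L2GT g -> weak_pderiv 1 0 u g -> weak_tensor false u g.
Proof.
move=> Lu Lg W n j fs gs Cf Cg s0 _ pg.
by rewrite (weak_test (i := 1) (k := 0) Lu Lg W)//= ?mulN1r//; apply: chain_le; [|exact: Cf| |exact: Cg].
Qed.

Lemma weak_tensor_t u g : L2GT u -> L2GT g -> weak_pderiv 0 1 u g -> weak_tensor true u g.
Proof.
move=> Lu Lg W n j fs gs Cf Cg s0 _ pg.
by rewrite (weak_test (i := 0) (k := 1) Lu Lg W)//= ?mulN1r//; apply: chain_le; [|exact: Cf| |exact: Cg].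
Qed.

(** The derivative of order 2 is the derivative of the derivative of order 1: the
    test function fs 0 for the former is the test function fs 1 for the latter. *)
Lemma weak_tensor_xx u g h : L2GT u -> L2GT g -> L2GT h -> weak_pderiv 1 0 u g -> weak_pderiv 2 0 u h -> weak_tensor false g h.
Proof.
move=> Lu Lg Lh W1 W2 n j fs gs Cf Cg s0 s1 pg.
have E2 := weak_test (i := 2) (k := 0) Lu Lh W2 Cf Cg s0 (pg 0%N).
have Cf' : chain 1 (fun i => fs (1 + i)%N) by apply: (@chain_shift _ 1 1).
have Cg' : chain 1 gs by exact: chain_le Cg.
have E1 := weak_test (i := 1) (k := 0) Lu Lg W1 Cf' Cg' s1 (pg 0%N).
rewrite /= in E1 E2 *; rewrite E2 sqrrN expr1n mul1r expr1 mulN1r in E1.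
by rewrite E1 opprK.
Qed.

Lemma weak_tensor_tt u g h : L2GT u -> L2GT g -> L2GT h -> weak_pderiv 0 1 u g -> weak_pderiv 0 2 u h -> weak_tensor true g h.
Proof.
move=> Lu Lg Lh W1 W2 n j fs gs Cf Cg s0 s1 pg.
have E2 := weak_test (i := 0) (k := 2) Lu Lh W2 Cf Cg s0 (pg 0%N).
have Cg' : chain 1 (fun i => gs (1 + i)%N) by apply: (@chain_shift _ 1 1).
have Cf' : chain 1 fs by exact: chain_le Cf.
have E1 := weak_test (i := 0) (k := 1) Lu Lg W1 Cf' Cg' s0 (pg 1%N).
rewrite /= in E1 E2 *; rewrite E2 sqrrN expr1n mul1r expr1 mulN1r in E1.
by rewrite E1 opprK.
Qed.

(** For almost every t, the section of w at t is absolutely continuous on the edge,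
    with derivative the section of g. *)
Lemma weak_tensor_AC_x w g n j : L2GT w -> L2GT g -> weak_tensor false w g ->
  \forall t \ae mu, @torus R t -> AC_edge n j (fun x => w j (x, t)) (fun x => g j (x, t)).
Proof.
move=> Lw Lg W.
have wi := L2GT_edge n j Lw; have gi := L2GT_edge n j Lg.
apply: (du_Bois_Reymond_x (lend_lt_rend R n j) P4_gt0 wi gi) => k c d [ac cd db] k' c' d' [ac' cd' db'].
have K0 : 0 < k.+1%:R :> R by rewrite ltr0n.
have s0 := csupp_plat K0 cd ac db (isT : (0 <= 2)%N).
have s1 := csupp_plat K0 cd ac db (isT : (1 <= 2)%N).
have Cg := chain_pplat ac' cd' db'.
have := W n j _ _ (chain_plat k.+1%:R (ratr c) (ratr d)) Cg s0 s1 (fun i t => per_periodic _ _ P4_gt0).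
have cp i := @continuous_plat R k.+1%:R (ratr c) (ratr d) i.
have i1 := intg_mul_cont2 (intg_mul_cont1 wi (cp 1%N)) (Cg.2 0%N isT).
have i2 := intg_mul_cont2 (intg_mul_cont1 gi (cp 0%N)) (Cg.2 0%N isT).
move=> /eqP; rewrite -addr_eq0 /= -RintegralD// => /eqP E.
rewrite -[RHS]E; apply: eq_Rintegral => -[x t]; rewrite inE => -[/= _ Tt].
by rewrite (pplat_torus ac' cd' db')// mulrDl.
Qed.

Lemma weak_tensor_AC_t w g n j : L2GT w -> L2GT g -> weak_tensor true w g ->
  \forall x \ae mu, @edge R n j x -> exists C, \forall t \ae mu, @torus R t -> w j (x, t) = C + prim 0 (fun t => g j (x, t)) t.
Proof.
move=> Lw Lg W.
have wi := L2GT_edge n j Lw; have gi := L2GT_edge n j Lg.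
apply: (du_Bois_Reymond_t (lend_lt_rend R n j) P4_gt0 wi gi) => k' c' d' [ac' cd' db'] k c d [ac cd db].
have K0 : 0 < k.+1%:R :> R by rewrite ltr0n.
have s0 := csupp_plat K0 cd ac db (isT : (0 <= 2)%N).
have s1 := csupp_plat K0 cd ac db (isT : (1 <= 2)%N).
have Cg := chain_pplat ac' cd' db'.
have := W n j _ _ (chain_plat k.+1%:R (ratr c) (ratr d)) Cg s0 s1 (fun i t => per_periodic _ _ P4_gt0).
have cp i := @continuous_plat R k.+1%:R (ratr c) (ratr d) i.
have i1 := intg_mul_cont2 (intg_mul_cont1 wi (cp 0%N)) (Cg.2 1%N isT).
have i2 := intg_mul_cont2 (intg_mul_cont1 gi (cp 0%N)) (Cg.2 0%N isT).
move=> /eqP; rewrite -addr_eq0 /= -RintegralD// => /eqP E.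
rewrite -[RHS]E; apply: eq_Rintegral => -[x t]; rewrite inE => -[/= _ Tt].
by rewrite !(pplat_torus ac' cd' db')//; ring.
Qed.

(** A time derivative has mean 0 over the period, as the constant 1 is an
    admissible test function in t. *)
Lemma weak_tensor_mean_t w g n j : L2GT w -> L2GT g -> weak_tensor true w g ->
  \forall x \ae mu, @edge R n j x -> \int[mu]_(t in @torus R) g j (x, t) = 0.
Proof.
move=> Lw Lg W.
have gi := L2GT_edge n j Lg; have wi := L2GT_edge n j Lw.
pose one (i : nat) (t : R) : R := (i == 0%N)%:R.
have Cg : chain 2 one.
  split=> i _ x; last exact: cvg_cst.
  by rewrite /one/=; exact: is_derive_cst.
have c0 := Cg.2 0%N isT.
have := @fundamental_lemma_x _ _ _ _ _ _ (lend_lt_rend R n j) gi _ c0.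
have H : forall (k : nat) (c d : rat), [/\ lend R n j < ratr c, ratr c <= ratr d :> R & ratr d + 3 / k.+1%:R < rend R n j] ->
     \int[mu2]_(z in @edge R n j `*` @torus R) ((g j z * one 0%N z.2) * plat k.+1%:R (ratr c) (ratr d) 0 z.1) = 0.
  move=> k c d [ac cd db].
  have K0 : 0 < k.+1%:R :> R by rewrite ltr0n.
  have s0 := csupp_plat K0 cd ac db (isT : (0 <= 2)%N).
  have s1 := csupp_plat K0 cd ac db (isT : (1 <= 2)%N).
  have := W n j _ _ (chain_plat k.+1%:R (ratr c) (ratr d)) Cg s0 s1 (fun i t => erefl).
  rewrite [LHS](_ : _ = 0); last first.
    transitivity (\int[mu2]_(z in @edge R n j `*` @torus R) (0 : R)).
      by apply: eq_Rintegral => z _; rewrite /one/= mulr0.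
    by rewrite Rintegral_cst ?mul0r.
  move=> /esym/eqP; rewrite oppr_eq0 => /eqP E; rewrite -[RHS]E.
  by apply: eq_Rintegral => z _; rewrite /= mulrAC.
move=> /(_ H); apply: ae_imp => x + Ix => /(_ Ix) E; rewrite -[RHS]E.
by apply: eq_Rintegral => t _; rewrite /one/= mulr1.
Qed.

End SpaceTime.

(** * Spaces of functions of time with values in a function space on the graph *)

#[global] Hint Extern 0 (_.-measurable (_ `*` _)) => solve [exact: measurable_gT|exact: measurable_eT] : core.

Section Bochner.
Variable R : realType.
Local Notation mu := (@lebesgue_measure R).
Local Notation mu2 := (mu \x mu)%E.
Local Notation P4 := (4 * pi : R).
Implicit Types (n : int) (j : branch) (u w g : gfun2 R).

(** For nonnegative functions the integral is a supremum over the simple functions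
    below, so it is monotone without any measurability. *)
Lemma ge0_le_integral_any (f h : R -> \bar R) : (forall x, (0 <= f x)%E) -> (forall x, (f x <= h x)%E) ->
  (\int[mu]_x f x <= \int[mu]_x h x)%E.
Proof.
move=> f0 fh; have h0 x : (0 <= h x)%E by apply: le_trans (fh x).
rewrite !ge0_integralTE//; apply: ereal_sup_le => _ [s sf <-]; exists s => // x.
exact: le_trans (sf x) (fh x).
Qed.

(** The function f need not be measurable: the norm in H^1 of the section at t
    involves a choice of weak derivative for each t separately. *)
Lemma ae_bound_lty (D : set R) (f : R -> \bar R) (h : R -> R) : measurable D -> (forall x, D x -> (0 <= f x)%E) ->
  intg mu D h -> (\forall x \ae mu, D x -> (f x <= (h x)%:E)%E) ->
  (\int[mu]_(x in D) f x < +oo)%E.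
Proof.
move=> mD f0 hi [N [mN N0 HN]].
(* the bound |h| modified to +oo on the exceptional null set, so that it holds
everywhere *)
pose h' x := if x \in N then +oo%E else `|((h \_ D) x)%:E|%E.
have mh : measurable_fun setT (h \_ D) by apply: (measurable_restrictT _ _).1 => //; exact: intg_meas hi.
have H1 : (\int[mu]_x (f \_ D) x <= \int[mu]_x h' x)%E.
  apply: ge0_le_integral_any => x; first exact: erestrict_ge0.
  rewrite /h'; case: ifPn => [_|]; first by rewrite leey.
  rewrite notin_setE => nN; rewrite !patchE; case: ifPn => [|_]; last by rewrite lee_fin.
  rewrite inE => Dx; have [fx|fx] := pselect (f x <= (h x)%:E)%E.
    by apply: (le_trans fx); rewrite lee_fin ler_norm.
  by exfalso; apply: nN; apply: HN => /= /(_ Dx).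
rewrite integral_mkcond; apply: le_lt_trans H1 _.
have mh' : measurable_fun setT h'.
  apply: measurable_fun_ifT => //; last by apply: measurableT_comp => //; exact/measurable_EFinP.
  apply: (measurable_fun_bool true).
  rewrite (_ : _ @^-1` _ = N); first by rewrite setTI.
  by apply/seteqP; split => x /= H; [exact: set_mem|exact: mem_set].
have E : (\int[mu]_x h' x = \int[mu]_x `|((h \_ D) x)%:E|)%E; last first.
  by rewrite E; have := hi; rewrite integrable_mkcond// restrict_EFin => /integrableP[_]; exact.
apply: ge0_ae_eq_integral => //.
- by apply: measurableT_comp => //; exact/measurable_EFinP.
- by move=> x _; rewrite /h'; case: ifP.
- exists N; split => // x /= nE; apply: contrapT => nN; apply: nE => _.
  by rewrite /h' memNset.
Qed.

Lemma measurable_section_integral (D : set R) (F : R * R -> R) : measurable D -> measurable_fun (D `*` setT) F ->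
  measurable_fun setT (fun t => \int[mu]_(x in D) (F (x, t))%:E)%E.
Proof.
move=> mD mF; pose G := F \_ (D `*` setT).
have mDT : measurable (D `*` [set: R]) by exact: measurableX.
have mG : measurable_fun setT (EFin \o G).
  by apply/measurable_EFinP; exact: (measurable_restrictT _ _).1.
have E t : (\int[mu]_(x in D) (F (x, t))%:E = \int[mu]_x (EFin \o G) (x, t))%E.
  rewrite integral_mkcond; apply: eq_integral => x _.
  by rewrite /= /G !patchE in_setX/= in_setT andbT; case: ifP.
have P1 : measurable_fun setT (fun t => \int[mu]_x ((EFin \o G)^\+ (x, t)))%E :=
  measurable_fun_fubini_tonelli_G (m1 := mu) _ (measurable_funepos mG) (fun x => funepos_ge0 _ x).
have P2 : measurable_fun setT (fun t => \int[mu]_x ((EFin \o G)^\- (x, t)))%E :=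
  measurable_fun_fubini_tonelli_G (m1 := mu) _ (measurable_funeneg mG) (fun x => funeneg_ge0 _ x).
have -> : (fun t => \int[mu]_(x in D) (F (x, t))%:E)%E =
  (fun t => \int[mu]_x ((EFin \o G)^\+ (x, t)) - \int[mu]_x ((EFin \o G)^\- (x, t)))%E.
  apply/funext => t; rewrite E integralE.
  by congr (_ - _)%E; apply: eq_integral => x _; rewrite ?funeposE ?funenegE.
exact (emeasurable_funB P1 P2).
Qed.

Lemma cauchy_schwarz_itv (a b : R) (g : R -> R) : a <= b -> intg mu `[a, b] g -> intg mu `[a, b] (fun x => g x ^+ 2) ->
  (\int[mu]_(x in `[a, b]) g x) ^+ 2 <= (b - a) * \int[mu]_(x in `[a, b]) g x ^+ 2.
Proof.
move=> ab gi g2i; set I := Rintegral _ _ _; set N := Rintegral _ _ _.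
have N0 : 0 <= N by apply: Rintegral_ge0 => x _; exact: sqr_ge0.
have ci (c : R) : intg mu `[a, b] (cst c) by apply: intg_cont => z; exact: cvg_cst.
have muI : fine (mu `[a, b]) = b - a.
  by rewrite lebesgue_measure_itv/= lte_fin; case: ltP => [//|ba]; apply/eqP; rewrite eq_sym subr_eq0 eq_le ab ba.
(* the integral of (g - c)^2 is nonnegative; the optimal c is the mean of g *)
have key (c : R) : 0 <= N - 2 * c * I + c ^+ 2 * (b - a).
  have -> : N - 2 * c * I + c ^+ 2 * (b - a) = \int[mu]_(x in `[a, b]) ((g x ^+ 2 - 2 * c * g x) + cst (c ^+ 2) x).
    rewrite RintegralD//; last by apply: intgB => //; apply: intgZ.
    by rewrite RintegralB//; [rewrite RintegralZl// Rintegral_cst// muI|apply: intgZ].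
  by apply: Rintegral_ge0 => x _; rewrite /cst; have := sqr_ge0 (g x - c); nra.
have [ba0|ba0] := eqVneq (b - a) 0.
  rewrite ba0 mul0r.
  have E : b = a by apply/eqP; rewrite -subr_eq0 ba0.
  by rewrite /I E set_itv1 Rintegral_set1 expr0n.
have ba : 0 < b - a by rewrite lt_neqAle eq_sym ba0 subr_ge0.
have := key (I / (b - a)).
have -> : N - 2 * (I / (b - a)) * I + (I / (b - a)) ^+ 2 * (b - a) = N - I ^+ 2 / (b - a) by field.
by rewrite subr_ge0 ler_pdivrMr// mulrC.
Qed.

Lemma torus_cst (c : R) : intg mu (@torus R) (cst c).
Proof. by apply: intg_cont => z; exact: cvg_cst. Qed.

Lemma L2GT_pair u (phi : gfun R) j : L2GT u -> L2G phi ->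
  intg mu2 (@gdom R j `*` @torus R) (fun z => u j z * phi j z.1).
Proof.
move=> Lu Lp.
have mp : measurable_fun (@gdom R j `*` @torus R) (fun z : R * R => phi j z.1).
  apply: (measurable_comp (F := @gdom R j)) => //; last exact: measurable_funTS measurable_fst.
    by move=> _ [[x t] [/= gx _] <-].
  exact: Lp.1.
apply: (@intg_le _ _ _ mu2 _ _ (fun z => u j z ^+ 2 + phi j z.1 ^+ 2 * cst 1 z.2)) => //.
- by apply: measurable_funM => //; exact: L2GT_meas Lu.
- move=> z _; rewrite /cst mulr1 normrM -(real_normK (num_real (u j z))) -(real_normK (num_real (phi j z.1))).
  by have := sqr_ge0 (`|u j z| - `|phi j z.1|); have := normr_ge0 (u j z); have := normr_ge0 (phi j z.1); nra.
- apply: intgD => //; first exact: L2GT_sq.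
  by apply: (intg_tensor (f := fun x => phi j x ^+ 2)) => //; [exact: L2G_intg|exact: torus_cst].
Qed.

(** The inner product of u(t) and phi on the edges of type j, as a real number. *)
Definition ip_branch (u : gfun2 R) (phi : gfun R) j t := \int[mu]_(x in @gdom R j) (u j (x, t) * phi j x).
(** The inner product of u(t) and phi in L^2(G), as a real number. *)
Definition ip_sum (u : gfun2 R) (phi : gfun R) t := ip_branch u phi mid t + ip_branch u phi up t + ip_branch u phi low t.

Lemma ip_branch_intg u phi j : L2GT u -> L2G phi -> intg mu (@torus R) (ip_branch u phi j).
Proof. by move=> Lu Lp; exact: (Rintegral_fubini2 _ _ (L2GT_pair j Lu Lp)).1. Qed.

Lemma ip_sum_ae u phi : L2GT u -> L2G phi ->
  \forall t \ae mu, @torus R t -> ipL2 (slice u t) phi = (ip_sum u phi t)%:E.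
Proof.
move=> Lu Lp; move: (L2GT_ae_L2G Lu); apply: ae_imp => t + Tt => /(_ Tt) Lt.
by rewrite /ipL2 gint_intg// => j; exact: L2G_mul.
Qed.

Lemma ipL2_meas u phi : L2GT u -> L2G phi -> measurable_fun setT (fun t => ipL2 (slice u t) phi).
Proof.
move=> Lu Lp; have [mu_ _ _] := Lu.
have H j : measurable_fun setT (fun t => \int[mu]_(x in @gdom R j) (u j (x, t) * phi j x)%:E)%E.
  apply: (measurable_section_integral (F := fun z => u j z * phi j z.1)) => //; apply: measurable_funM; first exact: mu_.
  apply: (measurable_comp (F := @gdom R j)) => //; last exact: measurable_funTS measurable_fst.
    by move=> _ [[x t] [/= gx _] <-].
  exact: Lp.1.
by apply: emeasurable_funD => //; apply: emeasurable_funD.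
Qed.

Lemma sqnorm_branch_intg u j : L2GT u -> intg mu (@torus R) (fun t => \int[mu]_(x in @gdom R j) (u j (x, t) * u j (x, t))).
Proof.
move=> Lu; have H := L2GT_sq j Lu.
by have := (Rintegral_fubini2 (@measurable_gdom R j) (measurable_torus (R:=R)) H).1.
Qed.

(** The square of the norm of u(t) in L^2(G), as a real number. *)
Definition sqnorm (u : gfun2 R) t := \int[mu]_(x in @gdom R mid) (u mid (x, t) * u mid (x, t)) +
   \int[mu]_(x in @gdom R up) (u up (x, t) * u up (x, t)) + \int[mu]_(x in @gdom R low) (u low (x, t) * u low (x, t)).

Lemma sqnorm_intg u : L2GT u -> intg mu (@torus R) (sqnorm u).
Proof. by move=> Lu; apply: intgD => //; [apply: intgD => //|]; exact: sqnorm_branch_intg. Qed.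

Lemma sqnormE u t : L2G (slice u t) -> ipL2 (slice u t) (slice u t) = (sqnorm u t)%:E.
Proof. by move=> Lt; rewrite /ipL2 gint_intg// => j; exact: L2G_mul. Qed.

Lemma ipL2_ge0 (f : gfun R) : (0 <= ipL2 f f)%E.
Proof.
have H j : (0 <= \int[mu]_(x in @gdom R j) (f j x * f j x)%:E)%E.
  by apply: integral_ge0 => x _; rewrite lee_fin -expr2 sqr_ge0.
by apply: adde_ge0; [apply: adde_ge0|]; exact: H.
Qed.

Lemma bochner_L2_slice u : L2GT u -> bochner_L2 (@L2G R) (@ipL2 R) (slice u).
Proof.
move=> Lu; split; first exact: L2GT_ae_L2G.
- by move=> phi Lp; exists (fun t => ipL2 (slice u t) phi); [exact: ipL2_meas|exact: aeW].
- apply: (ae_bound_lty _ _ (sqnorm_intg Lu)) => //; first by move=> t _; exact: ipL2_ge0.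
  by move: (L2GT_ae_L2G Lu); apply: ae_imp => t + Tt => /(_ Tt) /sqnormE ->.
Qed.

Lemma CmT_chain i (psi : R -> R) : CmT i psi -> chain i (fun k => derive1n k psi).
Proof.
move=> [c d _]; split => k ki; last exact: c.
move=> x; have -> : derive1n k.+1 psi x = derive1 (derive1n k psi) x by [].
by rewrite derive1E; apply: DeriveDef => //; exact: d.
Qed.

(** For almost every x, the section v (x, .) is the weak derivative of order i of
    u (x, .), for a given test function psi on the circle. *)
Lemma weak_t_ae i u v n j (psi : R -> R) : (i <= 2)%N -> L2GT u -> L2GT v -> weak_pderiv 0 i u v -> CmT i psi ->
  \forall x \ae mu, @edge R n j x ->
    \int[mu]_(t in @torus R) (u j (x, t) * derive1n i psi t) = (-1) ^+ i * \int[mu]_(t in @torus R) (v j (x, t) * psi t).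
Proof.
move=> i2 Lu Lv W psiC; have Cp := CmT_chain psiC; have [cp _ pp] := psiC.
have ui := L2GT_edge n j Lu; have vi := L2GT_edge n j Lv.
have ci : continuous (derive1n i psi) by exact: cp.
have c0 : continuous psi by exact: (cp 0%N).
have iu := intg_mul_cont2 ui ci; have iv := intg_mul_cont2 vi c0.
have mE : measurable (@edge R n j `*` @torus R) by exact: measurable_eT.
pose G z := u j z * derive1n i psi z.2 - (-1) ^+ i * (v j z * psi z.2).
have iG : intg mu2 (@edge R n j `*` @torus R) G by apply: intgB => //; apply: intgZ.
have c1 : continuous (cst 1 : R -> R) by move=> z; exact: cvg_cst.
have := @fundamental_lemma_x _ _ _ _ _ _ (lend_lt_rend R n j) iG _ c1.
have H : forall (k : nat) (c d : rat), [/\ lend R n j < ratr c, ratr c <= ratr d :> R & ratr d + 3 / k.+1%:R < rend R n j] ->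
     \int[mu2]_(z in @edge R n j `*` @torus R) ((G z * cst 1 z.2) * plat k.+1%:R (ratr c) (ratr d) 0 z.1) = 0.
  move=> k c d [ac cd db].
  have K0 : 0 < k.+1%:R :> R by rewrite ltr0n.
  have s0 := csupp_plat K0 cd ac db (isT : (0 <= 2)%N).
  have Cf : chain i (plat k.+1%:R (ratr c) (ratr d) : nat -> R -> R) by apply: chain_le i2 (chain_plat _ _ _).
  have := weak_test (i := 0) (k := i) Lu Lv W Cf Cp s0 pp.
  rewrite /= add0n => /eqP.
  have cpl := @continuous_plat R k.+1%:R (ratr c) (ratr d) 0.
  have j1 := intg_mul_cont2 (intg_mul_cont1 ui cpl) ci.
  have j2 := intg_mul_cont2 (intg_mul_cont1 vi cpl) c0.
  rewrite -subr_eq0 -RintegralZl// -RintegralB//; last by apply: intgZ.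
  move=> /eqP E; rewrite -[RHS]E; apply: eq_Rintegral => z _; rewrite /G /=; ring.
move=> /(_ H) HG.
have A1 := ae_integrable_sec1 (@measurable_edge R n j) (measurable_torus (R:=R)) iu.
have A2 := ae_integrable_sec1 (@measurable_edge R n j) (measurable_torus (R:=R)) iv.
apply: ae_imp2 HG (ae_and A1 A2) => x + [B1 B2] Ix.
move=> /(_ Ix) E; apply/eqP; rewrite -subr_eq0 -RintegralZl//; last exact: B2.
rewrite -RintegralB//; [|exact: B1|by apply: intgZ => //; exact: B2].
by rewrite -[X in _ == X]E; apply/eqP; apply: eq_Rintegral => t _; rewrite /G /= mulr1.
Qed.

Lemma L2GT_ae_t u j : L2GT u -> \forall x \ae mu, @gdom R j x -> intg mu (@torus R) (fun t => u j (x, t)).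
Proof.
move=> Lu; apply: ae_gdom => n.
by have := ae_integrable_sec1 _ _ (L2GT_edge n j Lu); apply.
Qed.

Lemma ip_branch_fubini u phi j (h : R -> R) : L2GT u -> L2G phi -> continuous h ->
  [/\ intg mu (@torus R) (fun t => ip_branch u phi j t * h t),
     \int[mu]_(t in @torus R) (ip_branch u phi j t * h t) =
       \int[mu]_(x in @gdom R j) \int[mu]_(t in @torus R) (u j (x, t) * phi j x * h t) &
     intg mu (@gdom R j) (fun x => \int[mu]_(t in @torus R) (u j (x, t) * phi j x * h t))].
Proof.
move=> Lu Lp ch.
have pi_ := L2GT_pair j Lu Lp.
have mg := @measurable_gdom R j; have mT := measurable_torus (R:=R).
have mgT : measurable (@gdom R j `*` @torus R) by exact: measurable_gT.
have [M [_ HM]] : bounded_set (h @` (@torus R)).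
  apply: compact_bounded; apply: continuous_compact; last exact: segment_compact.
  exact: continuous_subspaceT.
have Fi : intg mu2 (@gdom R j `*` @torus R) (fun z => u j z * phi j z.1 * h z.2).
  apply: (intgM (M := M + 1)) => //.
    apply: measurable_funTS; apply: measurableT_comp => //; exact: continuous_measurable_fun.
  by move=> [x y] [/= Ix Jy]; apply: (HM (M + 1)); [lra|exists y].
have [G1 E1] := Rintegral_fubini1 mg mT Fi; have [G2 E2] := Rintegral_fubini2 mg mT Fi.
have mhT : measurable_fun (@torus R) h by apply: measurable_funTS; exact: continuous_measurable_fun.
have A : \forall t \ae mu, @torus R t -> \int[mu]_(x in @gdom R j) (u j (x, t) * phi j x * h t) = ip_branch u phi j t * h t.
  move: (ae_integrable_sec2 mg mT pi_); apply: ae_imp => t + Tt => /(_ Tt) H.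
  by rewrite RintegralZr.
have mp : measurable_fun (@torus R) (fun t => ip_branch u phi j t * h t).
  by apply: measurable_funM => //; exact: intg_meas (ip_branch_intg j Lu Lp).
split => //.
- by apply: (ae_eq_intg _ _ A G2).
- rewrite E1 -E2; apply/esym; apply: ae_eq_Rintegral => //; exact: intg_meas G2.
Qed.

(** On the edges of type j, the scalar function (u(t), phi) has the weak
    derivative (v(t), phi) of order i. *)
Lemma ip_branch_weak i u v phi j (psi : R -> R) : (i <= 2)%N -> L2GT u -> L2GT v -> weak_pderiv 0 i u v -> CmT i psi -> L2G phi ->
  \int[mu]_(t in @torus R) (ip_branch u phi j t * derive1n i psi t) = (-1) ^+ i * \int[mu]_(t in @torus R) (ip_branch v phi j t * psi t).
Proof.
move=> i2 Lu Lv W psiC Lp.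
have [cp _ _] := psiC; have ci : continuous (derive1n i psi) by exact: cp.
have c0 : continuous psi by exact: (cp 0%N).
have [_ -> iu] := ip_branch_fubini j Lu Lp ci; have [_ -> iv] := ip_branch_fubini j Lv Lp c0.
have mg := @measurable_gdom R j; have mT := measurable_torus (R:=R).
rewrite -RintegralZl//; apply: ae_eq_Rintegral => //.
- exact: intg_meas iu.
- by apply: measurable_funM => //; exact: intg_meas iv.
have H : \forall x \ae mu, @gdom R j x ->
    \int[mu]_(t in @torus R) (u j (x, t) * derive1n i psi t) = (-1) ^+ i * \int[mu]_(t in @torus R) (v j (x, t) * psi t).
  by apply: ae_gdom => n; exact: weak_t_ae.
apply: ae_imp2 H (ae_and (L2GT_ae_t j Lu) (L2GT_ae_t j Lv)) => x + [B1 B2] gx.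
move=> /(_ gx) E; have {}B1 := B1 gx; have {}B2 := B2 gx.
transitivity (phi j x * \int[mu]_(t in @torus R) (u j (x, t) * derive1n i psi t)).
  rewrite -RintegralZl//; last exact: intg_mul_cont B1 ci.
  by apply: eq_Rintegral => t _; ring.
rewrite E mulrCA; congr (_ * _).
rewrite -RintegralZl//; last exact: intg_mul_cont B2 c0.
by apply: eq_Rintegral => t _; ring.
Qed.

Lemma ip_sum_EFin u phi (h : R -> R) : L2GT u -> L2G phi -> continuous h ->
  (\int[mu]_(t in @torus R) (ipL2 (slice u t) phi * (h t)%:E) =
   (\int[mu]_(t in @torus R) (ip_branch u phi mid t * h t) + \int[mu]_(t in @torus R) (ip_branch u phi up t * h t)
    + \int[mu]_(t in @torus R) (ip_branch u phi low t * h t))%:E)%E.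
Proof.
move=> Lu Lp ch; have mT := measurable_torus (R:=R).
have I j : intg mu (@torus R) (fun t => ip_branch u phi j t * h t) by have [] := ip_branch_fubini j Lu Lp ch.
rewrite -!RintegralD//; last by apply: intgD.
rewrite -integral_EFin//; last by apply: intgD => //; apply: intgD.
have mhT : measurable_fun (@torus R) h by apply: measurable_funTS; exact: continuous_measurable_fun.
apply: ae_eq_integral => //.
- apply: emeasurable_funM; first by apply: measurable_funTS; exact: ipL2_meas.
  exact/measurable_EFinP.
- apply/measurable_EFinP; by apply: measurable_funD; [apply: measurable_funD|]; exact: intg_meas (I _).
move: (ip_sum_ae Lu Lp); apply: ae_imp => t + Tt => /(_ Tt) ->.
by rewrite -EFinM /ip_sum !mulrDl.
Qed.

Lemma bochner_Hm_slice u : HGT 2 u -> bochner_Hm 2 (slice u).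
Proof.
move=> [Lu Hu]; split; first exact: bochner_L2_slice.
move=> i i2; have [v [Lv W]] := Hu 0%N i i2.
exists (slice v); first exact: bochner_L2_slice.
move=> psi phi psiC Lp; have [cp _ _] := psiC.
rewrite (ip_sum_EFin Lu Lp (cp i _))// (ip_sum_EFin Lv Lp (cp 0%N _))//.
by rewrite !(ip_branch_weak _ i2 Lu Lv W)// -EFinM !mulrDr.
Qed.

(** Almost every section of u is absolutely continuous on all edges at once, with
    derivative the section of g. *)
Lemma H1cG_slice u g : L2GT u -> L2GT g -> weak_tensor false u g ->
  \forall t \ae mu, @torus R t -> [/\ L2G (slice u t), L2G (slice g t) & forall n j, AC_edge n j (slice u t j) (slice g t j)].
Proof.
move=> Lu Lg W.
have H : \forall t \ae mu, forall n, @torus R t -> forall j, AC_edge n j (slice u t j) (slice g t j).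
  apply: ae_count => n.
  apply: ae_imp2 (weak_tensor_AC_x n mid Lu Lg W) (ae_and (weak_tensor_AC_x n up Lu Lg W) (weak_tensor_AC_x n low Lu Lg W)).
  by move=> t H1 [H2 H3] Tt; case; [exact: H1|exact: H2|exact: H3].
apply: ae_imp2 H (ae_and (L2GT_ae_L2G Lu) (L2GT_ae_L2G Lg)) => t H1 [H2 H3] Tt.
by split; [exact: H2|exact: H3|move=> n; exact: H1].
Qed.

Lemma bochner_L2_H1c u g : L2GT u -> L2GT g -> weak_tensor false u g -> condC u ->
  bochner_L2 (@H1cG R) (@ipH1 R) (slice u).
Proof.
move=> Lu Lg W cC.
have HS := H1cG_slice Lu Lg W.
have dwE : \forall t \ae mu, @torus R t -> forall phi, L2G phi -> (forall j, measurable_fun (@gdom R j) (phi j)) ->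
    [/\ L2G (slice u t), L2G (slice g t), ipL2 (dw (slice u t)) phi = ipL2 (slice g t) phi &
      ipL2 (dw (slice u t)) (dw (slice u t)) = ipL2 (slice g t) (slice g t)].
  move: HS; apply: ae_imp => t + Tt => /(_ Tt) [L1 L2 A] phi Lp mp.
  have E := dw_AC L1 L2 A.
  have [Ld _] : L2G (dw (slice u t)) /\ weak_deriv (slice u t) (dw (slice u t)).
    by apply: dwP; split => //; exists (slice g t); split => //; exact: AC_weak_deriv.
  split => //; apply: gint_ae_eq => j.
  - by apply: measurable_funM; [exact: Ld.1|exact: mp].
  - by apply: measurable_funM; [exact: L2.1|exact: mp].
  - by move: (E j); apply: ae_imp => x + gx => /(_ gx) ->.
  - by apply: measurable_funM; exact: Ld.1.
  - by apply: measurable_funM; exact: L2.1.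
  - by move: (E j); apply: ae_imp => x + gx => /(_ gx) ->.
split.
- apply: ae_imp2 HS cC => t HS cC Tt; have [L1 L2 A] := HS Tt.
  split; last exact: cC.
  by split => //; exists (slice g t); split => //; exact: AC_weak_deriv.
- move=> phi [Hp _]; have [Ldp _] := dwP Hp; have [Lp _] := Hp.
  exists (fun t => ipL2 (slice u t) phi + ipL2 (slice g t) (dw phi))%E.
    by apply: emeasurable_funD; exact: ipL2_meas.
  move: dwE; apply: ae_imp => t + Tt => /(_ Tt) /(_ _ Ldp Ldp.1) [_ _ E _].
  by rewrite /ipH1 E.
- apply: (ae_bound_lty (h := fun t => sqnorm u t + sqnorm g t)) => //.
  + by move=> t _; rewrite /ipH1 adde_ge0// ipL2_ge0.
  + by apply: intgD => //; exact: sqnorm_intg.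
  + apply: ae_imp2 dwE HS => t + HS Tt; have [L1 L2 _] := HS Tt.
    by move=> /(_ Tt) /(_ _ L1 L1.1) [_ _ _ E]; rewrite /ipH1 E sqnormE// sqnormE.
Qed.

End Bochner.

(** * Traces in time *)

Section TimeTrace.
Variable R : realType.
Local Notation mu := (@lebesgue_measure R).
Local Notation mu2 := (mu \x mu)%E.
Local Notation P4 := (4 * pi : R).
Implicit Types (n : int) (j : branch) (u w g : gfun2 R).

Lemma eq_intg d (T : measurableType d) (m : {measure set T -> \bar R}) (D : set T) (f h : T -> R) :
  (forall x, f x = h x) -> intg m D f -> intg m D h.
Proof. by move=> /funext ->. Qed.

Lemma ge0_subset_Rintegral (a b c d : R) (f : R -> R) : a <= c -> d <= b -> intg mu `[a, b] f -> (forall x, 0 <= f x) ->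
  \int[mu]_(t in `[c, d]) f t <= \int[mu]_(t in `[a, b]) f t.
Proof.
move=> ac db fi f0; have ci := intg_sub ac db fi.
rewrite -lee_fin -!integral_EFin//; apply: ge0_subset_integral => //.
- exact: measurable_int fi.
- by move=> x _; rewrite lee_fin.
- by move=> x /=; rewrite !in_itv/= => /andP[cx xd]; rewrite (le_trans ac)//= (le_trans xd).
Qed.

Lemma prim_one (y : R) : 0 <= y -> prim 0 (cst 1) y = y.
Proof.
move=> y0; have c1 : continuous (cst 1 : R -> R) by move=> z; exact: cvg_cst.
by have /= := C1_prim (fun x => is_derive_id x 1) c1 y0; rewrite add0r.
Qed.

(** Let f = C + prim 0 g with g of mean 0 over the period T.  Then f tends to C at
    both ends of the period, at the rate given by Cauchy-Schwarz, and C is the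
    average A, which depends measurably on parameters. *)
Lemma mean_zero_bound (T C : R) (f g : R -> R) : 0 < T -> intg mu `[0, T] f -> intg mu `[0, T] g ->
  intg mu `[0, T] (fun t => g t ^+ 2) -> \int[mu]_(t in `[0, T]) g t = 0 ->
  (\forall t \ae mu, `[0, T]%classic t -> f t = C + prim 0 g t) ->
  let A := T^-1 * \int[mu]_(t in `[0, T]) (f t - (T - t) * g t) in
  let N := \int[mu]_(t in `[0, T]) (g t ^+ 2) in
  \forall t \ae mu, `[0, T]%classic t -> (f t - A) ^+ 2 <= t * N /\ (f t - A) ^+ 2 <= (T - t) * N.
Proof.
move=> T0 fi gi g2i g0 fE A N.
have mI : measurable `[0, T] by exact: measurable_itv.
have c1 : continuous (cst 1 : R -> R) by move=> z; exact: cvg_cst.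
have cT : continuous (fun t : R => T - t) by move=> z; apply: cvgB; [exact: cvg_cst|exact: cvg_id].
have gTi : intg mu `[0, T] (fun t => (T - t) * g t).
  by apply: eq_intg (intg_mul_cont gi cT) => t; rewrite mulrC.
have ip : intg mu `[0, T] (fun x => cst 1 x * prim 0 g x) by apply: intg_prim => //; [exact: ltW|exact: intg_cont].
(* By exchanging the order of integration, the integral of prim 0 g over [0, T] is
that of (T - t) g t. *)
have AC : A = C.
  have E : \int[mu]_(t in `[0, T]) f t = C * T + \int[mu]_(t in `[0, T]) (cst 1 t * prim 0 g t).
    have -> : C * T = \int[mu]_(t in `[0, T]) cst C t.
      have muI : fine (mu `[0, T]) = T by rewrite lebesgue_measure_itv/= lte_fin T0 sube0.
      by rewrite Rintegral_cst// muI.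
    have iC : intg mu `[0, T] (cst C) by apply: intg_cont => z; exact: cvg_cst.
    rewrite -RintegralD//; apply: ae_eq_Rintegral => //.
    - exact: intg_meas fi.
    - by apply: measurable_funD => //; exact: intg_meas ip.
    - by move: fE; apply: ae_imp => t + It => /(_ It) ->; rewrite mul1r.
  rewrite /A RintegralB// E (prim_ibp (ltW T0) gi (intg_cont 0 T c1)).
  have -> : \int[mu]_(y in `[0, T]) (g y * (prim 0 (cst 1) T - prim 0 (cst 1) y)) =
     \int[mu]_(t in `[0, T]) ((T - t) * g t).
    apply: eq_Rintegral => y; rewrite inE/= in_itv/= => /andP[y0 _].
    by rewrite !prim_one// 1?mulrC// ltW.
  by rewrite addrK mulrA mulrAC mulVf ?mul1r ?gt_eqF.
move: fE; apply: ae_imp => t + It => /(_ It) ->.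
move: It; rewrite /= in_itv/= => /andP[t0 tT].
have -> : C + prim 0 g t - A = prim 0 g t by rewrite AC addrAC subrr add0r.
have sq0 (x : R) : 0 <= g x ^+ 2 by exact: sqr_ge0.
split.
  apply: le_trans (cauchy_schwarz_itv t0 (intg_sub (lexx 0) tT gi) (intg_sub (lexx 0) tT g2i)) _.
  by rewrite subr0 ler_wpM2l// ge0_subset_Rintegral.
(* g has mean 0, so the bound near the end T of the period is that near 0 *)
have E : prim 0 g t = - \int[mu]_(s in `[t, T]) g s.
  have := @Rintegral_itvB R g (BLeft 0) (BRight T) t gi; rewrite !bnd_simp => /(_ t0 tT).
  rewrite g0 sub0r Rintegral_itv_obnd_cbnd; last first.
    by apply: intgS gi => // x /=; rewrite !in_itv/= => /andP[tx ->]; rewrite (le_trans t0)// ltW.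
  by move=> <-; rewrite opprK.
rewrite E sqrrN.
apply: le_trans (cauchy_schwarz_itv tT (intg_sub t0 (lexx T) gi) (intg_sub t0 (lexx T) g2i)) _.
by rewrite ler_wpM2l ?subr_ge0// ge0_subset_Rintegral.
Qed.

Section TraceAtZero.
Variables (w g : gfun2 R).
Hypotheses (Lw : L2GT w) (Lg : L2GT g) (W : weak_tensor true w g).

(** The trace of w at the time 0, if g is the time derivative of w. *)
Definition trace0 : gfun R := fun j x => P4^-1 * \int[mu]_(t in @torus R) (w j (x, t) - (P4 - t) * g j (x, t)).
(** The integral of g (x, .)^2 over one period. *)
Definition tderiv_sq : gfun R := fun j x => \int[mu]_(t in @torus R) (g j (x, t) ^+ 2).

Lemma trace0_meas j : measurable_fun (@gdom R j) (trace0 j).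
Proof.
apply: gdom_meas_fun => n; apply: measurable_funM => //.
have cT : continuous (fun t : R => P4 - t) by move=> z; apply: cvgB; [exact: cvg_cst|exact: cvg_id].
have i1 := L2GT_edge n j Lw; have i2 := intg_mul_cont2 (L2GT_edge n j Lg) cT.
have mE : measurable (@edge R n j `*` @torus R) by exact: measurable_eT.
have i3 : intg mu2 (@edge R n j `*` @torus R) (fun z => w j z - (P4 - z.2) * g j z).
  by apply: intgB => //; apply: eq_intg i2 => t; rewrite mulrC.
have [H _] := Rintegral_fubini1 (@measurable_edge R n j) (measurable_torus (R:=R)) i3.
exact: intg_meas H.
Qed.

Lemma tderiv_sq_intg j : intg mu (@gdom R j) (tderiv_sq j).
Proof. by have [H _] := Rintegral_fubini1 (@measurable_gdom R j) (measurable_torus (R:=R)) (L2GT_sq j Lg). Qed.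

Lemma tderiv_sq_ge0 j x : 0 <= tderiv_sq j x.
Proof. by apply: Rintegral_ge0 => t _; exact: sqr_ge0. Qed.

Lemma trace0_bound_x j : \forall x \ae mu, @gdom R j x -> \forall t \ae mu, @torus R t ->
  (w j (x, t) - trace0 j x) ^+ 2 <= t * tderiv_sq j x /\ (w j (x, t) - trace0 j x) ^+ 2 <= (P4 - t) * tderiv_sq j x.
Proof.
apply: ae_gdom => n.
have S2 := ae_integrable_sec1 (@measurable_gdom R j) (measurable_torus (R:=R)) (L2GT_sq j Lg).
apply: ae_imp2 (weak_tensor_AC_t n j Lw Lg W) (ae_and (weak_tensor_mean_t n j Lw Lg W)
  (ae_and S2 (ae_and (L2GT_ae_t j Lw) (L2GT_ae_t j Lg)))).
move=> x + [+ [+ [+ +]]] nx => /(_ nx) [C HC] /(_ nx) g0 /(_ (edge_sub nx)) g2 /(_ (edge_sub nx)) wi /(_ (edge_sub nx)) gi.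
exact: (mean_zero_bound (P4_gt0 R) wi gi g2 g0 HC).
Qed.

Lemma trace0_bound_t j : \forall t \ae mu, @torus R t -> \forall x \ae mu, @gdom R j x ->
  (w j (x, t) - trace0 j x) ^+ 2 <= t * tderiv_sq j x /\ (w j (x, t) - trace0 j x) ^+ 2 <= (P4 - t) * tderiv_sq j x.
Proof.
pose D := @gdom R j `*` @torus R.
have mD : measurable D by exact: measurable_gT.
have m1 : measurable_fun D (fun z => (w j z - trace0 j z.1) ^+ 2).
  apply: measurable_funX; apply: measurable_funB; first exact: L2GT_meas Lw.
  apply: (measurable_comp (F := @gdom R j)) => //; last exact: measurable_funTS measurable_fst.
    by move=> _ [[x t] [/= gx _] <-].
  exact: trace0_meas.
have mN : measurable_fun D (fun z : R * R => tderiv_sq j z.1).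
  apply: (measurable_comp (F := @gdom R j)) => //; last exact: measurable_funTS measurable_fst.
    by move=> _ [[x t] [/= gx _] <-].
  exact: intg_meas (tderiv_sq_intg j).
have m2 : measurable_fun D (fun z : R * R => z.2 * tderiv_sq j z.1).
  by apply: measurable_funM => //; exact: measurable_funTS measurable_snd.
have m3 : measurable_fun D (fun z : R * R => (P4 - z.2) * tderiv_sq j z.1).
  by apply: measurable_funM => //; apply: measurable_funB => //; exact: measurable_funTS measurable_snd.
(* The inequalities as one measurable set, for the exchange of the two almost
everywhere quantifiers. *)
pose P := ~` D `|` ((D `&` [set z | (w j z - trace0 j z.1) ^+ 2 <= z.2 * tderiv_sq j z.1]) `&`
   (D `&` [set z | (w j z - trace0 j z.1) ^+ 2 <= (P4 - z.2) * tderiv_sq j z.1])).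
have mP : measurable P.
  apply: measurableU; first exact: measurableC.
  by apply: measurableI; apply: measurable_fun_le.
have := ae_swap (@measurable_gdom R j) (measurable_torus (R:=R)) mP.
have H : \forall x \ae mu, @gdom R j x -> \forall t \ae mu, @torus R t -> P (x, t).
  move: (trace0_bound_x j); apply: ae_imp => x + gx => /(_ gx); apply: ae_imp => t + Tt => /(_ Tt) [H1 H2].
  by right; split; split.
move=> /(_ H); apply: ae_imp => t + Tt => /(_ Tt); apply: ae_imp => x + gx => /(_ gx) [].
  by move=> /(_ (conj gx Tt)).
by move=> [[_ H1] [_ H2]].
Qed.

(** The square of the norm of g in L^2(G x T). *)
Definition tderiv_sqnorm := \int[mu]_(x in @gdom R mid) tderiv_sq mid x + \int[mu]_(x in @gdom R up) tderiv_sq up x + \int[mu]_(x in @gdom R low) tderiv_sq low x.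

Lemma tderiv_sqnorm_ge0 : 0 <= tderiv_sqnorm.
Proof. by rewrite !addr_ge0// Rintegral_ge0// => x _; exact: tderiv_sq_ge0. Qed.

Lemma trace0_gint : \forall t \ae mu, @torus R t ->
  (gint (fun j x => (slice w t j x - trace0 j x) ^+ 2)%R <= (t * tderiv_sqnorm)%:E)%E /\
  (gint (fun j x => (slice w t j x - trace0 j x) ^+ 2)%R <= ((P4 - t) * tderiv_sqnorm)%:E)%E.
Proof.
have key (c t : R) j : 0 <= c -> (\forall x \ae mu, @gdom R j x -> (w j (x, t) - trace0 j x) ^+ 2 <= c * tderiv_sq j x) ->
   (\int[mu]_(x in @gdom R j) ((slice w t j x - trace0 j x) ^+ 2)%:E <= (c * \int[mu]_(x in @gdom R j) tderiv_sq j x)%:E)%E.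
  move=> c0 H; rewrite -RintegralZl//; last exact: tderiv_sq_intg.
  have iN : intg mu (@gdom R j) (fun x => c * tderiv_sq j x) by apply: intgZ => //; exact: tderiv_sq_intg.
  rewrite -integral_EFin//; apply: ae_ge0_le_integral => //.
  - by move=> x _; rewrite lee_fin sqr_ge0.
  - apply/measurable_EFinP; apply: measurable_funX; apply: measurable_funB; [exact: L2GT_sec Lw j|exact: trace0_meas].
  - by move=> x _; rewrite lee_fin mulr_ge0// tderiv_sq_ge0.
  - exact: measurable_int iN.
have K (c t : R) : 0 <= c -> (forall j, \forall x \ae mu, @gdom R j x -> (w j (x, t) - trace0 j x) ^+ 2 <= c * tderiv_sq j x) ->
  (gint (fun j x => (slice w t j x - trace0 j x) ^+ 2)%R <= (c * tderiv_sqnorm)%:E)%E.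
  move=> c0 H; rewrite /gint /tderiv_sqnorm !mulrDr !EFinD.
  by apply: leeD; [apply: leeD|]; exact: key.
apply: ae_imp2 (trace0_bound_t mid) (ae_and (trace0_bound_t up) (trace0_bound_t low)).
move=> t H1 [H2 H3] Tt; have {}H1 := H1 Tt; have {}H2 := H2 Tt; have {}H3 := H3 Tt.
move: (Tt); rewrite /torus/= in_itv/= => /andP[t0 tP].
split; apply: K; rewrite ?subr_ge0//; case; [move: H1|move: H2|move: H3|move: H1|move: H2|move: H3];
  by apply: ae_imp => x + gx => /(_ gx) [].
Qed.

(** The trace is square integrable, by comparison with w at some time t for which
    the bound holds. *)
Lemma trace0_L2 : L2G trace0.
Proof.
apply: intg_L2G; first exact: trace0_meas.
have p0 := P4_gt0 R.
have c0 : 0 <= (0 : R) <= P4 by rewrite lexx ltW.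
move=> j.
have H : \forall t \ae mu, @torus R t -> L2G (slice w t) /\ \forall x \ae mu, @gdom R j x -> (w j (x, t) - trace0 j x) ^+ 2 <= t * tderiv_sq j x.
  apply: ae_imp2 (L2GT_ae_L2G Lw) (trace0_bound_t j) => t H1 H2 Tt; split; first exact: H1.
  by move: (H2 Tt); apply: ae_imp => x + gx => /(_ gx) [].
have [t [/andP[t0 _] _ [Lt Ht]]] := ae_witness p0 c0 (ltr01 : 0 < (1 : R)) H.
have ih : intg mu (@gdom R j) (fun x => 2 * (slice w t j x) ^+ 2 + 2 * t * tderiv_sq j x).
  apply: intgD => //; apply: intgZ => //; [exact: L2G_intg|exact: tderiv_sq_intg].
apply/integrableP; split; first by apply/measurable_EFinP; apply: measurable_funX; exact: trace0_meas.
apply: (ae_bound_lty _ _ ih) => //.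
move: Ht; apply: ae_imp => x + gx => /(_ gx) Hx.
rewrite /= lee_fin ger0_norm ?sqr_ge0// /slice.
by have := sqr_ge0 (2 * w j (x, t) - trace0 j x); nra.
Qed.

Lemma trace0_trace : time_trace (slice w) 0 trace0.
Proof.
split; first exact: trace0_L2.
have p0 := P4_gt0 R; have M0 := tderiv_sqnorm_ge0.
move=> U [e /= e0 eU].
pose F t := gint (fun j x => (slice w t j x - trace0 j x) ^+ 2)%R.
have F0 t : (0 <= F t)%E.
  have H j : (0 <= \int[mu]_(x in @gdom R j) ((slice w t j x - trace0 j x) ^+ 2)%:E)%E.
    by apply: integral_ge0 => x _; rewrite lee_fin sqr_ge0.
  by apply: adde_ge0; [apply: adde_ge0|]; exact: H.
(* Times t < 0 are reduced by periodicity to the end of the period. *)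
have Fp t : F (t + P4) = F t.
  have [_ per _] := Lw.
  by rewrite /F; congr gint; apply/funext => j; apply/funext => x; rewrite /slice per.
have dM : 0 < e / (tderiv_sqnorm + 1) by rewrite divr_gt0// ltr_wpDl.
exists (Num.min P4 (e / (tderiv_sqnorm + 1))); first by rewrite lt_min p0.
apply: ae_imp2 trace0_gint (ae_shift P4 trace0_gint) => t H1 H2 _.
rewrite subr0 lt_min => /andP[tP te].
have FU : (F t <= (`|t| * tderiv_sqnorm)%:E)%E.
  have [t0|t0] := leP 0 t.
    rewrite ger0_norm// in tP *; have [] := H1 _ => //.
    by rewrite /torus/= in_itv/= t0 ltW.
  rewrite ltr0_norm// in tP *; have [] := H2 _; last first.
    rewrite -/(F (t + P4)) Fp => _; have -> // : P4 - (t + P4) = - t by ring.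
  by rewrite /torus/= in_itv/=; apply/andP; split; lra.
have Ffin : F t \is a fin_num by rewrite ge0_fin_numE//; apply: le_lt_trans FU _; exact: ltry.
rewrite /= -/(F t) -(fineK Ffin); apply: eU.
rewrite /ball_/= sub0r normrN ger0_norm ?fine_ge0//.
apply: (@le_lt_trans _ _ (`|t| * tderiv_sqnorm)); first by rewrite -lee_fin fineK.
apply: (@le_lt_trans _ _ (`|t| * (tderiv_sqnorm + 1))); first by rewrite ler_wpM2l// lerDl.
by rewrite -ltr_pdivlMr// ltr_wpDl.
Qed.

End TraceAtZero.
End TimeTrace.

(** * The formula of Green on the graph *)

Section Green.
Variable R : realType.
Local Notation mu := (@lebesgue_measure R).
Implicit Types (n m : int) (j : branch).

Lemma edge_inj n m j (x : R) : @edge R n j x -> @edge R m j x -> n = m.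
Proof.
have p0 := pi_gt0 R.
have key (k l : int) : @edge R k j x -> @edge R l j x -> ~ (k < l).
  rewrite /edge /lend /rend /va /vb/= !in_itv/= => /andP[_ H1] /andP[H2 _] kl.
  have : (k + 1)%:~R <= l%:~R :> R by rewrite ler_int lezD1.
  rewrite intrD => H3.
  have H4 : 2 * pi * (k%:~R + 1) <= 2 * pi * l%:~R :> R by rewrite ler_wpM2l// mulr_ge0// ltW.
  by case: j H1 H2; rewrite ?intrD; lra.
move=> Hn Hm; have [nm|mn|//] := ltgtP n m; [case: (key _ _ Hn Hm nm)|case: (key _ _ Hm Hn mn)].
Qed.

(** The union of the 2 n edges (m, j) with - n <= m < n. *)
Fixpoint first_edges j (n : nat) : set R :=
  if n is m.+1 then first_edges j m `|` (@edge R m%:Z j `|` @edge R (- (m%:Z) - 1) j) else set0.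

Lemma first_edges_meas j (n : nat) : measurable (first_edges j n).
Proof. by elim: n => //= n IH; apply: measurableU => //; exact: measurableU. Qed.
Hint Extern 0 (_.-measurable (first_edges _ _)) => solve [exact: first_edges_meas] : core.

Lemma first_edgesP j (n : nat) (x : R) : first_edges j n x <-> exists m, - n%:Z <= m < n%:Z /\ @edge R m j x.
Proof.
elim: n => [|n IH] /=; first by split => // -[m [/andP[a b] _]]; exfalso; lia.
split.
  move=> [/IH [m [mn mx]]|[nx|nx]].
  - by exists m; split => //; lia.
  - by exists n%:Z; split => //; lia.
  - by exists (- n%:Z - 1); split => //; lia.
move=> [m [mn mx]].
have [E|[E|E]] : m = n%:Z \/ m = - n%:Z - 1 \/ - n%:Z <= m < n%:Z by lia.
- by right; left; rewrite -E.
- by right; right; rewrite -E.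
- by left; apply/IH; exists m.
Qed.

Lemma first_edges_sub j (n : nat) : first_edges j n `<=` @gdom R j.
Proof. by move=> x /first_edgesP [m [_ mx]]; exists m. Qed.

Lemma first_edges_int j (n : nat) (h : R -> R) : intg mu (@gdom R j) h ->
  \int[mu]_(x in first_edges j n.+1) h x = \int[mu]_(x in first_edges j n) h x +
   (\int[mu]_(x in @edge R n%:Z j) h x + \int[mu]_(x in @edge R (- n%:Z - 1) j) h x).
Proof.
move=> hi.
have i1 : intg mu (first_edges j n.+1) h by apply: intgS hi => //; exact: first_edges_sub.
have mE : measurable (@edge R n%:Z j `|` @edge R (- (n%:Z) - 1) j) by exact: measurableU.
have i2 : intg mu (@edge R n%:Z j `|` @edge R (- (n%:Z) - 1) j) h.
  by apply: intgS i1 => // x; right.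
transitivity (\int[mu]_(x in first_edges j n `|` (@edge R n%:Z j `|` @edge R (- n%:Z - 1) j)) h x) => //.
rewrite Rintegral_setU//.
  rewrite Rintegral_setU//; apply/disj_setPS => x [/= nx mx].
  by have := edge_inj nx mx; lia.
apply/disj_setPS => x [/= /first_edgesP [m [mn mx]] [nx|nx]]; have := edge_inj nx mx; lia.
Qed.

Lemma first_edges_cvg j (h : R -> R) : intg mu (@gdom R j) h ->
  (fun n : nat => \int[mu]_(x in first_edges j n) h x) @ \oo --> \int[mu]_(x in @gdom R j) h x.
Proof.
move=> hi.
have H : (\int[mu]_(x in @gdom R j) ((h \_ (first_edges j n)) x)%:E @[n --> \oo] --> \int[mu]_(x in @gdom R j) (h x)%:E)%E.
  apply: (@dominated_cvg _ _ _ mu (@gdom R j) _ _ _ (fun x => `|(h x)%:E|%E)) => //.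
  - move=> n; apply/measurable_EFinP; apply/measurable_restrict => //.
    by apply: measurable_funS (intg_meas hi) => //; exact: subIsetl.
  - move=> x [m _ mx]; apply: cvg_near_cst; near=> n.
    rewrite patchE mem_set//; apply/first_edgesP; exists m; split => //.
    have : (`|m|%N < n)%N by near: n; exact: nbhs_infty_gt.
    lia.
  - have := integrable_norm hi; exact.
  - by move=> n x _; rewrite lee_fin patchE; case: ifP => //; rewrite normr0.
have E (n : nat) : (\int[mu]_(x in @gdom R j) ((h \_ (first_edges j n)) x)%:E = (\int[mu]_(x in first_edges j n) h x)%:E)%E.
  have i1 : intg mu (@gdom R j `&` first_edges j n) h.
    rewrite (setIidr (@first_edges_sub j n)); apply: intgS hi => //; exact: first_edges_sub.
  have i2 : intg mu (@gdom R j) (h \_ (first_edges j n)) by rewrite -restrict_EFin; apply/integrable_restrict.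
  rewrite (integral_EFin _ i2)// -Rintegral_mkcondr; congr EFin; congr Rintegral.
  exact: setIidr (@first_edges_sub j n).
move: H; under eq_fun do rewrite E; rewrite integral_EFin//.
by move=> /fine_cvgP [_].
Unshelve. all: by end_near.
Qed.

(** The integral of the derivative of f p over [a, b], and a bound for the value of
    f p at a by the integrals of |f p| and |(f p)'|: at each point x of the
    interval, |f p| (a) <= |f p| (x) + \int |(f p)'|. *)
Lemma AC_green (a b : R) (f f' p p' : R -> R) Cf Cp : a < b -> intg mu `[a, b] f -> intg mu `[a, b] p ->
  intg mu `[a, b] f' -> intg mu `[a, b] p' ->
  measurable_fun `[a, b] f -> measurable_fun `[a, b] p ->
  intg mu `[a, b] (fun x => f x * p x) -> intg mu `[a, b] (fun x => f' x * p x + f x * p' x) ->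
  (\forall x \ae mu, `[a, b]%classic x -> f x = Cf + prim a f' x) ->
  (\forall x \ae mu, `[a, b]%classic x -> p x = Cp + prim a p' x) ->
  \int[mu]_(x in `[a, b]) (f' x * p x + f x * p' x) = (Cf + prim a f' b) * (Cp + prim a p' b) - Cf * Cp /\
  (b - a) * `|Cf * Cp| <= \int[mu]_(x in `[a, b]) `|f x * p x| + (b - a) * \int[mu]_(x in `[a, b]) `|f' x * p x + f x * p' x|.
Proof.
move=> ab fi pi_ f'i p'i mf mp fpi hi fE pE.
have mI : measurable `[a, b] by exact: measurable_itv.
pose F x := Cf + prim a f' x; pose P x := Cp + prim a p' x.
have mF : measurable_fun `[a, b] F by apply: measurable_funD => //; exact: prim_meas (ltW ab) f'i.
have mP : measurable_fun `[a, b] P by apply: measurable_funD => //; exact: prim_meas (ltW ab) p'i.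
have mf' := intg_meas f'i; have mp' := intg_meas p'i.
have mh := intg_meas hi.
have E : \forall x \ae mu, `[a, b]%classic x -> f' x * p x + f x * p' x = F x * p' x + f' x * P x.
  apply: ae_imp2 fE pE => x + + Ix => /(_ Ix) -> /(_ Ix) ->; rewrite /F /P; ring.
have mH : measurable_fun `[a, b] (fun x => F x * p' x + f' x * P x).
  by apply: measurable_funD; apply: measurable_funM.
have key x : a <= x <= b -> \int[mu]_(y in `[a, x]) (f' y * p y + f y * p' y) = F x * P x - Cf * Cp.
  move=> /andP[ax xb].
  rewrite -(AC_ibp Cf Cp ax (intg_sub (lexx a) xb f'i) (intg_sub (lexx a) xb p'i)).
  apply: (prim_ae xb hi mH E).
split; first by rewrite key// lexx ltW.
set K := \int[mu]_(x in `[a, b]) `|f' x * p x + f x * p' x|.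
(* the bound at one point x, to be integrated over [a, b] *)
have bd x : a <= x <= b -> `|Cf * Cp| <= `|F x * P x| + K.
  move=> xab; have /andP[ax xb] := xab.
  have -> : Cf * Cp = F x * P x - (F x * P x - Cf * Cp) by ring.
  apply: (le_trans (ler_normB _ _)); rewrite lerD2l -key//.
  exact: prim_bound xb hi.
have FPi : intg mu `[a, b] (fun x => F x * P x).
  apply: (ae_eq_intg _ _ _ fpi);[by []|exact: measurable_funM|].
  by apply: ae_imp2 fE pE => x + + Ix => /(_ Ix) -> /(_ Ix) ->.
have ci (c : R) : intg mu `[a, b] (cst c) by apply: intg_cont => z; exact: cvg_cst.
have muI : fine (mu `[a, b]) = b - a by rewrite lebesgue_measure_itv/= lte_fin ab.
have -> : (b - a) * `|Cf * Cp| = \int[mu]_(x in `[a, b]) cst `|Cf * Cp| x.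
  by rewrite Rintegral_cst// muI mulrC.
have -> : \int[mu]_(x in `[a, b]) `|f x * p x| = \int[mu]_(x in `[a, b]) `|F x * P x|.
  apply: ae_eq_Rintegral => //.
  - by apply: measurableT_comp => //; exact: measurable_funM.
  - by apply: measurableT_comp => //; exact: measurable_funM.
  - by apply: ae_imp2 fE pE => x + + Ix => /(_ Ix) -> /(_ Ix) ->.
have -> : (b - a) * K = \int[mu]_(x in `[a, b]) cst K x by rewrite Rintegral_cst// muI mulrC.
have iN := integrable_norm FPi.
rewrite -RintegralD//; apply: le_Rintegral => //.
  exact: intgD.
Qed.

Lemma vertex_value_unique (f : gfun R) n j (c l l' : R) : lend R n j <= c <= rend R n j ->
  vertex_value f n j c l -> vertex_value f n j c l' -> l = l'.
Proof. by move=> cI; apply: vertex_unique (lend_lt_rend R n j) cI. Qed.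

Lemma lend_I n j : lend R n j <= lend R n j <= rend R n j.
Proof. by rewrite lexx ltW// lend_lt_rend. Qed.

Lemma rend_I n j : lend R n j <= rend R n j <= rend R n j.
Proof. by rewrite lexx ltW// lend_lt_rend. Qed.

Lemma lend_mid n : lend R n mid = vb R (n - 1).
Proof. by rewrite /lend /vb subrK. Qed.

Section GraphGreen.
Variables (f f' p p' : gfun R).
Hypotheses (Lf : L2G f) (Lf' : L2G f') (Lp : L2G p) (Lp' : L2G p').
Hypotheses (Af : forall n j, AC_edge n j (f j) (f' j)) (Ap : forall n j, AC_edge n j (p j) (p' j)).
Hypotheses (Kf : kirchhoff f) (Cp : continuous_at_vertices p).

Let h j (x : R) : R := f' j x * p j x + f j x * p' j x.
Let k (x : R) : R := `|f mid x * p mid x| + pi * `|h mid x|.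

Let hi j : intg mu (@gdom R j) (h j).
Proof. by apply: intgD => //; exact: L2G_mul. Qed.

Let ki : intg mu (@gdom R mid) k.
Proof.
apply: intgD => //; first by apply: integrable_norm; exact: L2G_mul.
by apply: intgZ => //; apply: integrable_norm; exact: hi.
Qed.

Lemma edge_green n j : exists fl fr pl pr,
  [/\ vertex_value f n j (lend R n j) fl, vertex_value f n j (rend R n j) fr,
      vertex_value p n j (lend R n j) pl & vertex_value p n j (rend R n j) pr] /\
  \int[mu]_(x in @edge R n j) h j x = fr * pr - fl * pl /\
  (rend R n j - lend R n j) * `|fl * pl| <= \int[mu]_(x in @edge R n j) `|f j x * p j x| +
     (rend R n j - lend R n j) * \int[mu]_(x in @edge R n j) `|h j x|.
Proof.
have [Cf HCf] := Af n j; have [Cp' HCp] := Ap n j.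
have lr := lend_lt_rend R n j.
exists Cf, (Cf + prim (lend R n j) (f' j) (rend R n j)), Cp', (Cp' + prim (lend R n j) (p' j) (rend R n j)).
have f'i := L2G_edge n j Lf'; have p'i := L2G_edge n j Lp'.
split.
  split.
  - by have := AC_vertex lr (lend_I n j) f'i HCf; rewrite prim_aa addr0.
  - exact: AC_vertex lr (rend_I n j) f'i HCf.
  - by have := AC_vertex lr (lend_I n j) p'i HCp; rewrite prim_aa addr0.
  - exact: AC_vertex lr (rend_I n j) p'i HCp.
have sub := @edge_sub R n j.
apply: (AC_green lr (L2G_edge n j Lf) (L2G_edge n j Lp) f'i p'i _ _ _ _ HCf HCp).
- exact: intg_meas (L2G_edge n j Lf).
- exact: intg_meas (L2G_edge n j Lp).
- by apply: intgS (L2G_mul Lf Lp j).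
- by apply: intgS (hi j).
Qed.

(** A choice of the values b n of f p at the vertices 2 pi (n + 1), taken from the
    edges (n + 1, mid). *)
Lemma vertex_products : exists b : int -> R, forall n, exists fl pl,
  [/\ vertex_value f (n + 1) mid (vb R n) fl, vertex_value p (n + 1) mid (vb R n) pl & b n = fl * pl].
Proof.
have H n : exists v : R, exists fl pl,
  [/\ vertex_value f (n + 1) mid (vb R n) fl, vertex_value p (n + 1) mid (vb R n) pl & v = fl * pl].
  have [fl [_ [pl [_ [[H1 _ H2 _] _]]]]] := edge_green (n + 1) mid.
  by exists (fl * pl), fl, pl; split.
by have [b bP] := choice H; exists b.
Qed.

(** The Kirchhoff conditions for f and the continuity of p cancel all boundary
    terms of the integral of (f p)' over the graph. *)
Lemma graph_green : \int[mu]_(x in @gdom R mid) h mid x + \int[mu]_(x in @gdom R up) h up x + \int[mu]_(x in @gdom R low) h low x = 0.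
Proof.
have [b bP] := vertex_products.
(* The three edges with index n contribute the difference of the values of f p at
the vertices 2 pi (n + 1) and 2 pi n. *)
have EE n : \int[mu]_(x in @edge R n mid) h mid x + \int[mu]_(x in @edge R n up) h up x + \int[mu]_(x in @edge R n low) h low x = b n - b (n - 1).
  have [f0l [f0r [p0l [p0r [[a1 a2 a3 a4] [-> _]]]]]] := edge_green n mid.
  have [ful [fur [pul [pur [[b1 b2 b3 b4] [-> _]]]]]] := edge_green n up.
  have [fll [flr [pll [plr [[c1 c2 c3 c4] [-> _]]]]]] := edge_green n low.
  have [[x1 [x2 [x3 [X1 X2 X3 X]]]] [y1 [y2 [y3 [Y1 Y2 Y3 Y]]]]] := Kf n.
  have [[q [Q1 Q2 Q3]] [r [R1 R2 R3]]] := Cp n.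
  have [fl [pl [B1 B2 B]]] := bP n; have [fl' [pl' [D1 D2 D]]] := bP (n - 1).
  rewrite subrK -lend_mid in D1 D2.
  rewrite B D.
  have := vertex_value_unique (lend_I n mid) a1 D1 => ->.
  have := vertex_value_unique (lend_I n mid) a3 D2 => ->.
  have := vertex_value_unique (rend_I n mid) a2 X1 => ->.
  have := vertex_value_unique (rend_I n mid) a4 Q1 => ->.
  have := vertex_value_unique (lend_I n up) b1 X2 => ->.
  have := vertex_value_unique (lend_I n up) b3 Q2 => ->.
  have := vertex_value_unique (rend_I n up) b2 Y2 => ->.
  have := vertex_value_unique (rend_I n up) b4 R2 => ->.
  have := vertex_value_unique (lend_I n low) c1 X3 => ->.
  have := vertex_value_unique (lend_I n low) c3 Q3 => ->.
  have := vertex_value_unique (rend_I n low) c2 Y3 => ->.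
  have := vertex_value_unique (rend_I n low) c4 R3 => ->.
  have := vertex_value_unique (lend_I (n + 1) mid) B1 Y1 => ->.
  have := vertex_value_unique (lend_I (n + 1) mid) B2 R1 => ->.
  rewrite X Y; ring.
have bd n : pi * `|b n| <= \int[mu]_(x in @edge R (n + 1) mid) k x.
  have [fl [pl [B1 B2 ->]]] := bP n.
  have [f0l [f0r [p0l [p0r [[a1 a2 a3 a4] [_ H]]]]]] := edge_green (n + 1) mid.
  have E : rend R (n + 1) mid - lend R (n + 1) mid = pi by rewrite /rend /lend /va addrAC subrr add0r.
  rewrite E in H.
  rewrite (vertex_value_unique (lend_I (n + 1) mid) B1 a1) (vertex_value_unique (lend_I (n + 1) mid) B2 a3).
  apply: (le_trans H); rewrite /k RintegralD//.
  - rewrite RintegralZl//; apply: integrable_norm; apply: intgS (hi mid) => //; exact: edge_sub.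
  - apply: integrable_norm; apply: intgS (L2G_mul Lf Lp mid) => //; exact: edge_sub.
  - apply: intgZ => //; apply: integrable_norm; apply: intgS (hi mid) => //; exact: edge_sub.
pose S (n : nat) := \int[mu]_(x in first_edges mid n) h mid x + \int[mu]_(x in first_edges up n) h up x + \int[mu]_(x in first_edges low n) h low x.
have SE (n : nat) : S n = b (n%:Z - 1) - b (- n%:Z - 1).
  elim: n => [|n IH]; first by rewrite /S !Rintegral_set0 !addr0 oppr0 subrr.
  rewrite /S !first_edges_int//.
  have := EE n%:Z; have := EE (- n%:Z - 1); move: IH; rewrite /S => IH E2 E1.
  have -> : n.+1%:Z - 1 = n%:Z by lia.
  have -> : - n.+1%:Z - 1 = - n%:Z - 1 - 1 by lia.
  move: IH E1 E2; lra.
have Scv : S @ \oo --> \int[mu]_(x in @gdom R mid) h mid x + \int[mu]_(x in @gdom R up) h up x + \int[mu]_(x in @gdom R low) h low x.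
  by apply: cvgD; [apply: cvgD|]; exact: first_edges_cvg.
have kcv := first_edges_cvg ki.
pose c (n : nat) := \int[mu]_(x in first_edges mid n) k x.
have k0 n : 0 <= \int[mu]_(x in @edge R n mid) k x.
  by apply: Rintegral_ge0 => x _; rewrite /k addr_ge0// mulr_ge0// pi_ge0.
have p0 := pi_gt0 R.
(* The partial sums are bounded by tails of the convergent integral of k. *)
have Sb (n : nat) : pi * `|S n.+1| <= c n.+2 - c n.
  rewrite SE.
  have -> : n.+1%:Z - 1 = n%:Z by lia.
  have -> : - n.+1%:Z - 1 = - n%:Z - 2 by lia.
  have H1 := bd n%:Z; have H2 := bd (- n%:Z - 2).
  have E1 : - n%:Z - 2 + 1 = - n%:Z - 1 by lia.
  have E2 : n%:Z + 1 = n.+1%:Z by lia.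
  rewrite E1 in H2; rewrite E2 in H1.
  rewrite /c !first_edges_int//.
  have H3 := k0 n%:Z; have H4 := k0 (- n.+1%:Z - 1).
  have E3 : - n.+1%:Z - 1 = - n%:Z - 2 by lia.
  apply: (@le_trans _ _ (pi * `|b n%:Z| + pi * `|b (- n%:Z - 2)|)).
    by rewrite -mulrDr ler_wpM2l ?ler_normB// ltW.
  have aux (A I1 I2 I3 I4 x y : R) : x <= I3 -> y <= I2 -> 0 <= I1 -> 0 <= I4 ->
    x + y <= A + (I1 + I2) + (I3 + I4) - A by lra.
  exact: aux.
have S0 : S @ \oo --> (0 : R).
  rewrite -cvg_shiftS.
  apply/cvgr0Pnorm_le => e e0.
  have c0 : (fun n : nat => c n.+2 - c n) @ \oo --> (0 : R).
    rewrite -(subrr (\int[mu]_(x in @gdom R mid) k x)); apply: cvgB; last exact: kcv.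
    by have := kcv; rewrite -(cvg_shiftn 2)/=; under eq_fun do rewrite addn2.
  have pe : 0 < pi * e by rewrite mulr_gt0.
  have := c0 => /cvgr0Pnorm_le /(_ _ pe); apply: filterS => n Hn.
  by rewrite -(ler_pM2l p0); apply: (le_trans (Sb n)); apply: le_trans Hn; exact: ler_norm.
exact: (cvg_unique _ Scv S0).
Qed.

End GraphGreen.

End Green.

(** * From the pointwise equation to the evolution identity *)

Section Evolution.
Variable R : realType.
Local Notation mu := (@lebesgue_measure R).
Local Notation mu2 := (mu \x mu)%E.
Local Notation P4 := (4 * pi : R).
Implicit Types (n : int) (j : branch) (u w g : gfun2 R).

(** The chosen derivatives have their defining property if they exist. *)
Lemma DwP m i k u : HGT m u -> (i + k <= m)%N -> L2GT (Dw i k u) /\ weak_pderiv i k u (Dw i k u).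
Proof.
move=> [_ H] ik; have [g gP] := H i k ik.
have := @xgetPex (gfun2 R) (fun _ _ => 0) [set g | L2GT g /\ weak_pderiv i k u g].
by apply; exists g.
Qed.

Lemma measurable_nonlin (s : bool) (p : R) (D : set R) (f : R -> R) : measurable_fun D f ->
  measurable_fun D (fun x => nonlin s p (f x)).
Proof.
move=> mf; apply: measurable_funM => //; apply: measurable_funM => //.
apply: (measurableT_comp (measurable_powR _)).
exact: measurableT_comp.
Qed.

(** The evolution identity at one time: u0, v, w, z stand for u, u_tt, u_x, u_xx at
    that time. *)
Lemma slice_identity (s : bool) (p alpha : R) (u0 v z w : gfun R) : L2G u0 -> L2G v -> L2G z -> L2G w ->
  (forall n j, AC_edge n j (w j) (z j)) -> kirchhoff w ->
  (forall j, \forall x \ae mu, @gdom R j x -> v j x - z j x + alpha * u0 j x = nonlin s p (u0 j x)) ->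
  forall phi, H1cG phi ->
    gint (fun j x => v j x * phi j x + w j x * dw phi j x + alpha * u0 j x * phi j x
      - nonlin s p (u0 j x) * phi j x) = 0%E.
Proof.
move=> Lu Lv Lz Lw Aw Kw E phi [Hp Cp]; have [Lp _] := Hp; have [Ld Wd] := dwP Hp.
have mf (f : gfun R) j : L2G f -> measurable_fun (@gdom R j) (f j) by move=> [].
(* the equation turns u_tt + alpha u - nonlin into u_xx *)
rewrite (@gint_ae_eq _ _ (fun j x => z j x * phi j x + w j x * dw phi j x)).
- rewrite gint_intg; last by move=> j; apply: intgD => //; exact: L2G_mul.
  rewrite graph_green//.
  by move=> n j; exact: weak_deriv_AC.
- move=> j; apply: measurable_funB; last first.
    by apply: measurable_funM; [apply: measurable_nonlin; exact: mf|exact: mf].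
  apply: measurable_funD; last by apply: measurable_funM; [apply: measurable_funM => //|]; exact: mf.
  by apply: measurable_funD; apply: measurable_funM; exact: mf.
- by move=> j; apply: measurable_funD; apply: measurable_funM; exact: mf.
- by move=> j; move: (E j); apply: ae_imp => x + gx => /(_ gx) <-; ring.
Qed.

Lemma pointwise_evolution_identity (s : bool) (p alpha : R) u : HGT 2 u -> pointwise_solution s p alpha u ->
  condK u -> evolution_identity s p alpha u.
Proof.
move=> Hu PS cK.
have Lu : L2GT u by case: Hu.
have [L10 W10] := DwP (i := 1) (k := 0) Hu isT.
have [L20 W20] := DwP (i := 2) (k := 0) Hu isT.
have [L02 W02] := DwP (i := 0) (k := 2) Hu isT.
have [_ per10 _] := L10; have [_ per02 _] := L02; have [_ peru _] := Lu.
(* The identity holds for almost every t in the period, hence for almost every t. *)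
have W : \forall t \ae mu, forall phi, H1cG phi ->
    gint (fun j x =>
      Dw 0 2 u j (x, t) * phi j x + Dw 1 0 u j (x, t) * dw phi j x
      + alpha * u j (x, t) * phi j x - nonlin s p (u j (x, t)) * phi j x) = 0%E.
  apply: (ae_periodic (P4_gt0 R)).
    move=> t; split=> H phi Hphi; have := H phi Hphi.
      by under [X in _ -> gint X = _]eq_fun do under eq_fun do rewrite per02 per10 peru.
    by under [X in gint X = _ -> _]eq_fun do under eq_fun do rewrite per02 per10 peru.
  have Q1 := H1cG_slice L10 L20 (weak_tensor_xx Lu L10 L20 W10 W20).
  have Q2 := L2GT_ae_L2G Lu; have Q3 := L2GT_ae_L2G L02.
  have Q4 j : \forall t \ae mu, @torus R t -> \forall x \ae mu, @gdom R j x ->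
      Dw 0 2 u j (x, t) - Dw 2 0 u j (x, t) + alpha * u j (x, t) = nonlin s p (u j (x, t)).
    exact: (ae_sec2 (P := fun z => Dw 0 2 u j z - Dw 2 0 u j z + alpha * u j z = nonlin s p (u j z)) (PS j)).
  have Q := ae_and (ae_and Q1 (ae_and Q2 Q3))
    (ae_and cK (ae_and (Q4 mid) (ae_and (Q4 up) (Q4 low)))).
  move: Q; apply: ae_imp => t [[q1 [q2 q3]] [K [e1 [e2 e3]]]] Tt.
  have [L1 L2 A] := q1 Tt.
  have E (j : branch) : \forall x \ae mu, @gdom R j x ->
      slice (Dw 0 2 u) t j x - slice (Dw 2 0 u) t j x + alpha * slice u t j x = nonlin s p (slice u t j x).
    by case: j; [exact: (e1 Tt)|exact: (e2 Tt)|exact: (e3 Tt)].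
  exact: (slice_identity (q2 Tt) (q3 Tt) L2 L1 A (K Tt) E).
by move: W; apply: ae_imp => t H _.
Qed.

Lemma HGT_evolution_space u : HGT 2 u -> condC u -> evolution_space u.
Proof.
move=> Hu cC; split; last exact: bochner_Hm_slice.
have [L10 W10] := DwP (i := 1) (k := 0) Hu isT.
have Lu : L2GT u by case: Hu.
by apply: bochner_L2_H1c cC; [|exact: L10|exact: weak_tensor_x].
Qed.

Lemma HGT_time_traces u : HGT 2 u ->
  exists u0 u1 : gfun R, time_trace (slice u) 0 u0 /\ time_trace (slice (Dw 0 1 u)) 0 u1.
Proof.
move=> Hu; have Lu : L2GT u by case: Hu.
have [L01 W01] := DwP (i := 0) (k := 1) Hu isT.
have [L02 W02] := DwP (i := 0) (k := 2) Hu isT.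
exists (trace0 u (Dw 0 1 u)), (trace0 (Dw 0 1 u) (Dw 0 2 u)); split; apply: trace0_trace => //.
  exact: weak_tensor_t.
exact: (weak_tensor_tt Lu).
Qed.

End Evolution.

(** * From the evolution identity to the Kirchhoff conditions *)

Section Kirchhoff.
Variable R : realType.
Local Notation mu := (@lebesgue_measure R).
Implicit Types (n : int) (j : branch).

Lemma rend_sub_lend n j : rend R n j - lend R n j = pi.
Proof. by case: j; rewrite /rend /lend /va /vb ?intrD; ring. Qed.

Lemma intg_extend (D E : set R) (f : R -> R) : measurable D -> measurable E -> E `<=` D ->
  (forall x, D x -> ~ E x -> f x = 0) -> intg mu E f ->
  intg mu D f /\ \int[mu]_(x in D) f x = \int[mu]_(x in E) f x.
Proof.
move=> mD mE ED f0 fi.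
have DE : D `&` E = E by exact: setIidr.
have H x : x \in D -> f x = (f \_ E) x.
  rewrite inE => Dx; rewrite patchE; case: ifPn => // /negP xE; apply: f0 => // Ex; apply: xE; exact: mem_set.
have iD : intg mu D (f \_ E).
  by rewrite -restrict_EFin; apply/integrable_restrict => //; rewrite DE.
split.
  by apply: eq_integrable iD => // x Dx /=; rewrite H.
have -> : \int[mu]_(x in D) f x = \int[mu]_(x in D) ((f \_ E) x) by apply: eq_Rintegral => x; exact: H.
by rewrite -Rintegral_mkcondr DE.
Qed.

(** Bounded functions that vanish eventually at every x <> c integrate to 0 in the
    limit, against any integrable function (dominated convergence). *)
Lemma Rintegral_concentrating (E : set R) (h : R -> R) (th : nat -> R -> R) (c M : R) : measurable E ->
  intg mu E h -> (forall k, continuous (th k)) -> (forall k x, `|th k x| <= M) ->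
  (forall x, x != c -> \forall k \near \oo, th k x = 0) ->
  (fun k => \int[mu]_(x in E) (h x * th k x)) @ \oo --> (0 : R).
Proof.
move=> mE hi cth bth th0.
have mth k : measurable_fun E (th k) by apply: measurable_funTS; exact: continuous_measurable_fun.
have mh := intg_meas hi.
have ti k : intg mu E (fun x => h x * th k x) .
  by apply: (intgM (M := M)) => //; apply: measurable_funTS; exact: continuous_measurable_fun.
have := @dominated_convergence _ _ _ mu E mE (fun k x => (h x * th k x)%:E) (cst 0%E) (fun x => (M * `|h x|)%:E).
case.
- by move=> k; exact: measurable_int (ti k).
- exact: measurable_cst.
- have := ae_neq c; apply: ae_imp => x /eqP xc _; apply: cvg_near_cst.
  by have := th0 x xc; apply: filterS => k ->; rewrite mulr0.
- by apply: intgZ => //; exact: integrable_norm.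
- by apply: aeW => x k _; rewrite lee_fin normrM mulrC ler_wpM2r.
move=> _ _; rewrite integral0.
under eq_fun do rewrite integral_EFin//.
by move=> /fine_cvgP [_].
Qed.

(** The i-th derivative of a bump of height 1 at c with support
    [c - 3 / (k + 1), c + 3 / (k + 1)]. *)
Definition bump (c : R) (k i : nat) : R -> R := plat k.+1%:R (c - 3 / k.+1%:R) c i.

Lemma bump_out c k i x : (i <= 2)%N -> 3 / k.+1%:R < `|x - c| -> bump c k i x = 0.
Proof.
move=> i2 xc; have k0 : 0 < k.+1%:R :> R by rewrite ltr0n.
have k3 : 0 < 3 / k.+1%:R :> R by rewrite divr_gt0.
apply: plat_out => //; first by rewrite lerBlDr lerDl ltW.
move=> /andP[h1 h2]; move: xc; apply/negP; rewrite -leNgt.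
by rewrite ler_distl h1.
Qed.

Lemma bump_c c k : bump c k 0 c = 1.
Proof.
have k0 : k.+1%:R != 0 :> R by rewrite pnatr_eq0.
rewrite /bump /plat expr0 mul1r subrr mulr0 (@spl_le0 R 0 0)// subr0 spl_ge3//.
by have -> : k.+1%:R * (c - (c - 3 / k.+1%:R)) = 3 :> R by field.
Qed.

Lemma bump_bound : exists M : R, forall c k x, `|bump c k 0 x| <= M.
Proof.
have [M M0 HM] := @bounded_spl R 0 isT; exists (M + M) => c k x.
by rewrite /bump /plat expr0 mul1r; apply: (le_trans (ler_normB _ _)); apply: lerD.
Qed.

Lemma bump_small (c : R) e : 0 < e -> \forall k \near \oo, 3 / k.+1%:R < e :> R.
Proof.
move=> e0; near=> k.
rewrite ltr_pdivrMr ?ltr0n// mulrC -ltr_pdivrMr//.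
apply: (lt_trans (truncnS_gt _)); rewrite ltr_nat ltnS.
near: k; exact: nbhs_infty_gt.
Unshelve. all: by end_near.
Qed.

(** A bump, taken on all edges, is in H^1_c, and its weak derivative is its
    derivative. *)
Lemma bump_H1c c k : H1cG (fun _ => bump c k 0) /\
  forall j, \forall x \ae mu, @gdom R j x -> dw (fun _ => bump c k 0) j x = bump c k 1 x.
Proof.
have L i : (i <= 2)%N -> @L2G R (fun _ => bump c k i).
  move=> i2; apply: intg_L2G.
    by move=> j; apply: measurable_funTS; apply: continuous_measurable_fun; exact: continuous_plat.
  move=> j; pose e : R := 3 / k.+1%:R.
  have H : intg mu setT (fun x => bump c k i x ^+ 2).
    apply: (proj1 (@intg_extend setT `[c - e, c + e] _ _ _ _ _ _)) => //.
      move=> x _ nx; rewrite bump_out// ?expr0n//; rewrite ltNge; apply/negP => xc; apply: nx.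
      by rewrite /= in_itv/=; move: xc; by rewrite ler_distl.
    apply: intg_cont => x; apply: cvgM; exact: continuous_plat.
  by apply: intgS H.
have A n j : AC_edge n j (bump c k 0) (bump c k 1).
  exists (bump c k 0 (lend R n j)); apply: aeW => x; rewrite /edge/= in_itv/= => /andP[lx _].
  have D (y : R) : is_derive y 1 (bump c k 0) (bump c k 1 y) by exact: is_derive_plat.
  exact: (C1_prim D (@continuous_plat _ _ _ _ 1) lx).
have V n j (y : R) : lend R n j <= y <= rend R n j -> vertex_value (fun _ => bump c k 0) n j y (bump c k 0 y).
  move=> yI; have [C0 HC] := A n j.
  have := AC_vertex (lend_lt_rend R n j) yI (L2G_edge n j (L 1%N isT)).
  move=> /(_ (bump c k 0) (bump c k 0 (lend R n j))).
  have D (z : R) : is_derive z 1 (bump c k 0) (bump c k 1 z) by exact: is_derive_plat.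
  rewrite -(C1_prim D (@continuous_plat _ _ _ _ 1) (proj1 (andP yI))).
  apply; apply: aeW => x; rewrite /edge/= in_itv/= => /andP[lx _].
  exact: (C1_prim D (@continuous_plat _ _ _ _ 1) lx).
split; last by apply: dw_AC => //; exact: L.
split.
  split; first exact: L.
  exists (fun _ => bump c k 1); split; first exact: L.
  by apply: AC_weak_deriv => //; exact: L.
move=> n; split.
  exists (bump c k 0 (va R n)); split; apply: V.
  - exact: rend_I.
  - exact: lend_I.
  - exact: lend_I.
exists (bump c k 0 (vb R n)); split; apply: V.
- exact: lend_I.
- exact: rend_I.
- exact: rend_I.
Qed.

Section TestedIdentity.
Variables (s : bool) (p alpha : R) (u0 v z w : gfun R).
Hypotheses (p1 : 1 < p) (Lu : L2G u0) (Lv : L2G v) (Lz : L2G z) (Lw : L2G w).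
Hypotheses (Au : forall n j, AC_edge n j (u0 j) (w j)) (Aw : forall n j, AC_edge n j (w j) (z j)).
Hypothesis test : forall phi, H1cG phi ->
    gint (fun j x => v j x * phi j x + w j x * dw phi j x + alpha * u0 j x * phi j x
      - nonlin s p (u0 j x) * phi j x) = 0%E.

Let N j x := nonlin s p (u0 j x).

Lemma nonlin_bound (b y : R) : `|y| <= b -> `|nonlin s p y| <= b `^ (p - 1) * b.
Proof.
move=> yb; have b0 : 0 <= b by apply: le_trans yb.
rewrite /nonlin !normrM normrX normrN1 expr1n mul1r ger0_norm ?powR_ge0//.
apply: ler_pM; rewrite ?powR_ge0//.
by apply: ge0_ler_powR; rewrite ?nnegrE// subr_ge0 ltW.
Qed.

(** On an edge u0 is absolutely continuous, hence bounded, and so is its power. *)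
Lemma nonlin_intg n j : intg mu (@edge R n j) (N j).
Proof.
have [C HC] := Au n j; have wi := L2G_edge n j Lw; have lr := lend_lt_rend R n j.
have mP : measurable_fun (@edge R n j) (fun x => C + prim (lend R n j) (w j) x).
  by apply: measurable_funD => //; exact: prim_meas (ltW lr) wi.
pose b := `|C| + \int[mu]_(x in @edge R n j) `|w j x|.
have H : intg mu (@edge R n j) (fun x => nonlin s p (C + prim (lend R n j) (w j) x)).
  apply: (@intg_le _ _ _ mu _ _ (cst (b `^ (p - 1) * b))) => //.
  - exact: measurable_nonlin.
  - move=> x; rewrite /edge/= in_itv/= => /andP[_ xr]; apply: nonlin_bound.
    by apply: (le_trans (ler_normD _ _)); rewrite lerD2l; exact: prim_bound xr wi.
  - by apply: intg_cont => x; exact: cvg_cst.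
apply: ae_eq_intg H => //.
  apply: measurable_nonlin; exact: intg_meas (L2G_edge n j Lu).
by move: HC; apply: ae_imp => x HC Ix; rewrite /N HC.
Qed.

Let q j x := v j x - z j x + alpha * u0 j x - N j x.

Lemma residual_intg n j : intg mu (@edge R n j) (q j).
Proof.
apply: intgB => //; last exact: nonlin_intg.
apply: intgD => //; last by apply: intgZ => //; exact: L2G_edge.
by apply: intgB => //; exact: L2G_edge.
Qed.

(** Integration by parts in the tested identity on one edge; q is the residual of
    the equation. *)
Lemma edge_test n j C (th th' : R -> R) : (forall x : R, is_derive x 1 th (th' x)) -> continuous th -> continuous th' ->
  (\forall x \ae mu, @edge R n j x -> w j x = C + prim (lend R n j) (z j) x) ->
  intg mu (@edge R n j) (fun x => v j x * th x + w j x * th' x + alpha * u0 j x * th x - N j x * th x) /\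
  \int[mu]_(x in @edge R n j) (v j x * th x + w j x * th' x + alpha * u0 j x * th x - N j x * th x) =
  \int[mu]_(x in @edge R n j) (q j x * th x) +
   ((C + prim (lend R n j) (z j) (rend R n j)) * th (rend R n j) - C * th (lend R n j)).
Proof.
move=> dth cth cth' HC.
have lr := lend_lt_rend R n j.
have wi := L2G_edge n j Lw; have zi := L2G_edge n j Lz.
rewrite -(ibp_C1 (ltW lr) wi zi HC dth cth').
have i1 : intg mu (@edge R n j) (fun x => q j x * th x) by apply: intg_mul_cont => //; exact: residual_intg.
have i2 : intg mu (@edge R n j) (fun x => w j x * th' x + z j x * th x).
  by apply: intgD => //; apply: intg_mul_cont.
have ID : \int[mu]_(x in @edge R n j) (q j x * th x + (w j x * th' x + z j x * th x)) =
  \int[mu]_(x in @edge R n j) (q j x * th x) + \int[mu]_(x in @edge R n j) (w j x * th' x + z j x * th x).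
  by rewrite RintegralD.
rewrite -ID.
have E x : v j x * th x + w j x * th' x + alpha * u0 j x * th x - N j x * th x =
   q j x * th x + (w j x * th' x + z j x * th x) by rewrite /q; ring.
split; last by apply: eq_Rintegral => x _; exact: E.
by apply: eq_intg (intgD _ i1 i2) => // x; rewrite -E.
Qed.

(** At a vertex c, which is the end point of the edges (M j, j), on their right if
    b j holds, the values of w with the sign + for right and - for left end
    points add up to 0.  The identity is tested with the bumps at c. *)
Lemma vertex_balance (c : R) (M : branch -> int) (b : branch -> bool) (C : branch -> R) :
  (forall j, \forall x \ae mu, @edge R (M j) j x -> w j x = C j + prim (lend R (M j) j) (z j) x) ->
  (forall j, c = if b j then rend R (M j) j else lend R (M j) j) ->
  (forall j x, @gdom R j x -> `|x - c| < pi -> @edge R (M j) j x) ->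
  let W j := (if b j then 1 else -1) * (C j + prim (lend R (M j) j) (z j) c) in
  W mid + W up + W low = 0.
Proof.
move=> HC cE gE W.
pose I (k : nat) j := \int[mu]_(x in @edge R (M j) j) (q j x * bump c k 0 x).
have p0 := pi_gt0 R.
(* Once the bump is narrower than the edges, only the three edges at c matter. *)
have key : \forall k \near \oo, (I k mid + W mid) + (I k up + W up) + (I k low + W low) = 0.
  have := bump_small c p0; apply: filterS => k k3.
  have [Hb db] := bump_H1c c k.
  have o i x : (i <= 2)%N -> pi <= `|x - c| -> bump c k i x = 0.
    by move=> i2 xp; apply: bump_out => //; exact: lt_le_trans k3 xp.
  pose F j x := v j x * bump c k 0 x + w j x * bump c k 1 x + alpha * u0 j x * bump c k 0 x - N j x * bump c k 0 x.
  have FE j : intg mu (@gdom R j) (F j) /\ \int[mu]_(x in @gdom R j) F j x = I k j + W j.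
    have d (x : R) : is_derive x 1 (bump c k 0) (bump c k 1 x) by exact: is_derive_plat.
    have [i1 E1] := edge_test d (@continuous_plat _ _ _ _ 0) (@continuous_plat _ _ _ _ 1) (HC j).
    have [i2 E2] : intg mu (@gdom R j) (F j) /\ \int[mu]_(x in @gdom R j) F j x = \int[mu]_(x in @edge R (M j) j) F j x.
      apply: intg_extend => //; first exact: edge_sub.
      move=> x gx nx; have xp : pi <= `|x - c| by rewrite leNgt; apply/negP => /(gE j x gx).
      by rewrite /F !o// !mulr0 !addr0 subr0.
    split=> //; rewrite E2 E1 /I; congr (_ + _); rewrite /W.
    have rl := rend_sub_lend (M j) j.
    move: (cE j); case: (b j) => cj.
      rewrite -cj bump_c o//; first by rewrite mulr0 subr0 mul1r mulr1.
      by rewrite cj distrC rl ger0_norm// ltW.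
    rewrite -cj bump_c o//; first by rewrite mulr0 prim_aa addr0 mulr1 sub0r mulN1r.
    by rewrite cj rl ger0_norm// ltW.
  have := test Hb.
  rewrite (@gint_ae_eq _ _ F); first last.
  - by move=> j; move: (db j); apply: ae_imp => x + gx => /(_ gx) ->.
  - by move=> j; exact: intg_meas (FE j).1.
  - move=> j; have [[Lb _] _] := Hb; have [Ld _] := dwP Hb.1.
    have mf (f : gfun R) : L2G f -> measurable_fun (@gdom R j) (f j) by move=> [].
    have mb := mf _ Lb; have md := mf _ Ld.
    apply: measurable_funB; last by apply: measurable_funM => //; apply: measurable_nonlin; exact: mf.
    apply: measurable_funD; last by apply: measurable_funM => //; apply: measurable_funM => //; exact: mf.
    by apply: measurable_funD; apply: measurable_funM => //; exact: mf.
  rewrite gint_intg; last by move=> j; exact: (FE j).1.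
  by move=> [] ; rewrite !(FE _).2.
have [B HB] := bump_bound.
have I0 j : (fun k => I k j) @ \oo --> (0 : R).
  apply: (@Rintegral_concentrating _ (q j) (fun k => bump c k 0) c B) => //.
  - exact: residual_intg.
  - by move=> k; exact: continuous_plat.
  - move=> x xc; have xc0 : 0 < `|x - c| by rewrite normr_gt0 subr_eq0.
    by have := bump_small c xc0; apply: filterS => k; exact: bump_out.
have lim : (fun k => (I k mid + W mid) + (I k up + W up) + (I k low + W low)) @ \oo --> (0 + W mid) + (0 + W up) + (0 + W low).
  by apply: cvgD; [apply: cvgD|]; (apply: cvgD; [exact: I0|exact: cvg_cst]).
rewrite !add0r in lim.
have lim0 : (fun k => (I k mid + W mid) + (I k up + W up) + (I k low + W low)) @ \oo --> (0 : R).
  exact: cvg_near_cst.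
exact: (cvg_unique _ lim lim0).
Qed.

Lemma pi2_lt (m n : int) : 2 * pi * m%:~R < 2 * pi * (n%:~R + 1) :> R -> m <= n.
Proof.
have p0 := pi_gt0 R.
rewrite ltr_pM2l; last by rewrite mulr_gt0.
by rewrite -[1](mulr1z) -intrD ltr_int ltzD1.
Qed.

Lemma near_va n j x : @gdom R j x -> `|x - va R n| < pi -> @edge R n j x.
Proof.
have p0 := pi_gt0 R.
move=> [m _ mx]; rewrite ltr_norml => /andP[h1 h2].
suff -> : n = m by [].
move: mx h1 h2; rewrite /edge/= in_itv/= /lend /rend /va /vb ?intrD => /andP[m1 m2] h1 h2.
apply/eqP; rewrite eq_le; apply/andP; split; apply: pi2_lt.
  by case: j m1 m2; lra.
by case: j m1 m2; lra.
Qed.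

Lemma near_vb n j x : @gdom R j x -> `|x - vb R n| < pi -> @edge R (if j is mid then n + 1 else n) j x.
Proof.
have p0 := pi_gt0 R.
move=> [m _ mx]; rewrite ltr_norml => /andP[h1 h2].
suff -> : (if j is mid then n + 1 else n) = m by [].
move: mx h1 h2; rewrite /edge/= in_itv/= /lend /rend /va /vb ?intrD => /andP[m1 m2] h1 h2.
apply/eqP; rewrite eq_le; apply/andP; split; apply: pi2_lt.
  by case: j m1 m2; rewrite ?intrD; lra.
by case: j m1 m2; rewrite ?intrD; lra.
Qed.

Lemma tested_kirchhoff : kirchhoff w.
Proof.
have zi n j := L2G_edge n j Lz.
have vv n j c C : lend R n j <= c <= rend R n j ->
    (\forall x \ae mu, @edge R n j x -> w j x = C + prim (lend R n j) (z j) x) ->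
    vertex_value w n j c (C + prim (lend R n j) (z j) c).
  by move=> cI HC; exact: AC_vertex (lend_lt_rend R n j) cI (zi n j) HC.
have AC (M : branch -> int) : exists C : branch -> R,
    forall j, \forall x \ae mu, @edge R (M j) j x -> w j x = C j + prim (lend R (M j) j) (z j) x.
  have [C0 H0] := Aw (M mid) mid; have [C1 H1] := Aw (M up) up; have [C2 H2] := Aw (M low) low.
  by exists (fun j => match j with mid => C0 | up => C1 | low => C2 end); case.
move=> n; split.
  have [C HC] := AC (fun _ => n).
  have cE j : va R n = if (if j is mid then true else false) then rend R n j else lend R n j by case: j.
  have /= := vertex_balance HC cE (@near_va n).
  set a := C mid + _; set b := C up + _; set c := C low + _ => H.
  have := vv _ _ _ _ (rend_I R n mid) (HC mid); have := vv _ _ _ _ (lend_I R n up) (HC up).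
  have := vv _ _ _ _ (lend_I R n low) (HC low) => V3 V2 V1.
  by exists a, b, c; split; [exact: V1|exact: V2|exact: V3|move: H; rewrite !mulN1r mul1r => /eqP; rewrite -addrA -opprD subr_eq0 => /eqP].
have [C HC] := AC (fun j => if j is mid then n + 1 else n).
have cE j : vb R n = let m := (if j is mid then n + 1 else n) in
  if (if j is mid then false else true) then rend R m j else lend R m j by case: j.
have /= := vertex_balance HC cE (@near_vb n).
set a := C mid + _; set b := C up + _; set c := C low + _ => H.
have := vv _ _ _ _ (lend_I R (n + 1) mid) (HC mid); have := vv _ _ _ _ (rend_I R n up) (HC up).
have := vv _ _ _ _ (rend_I R n low) (HC low) => V3 V2 V1.
exists a, b, c; split; [exact: V1|exact: V2|exact: V3|].
by move: H; rewrite mulN1r !mul1r -addrA addrC => /eqP; rewrite subr_eq0 => /eqP.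
Qed.

End TestedIdentity.

Lemma evolution_identity_condK (s : bool) (p alpha : R) (u : gfun2 R) : 1 < p -> HGT 2 u ->
  evolution_identity s p alpha u -> condK u.
Proof.
move=> p1 Hu EI.
have Lu : L2GT u by case: Hu.
have [L10 W10] := DwP (i := 1) (k := 0) Hu isT.
have [L20 W20] := DwP (i := 2) (k := 0) Hu isT.
have [L02 W02] := DwP (i := 0) (k := 2) Hu isT.
have Q1 := H1cG_slice L10 L20 (weak_tensor_xx Lu L10 L20 W10 W20).
have Q2 := H1cG_slice Lu L10 (weak_tensor_x Lu L10 W10).
have Q3 := L2GT_ae_L2G L02.
have Q := ae_and (ae_and Q1 (ae_and Q2 Q3))
  (ae_and EI (ae_neq 0)).
move: Q; apply: ae_imp => t [[q1 [q2 q3]] [e t0]] Tt.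
have tp : 0 < t by move: (Tt); rewrite /torus/= in_itv/= => /andP[]; rewrite le_eqVlt => /predU1P[E|//]; rewrite E in t0.
have [L1 L2 A] := q1 Tt; have [Lut _ Au] := q2 Tt.
exact: (tested_kirchhoff p1 Lut (q3 Tt) L2 L1 Au A (e tp)).
Qed.

End Kirchhoff.

Theorem theorem1p4 (R : realType) (p alpha : R) (s : bool) (u : gfun2 R) :
  1 < p -> 0 <= alpha ->
  H1cGT u -> HGT 2 u ->
  (antiperiodic_2pi u -> up_low_symmetric u ->
   weak_solution s p alpha u -> pointwise_solution s p alpha u ->
   condC u -> condK u ->
   [/\ evolution_space u,
       evolution_identity s p alpha u &
       exists u0 u1 : gfun R,
         time_trace (slice u) 0 u0 /\ time_trace (slice (Dw 0 1 u)) 0 u1])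
  /\
  (evolution_space u -> evolution_identity s p alpha u ->
   condC u /\ condK u).
Proof.
move=> p1 _ _ Hu; split=> [_ _ _ PS cC cK|[[sp _ _] _] EI].
  split; first exact: HGT_evolution_space.
    exact: pointwise_evolution_identity.
  exact: HGT_time_traces.
split; last exact: evolution_identity_condK EI.
by move: sp; apply: ae_imp => t + Tt => /(_ Tt) [].
Qed.
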